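(* Let $K$ be the subgroup of $\mathrm{Alt}(9)$ which normalizes $\langle (1,2,3), (4,5,6), (7,8,9)\rangle$, that is, $$K= \langle (1,2,3),\; (1,4,7)(2,5,8)(3,6,9),\; (1,2)(4,5),\; (1,4)(2,5)(3,6)(7,8)\rangle .$$ Suppose $G$ is a finite group, $H \le G$ with $H \cong K$ and $J= O_3(H)$. If $C_G(j) \le H$ for all $j \in J^\#$ and $J$ is strongly closed in $H$ with respect to $G$, then $G=H$.
   Context: $O_3(H)$ is the largest normal $3$-subgroup of $H$ and $J^\#=J\setminus\{1\}$. ''$J$ is strongly closed in $H$ with respect to $G$'' means that $J^g\cap H\le J$ for all $g\in G$, where $J^g=g^{-1}Jg$. (Under $H\cong K$, $J$ corresponds to $\langle (1,2,3), (4,5,6), (7,8,9)\rangle$.) *)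

(* Defs.v *)
From mathcomp Require Import all_boot all_fingroup all_solvable.

Set Implicit Arguments.
Unset Strict Implicit.
Unset Printing Implicit Defensive.

Local Open Scope group_scope.

(* The points 1, ..., 9 permuted by Alt(9) are the elements 0, ..., 8 of 'I_9. *)
Definition pt (k : nat) : 'I_9 := inord k.-1.

Definition cyc2 (i j : nat) : {perm 'I_9} := tperm (pt i) (pt j).

(* Permutations are composed from left to right, so that for distinct i, j, k
   this is i |-> j |-> k |-> i. *)
Definition cyc3 (i j k : nat) : {perm 'I_9} := cyc2 i j * cyc2 i k.

Definition E27 : {group {perm 'I_9}} :=
  <<[set cyc3 1 2 3; cyc3 4 5 6; cyc3 7 8 9]>>%G.

(* [K648_gen] below proves that this normalizer is generated by [K648_gens]. *)
Definition K648 : {group {perm 'I_9}} := 'N_('Alt_('I_9))(E27)%G.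

Definition strongly_closed (gT : finGroupType) (J H G : {set gT}) : Prop :=
  forall g, g \in G -> J :^ g :&: H \subset J.

Definition K648_gens : seq {perm 'I_9} :=
  [:: cyc3 1 2 3;
      cyc3 1 4 7 * cyc3 2 5 8 * cyc3 3 6 9;
      cyc2 1 2 * cyc2 4 5;
      cyc2 1 4 * cyc2 2 5 * cyc2 3 6 * cyc2 7 8].

Section Generators.

Let acts (g : {perm 'I_9}) (l : seq nat) :=
  forall i : 'I_9, val (g i) = nth 0 l i.

Let comp (l m : seq nat) := [seq nth 0 m k | k <- l].

Let swap i j := [seq if k == i.-1 then j.-1 else if k == j.-1 then i.-1 else k
                | k <- iota 0 9].

Let acts_cyc2 i j : 0 < i <= 9 -> 0 < j <= 9 -> acts (cyc2 i j) (swap i j).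
Proof.
case: i j => [//|i] [//|j] ilt jlt k.
rewrite /swap (nth_map 0) ?size_iota // nth_iota // add0n /cyc2 /= permE /=.
rewrite -!val_eqE /= (inordK ilt) (inordK jlt) !(fun_if val) /=.
by rewrite (inordK ilt) (inordK jlt).
Qed.

Let actsM g h l m : acts g l -> size l = 9 -> acts h m ->
  acts (g * h) (comp l m).
Proof.
by move=> gl sl hm k; rewrite permM hm gl (nth_map 0) // sl.
Qed.

Let acts_inj g h l : acts g l -> acts h l -> g = h.
Proof. by move=> gl hl; apply/permP=> i; apply: val_inj; rewrite gl hl. Qed.

Let acts_cyc3 i j k : 0 < i <= 9 -> 0 < j <= 9 -> 0 < k <= 9 ->
  acts (cyc3 i j k) (comp (swap i j) (swap i k)).
Proof. by move=> hi hj hk; apply: actsM; do ?apply: acts_cyc2. Qed.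

Let table n : seq nat := nth (iota 0 9)
  [:: [:: 1; 2; 0; 3; 4; 5; 6; 7; 8];
      [:: 3; 4; 5; 6; 7; 8; 0; 1; 2];
      [:: 1; 0; 2; 4; 3; 5; 6; 7; 8];
      [:: 3; 4; 5; 0; 1; 2; 7; 6; 8]]%N n.

Let acts1 : acts 1 (iota 0 9).
Proof. by move=> i; rewrite perm1 nth_iota. Qed.

Let acts_gen n : acts (nth 1 K648_gens n) (table n).
Proof.
case: n => [|[|[|[|n]]]] /=; last by rewrite /table !nth_default.
- exact: acts_cyc3.
- by apply: (actsM (actsM (acts_cyc3 _ _ _) _ (acts_cyc3 _ _ _)) _ (acts_cyc3 _ _ _)).
- by apply: (actsM (acts_cyc2 _ _) _ (acts_cyc2 _ _)).
by apply: (actsM (actsM (actsM (acts_cyc2 _ _) _ (acts_cyc2 _ _)) _ (acts_cyc2 _ _))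
             _ (acts_cyc2 _ _)).
Qed.

Let size_table n : size (table n) = 9.
Proof. by case: n => [|[|[|[|n]]]] //; rewrite /table nth_default. Qed.

Let word (w : seq nat) := foldr (fun n g => nth 1 K648_gens n * g) 1 w.
Let wtable (w : seq nat) := foldr (fun n l => comp (table n) l) (iota 0 9) w.

Let acts_word w : acts (word w) (wtable w).
Proof. by elim: w => //= n w IHw; apply: actsM (acts_gen n) _ IHw. Qed.

Let K648_genG := <<[set x in K648_gens]>>%G.

Let gen_nth n : nth 1 K648_gens n \in K648_genG.
Proof.
have [ltn|len] := ltnP n (size K648_gens); last by rewrite nth_default.
by rewrite mem_gen // inE mem_nth.
Qed.

Let word_gen w : word w \in K648_genG.
Proof. by elim: w => //= n w IHw; rewrite groupM ?gen_nth. Qed.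

Let blk (i : nat) := i %/ 3.

Let keeps (s : {perm 'I_9}) := [forall i, blk (s i) == blk i].

Let E27_words : E27 :=: <<[set word [:: 0]; word [:: 1; 1; 0; 1]%N; word [:: 1; 0; 1; 1]%N]>>.
Proof.
have E i w (h : i < 7) : comp (swap i.+1 i.+2) (swap i.+1 i.+3) = wtable w ->
    cyc3 i.+1 i.+2 i.+3 = word w.
  move=> e; apply: (@acts_inj _ _ (wtable w)) => //; rewrite -e.
  by apply: acts_cyc3; rewrite /= ?(leq_trans h) // ltnW // ltnW.
by congr <<_>>; rewrite (E 0 [:: 0]) // (E 3 [:: 1; 1; 0; 1]%N) // (E 6 [:: 1; 0; 1; 1]%N).
Qed.

Let E27_keeps s : s \in E27 -> keeps s.
Proof.
pose A := [set s | keeps s].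
have gA : group_set A.
  apply/group_setP; split=> [|x y]; first by rewrite inE; apply/forallP=> i; rewrite perm1.
  rewrite !inE => /forallP kx /forallP ky; apply/forallP=> i.
  by rewrite permM (eqP (ky _)) (eqP (kx _)).
suff: E27 \subset Group gA by move/subsetP=> sub /sub; rewrite inE.
rewrite E27_words gen_subG; apply/subsetP=> x; rewrite !inE -orbA.
by case/or3P=> /eqP->; apply/forallP=> i; rewrite /blk acts_word;
  case: i => -[|[|[|[|[|[|[|[|[|//]]]]]]]]].
Qed.

Let Ewords := [:: [:: 0]; [:: 1; 1; 0; 1]; [:: 1; 0; 1; 1]]%N.

Let Eword k := nth [::] Ewords k.

Let Eword_E27 k : word (Eword k) \in E27.
Proof.
rewrite E27_words; case: k => [|[|[|k]]]; last by rewrite /Eword nth_default ?group1.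
all: by apply: mem_gen; rewrite !inE eqxx ?orbT.
Qed.

Let size_wtable w : size (wtable w) = 9.
Proof. by case: w => [|n w] //=; rewrite size_map. Qed.

Let acts_exp w e :
  acts (word w ^+ e) (iter e (comp (wtable w)) (iota 0 9)).
Proof. by elim: e => //= e IHe; rewrite expgS; apply: actsM IHe. Qed.

Let E27_trans (i j : 'I_9) : blk i = blk j -> exists2 s, s \in E27 & s i = j.
Proof.
move=> eqb; exists (word (Eword (blk i)) ^+ (j + 3 - i)).
  by rewrite groupX ?Eword_E27.
apply: val_inj; rewrite acts_exp; move: eqb.
by case: i j => -[|[|[|[|[|[|[|[|[|//]]]]]]]]] ? [-[|[|[|[|[|[|[|[|[|//]]]]]]]]] ?].
Qed.

Let normE27_keeps x (i j : 'I_9) :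
  x \in 'N(E27) -> blk i = blk j -> blk (x i) = blk (x j).
Proof.
move=> nx /E27_trans[s sE <-].
have /E27_keeps/forallP/(_ (x i))/eqP <- : s ^ x \in E27 by rewrite memJ_norm.
by rewrite permJ.
Qed.

Let odd_cyc2 i j : 0 < i <= 9 -> 0 < j <= 9 -> odd_perm (cyc2 i j) = (i != j).
Proof.
case: i j => [//|i] [//|j] ilt jlt.
by rewrite odd_tperm -val_eqE /= (inordK ilt) (inordK jlt).
Qed.

Let gen_even n : ~~ odd_perm (nth 1 K648_gens n).
Proof.
case: n => [|[|[|[|n]]]] /=; last by rewrite nth_default ?odd_perm1.
all: by rewrite !odd_permM !odd_cyc2.
Qed.

Let word_cat v w : word (v ++ w) = word v * word w.
Proof. by elim: v => /= [|n v ->]; rewrite ?mul1g ?mulgA. Qed.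

Let gen_norm n : nth 1 K648_gens n \in 'N(E27).
Proof.
pose im := nth [::] (nth [::]
  [:: Ewords;
      [:: Eword 1; Eword 2; Eword 0];
      [:: Eword 0 ++ Eword 0; Eword 1 ++ Eword 1; Eword 2];
      [:: Eword 1; Eword 0; Eword 2 ++ Eword 2]]%N n).
have [ltn|len] := ltnP n 4; last by rewrite nth_default ?group1.
have conjE k : k < 3 -> word (Eword k) ^ nth 1 K648_gens n = word (im k).
  move=> ltk; apply: (mulgI (nth 1 K648_gens n)); rewrite -conjgC.
  have -> : nth 1 K648_gens n = word [:: n] by rewrite /= mulg1.
  rewrite -!word_cat.
  apply: (@acts_inj _ _ (wtable ([:: n] ++ im k))) => //.
  suff <-: wtable (Eword k ++ [:: n]) = wtable ([:: n] ++ im k) by [].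
  by move: ltn ltk @im; case: n k => [|[|[|[|//]]]] [|[|[|//]]].
have imE k : k < 3 -> word (im k) \in E27.
  move=> ltk; suff [i [->|->]]: exists i, im k = Eword i \/ im k = Eword i ++ Eword i.
  - exact: Eword_E27.
  - by rewrite word_cat groupM ?Eword_E27.
  by rewrite /im; move: ltn ltk; case: n k {im conjE} => [|[|[|[|//]]]] [|[|[|//]]] _ _;
    first [by exists 0; auto | by exists 1%N; auto | by exists 2%N; auto].
rewrite inE {1}E27_words -genJ gen_subG; apply/subsetP=> _ /imsetP[x + ->].
by rewrite !inE -orbA => /or3P[]/eqP->;
  [rewrite (conjE 0) ?imE | rewrite (conjE 1%N) ?imE | rewrite (conjE 2) ?imE].
Qed.

Let gen_sub_K648 : K648_genG \subset K648.
Proof.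
rewrite gen_subG; apply/subsetP=> x; rewrite inE => xg.
rewrite -(nth_index 1 xg) inE Alt_even gen_even; exact: gen_norm.
Qed.

(* For a permutation x in K648 fixing all points below k, right multiplication
   by the word of index x k in the k-th list yields one that also fixes k. *)
Let transversal k : seq (seq nat) := nth [::]
  [:: [:: [::]; [:: 2]; [:: 0]; [:: 3]; [:: 2; 3]; [:: 3; 0]; [:: 1]; [:: 1; 2];
          [:: 1; 0]];
      [:: [::]; [::]; [:: 0; 2]];
      [::];
      [:: [::]; [::]; [::]; [::]; [:: 1; 1; 2; 1]; [:: 3; 0; 3]; [:: 1; 3];
          [:: 3; 1; 1]; [:: 1; 0; 3]];
      [:: [::]; [::]; [::]; [::]; [::]; [:: 1; 1; 0; 2; 1]];
      [::];
      [:: [::]; [::]; [::]; [::]; [::]; [::]; [::]; [:: 1; 0; 0; 1; 1];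
          [:: 1; 0; 1; 1]]]%N k.

Let allowed k v :=
  (k <= v) && all (fun i => (blk k == blk i) ==> (blk v == blk i)) (iota 0 k).

Let moves_back k v :=
  let l := wtable (nth [::] (transversal k) v) in
  (nth 0%N l v == k) && all (fun i => nth 0%N l i == i) (iota 0 k).

Let transversalP k v : k < 7 -> v < 9 -> allowed k v -> moves_back k v.
Proof.
have ok: all (fun k => all (fun v => allowed k v ==> moves_back k v) (iota 0 9))
             (iota 0 7) by vm_compute.
move=> ltk ltv; apply/implyP; move/allP: ok => /(_ k); rewrite mem_iota => /(_ ltk).
by move/allP=> /(_ v); rewrite mem_iota; apply.
Qed.

Let fixes (x : {perm 'I_9}) k := forall i : 'I_9, i < k -> x i = i.

Let fixes_ge x k (i : 'I_9) : fixes x k -> k <= i -> k <= x i.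
Proof.
move=> fx leki; rewrite leqNgt; apply/negP=> lt_xi.
by move: (lt_xi); rewrite (perm_inj (fx _ lt_xi)) ltnNge leki.
Qed.

Let fixes8 x : fixes x 8 -> x = 1.
Proof.
move=> fx; apply/permP=> i; rewrite perm1.
have [/fx//|le8i] := ltnP i 8; have le8xi := fixes_ge fx le8i.
have le8 (j : 'I_9) : 8 <= j -> val j = 8.
  by move=> le8j; apply/eqP; rewrite eqn_leq le8j -ltnS ltn_ord.
by apply: val_inj; rewrite (le8 _ le8i) (le8 _ le8xi).
Qed.

Let fixesS x k (ltk : k < 9) :
  fixes x k -> x (Ordinal ltk) = Ordinal ltk -> fixes x k.+1.
Proof.
move=> fx xk i; rewrite ltnS leq_eqVlt => /predU1P[ik|/fx//].
by rewrite (_ : i = Ordinal ltk) //; apply: val_inj.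
Qed.

Let fixes_allowed x k (ltk : k < 9) :
  x \in K648 -> fixes x k -> allowed k (x (Ordinal ltk)).
Proof.
rewrite inE => /andP[_ nx] fx; rewrite /allowed fixes_ge //=.
apply/allP=> i; rewrite mem_iota /= => lti; apply/implyP=> /eqP eb.
have lti9 := ltn_trans lti ltk.
have := normE27_keeps (i := Ordinal ltk) (j := Ordinal lti9) nx eb.
by rewrite (fx (Ordinal lti9)) //= => ->.
Qed.

Let fixes7 x : x \in K648 -> fixes x 7 -> x = 1.
Proof.
move=> Kx fx; have i7 : 7 < 9 by []. have i8 : 8 < 9 by [].
have [x7 | x7] := eqVneq (x (Ordinal i7)) (Ordinal i7).
  by apply: fixes8; apply: fixesS x7.
have x78 : x (Ordinal i7) = Ordinal i8.
  have := fixes_ge (i := Ordinal i7) fx (leqnn 7).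
  case: (x (Ordinal i7)) x7 => -[|[|[|[|[|[|[|[|[|//]]]]]]]]] ? //= _ _.
  exact: val_inj.
suff ex : x * tperm (Ordinal i7) (Ordinal i8) = 1.
  have {}ex : x = tperm (Ordinal i7) (Ordinal i8).
    by rewrite -[x](mulgK (tperm (Ordinal i7) (Ordinal i8))) ex mul1g tpermV.
  by move: Kx; rewrite inE Alt_even ex odd_tperm.
apply: fixes8; apply: (@fixesS _ _ i7) => [i lti|]; last by rewrite permM x78 tpermR.
by rewrite permM fx // tpermD // -val_eqE /= gtn_eqF // (leq_trans lti).
Qed.

Let fixes_gen x k : k <= 7 -> x \in K648 -> fixes x k -> x \in K648_genG.
Proof.
move=> lek; rewrite -(subKn lek); move: (7 - k)%N (leq_subr k 7) => d {k lek}.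
elim: d x => [|d IHd] x led Kx fx; first by rewrite (fixes7 Kx fx) group1.
set k := (7 - d.+1)%N in fx; have ltk : k < 7 by rewrite /k ltn_subrL.
have ltk9 : k < 9 by apply: ltn_trans ltk _.
set w := nth [::] (transversal k) (x (Ordinal ltk9)).
have /andP[/eqP wk /allP wfix] :=
  transversalP ltk (ltn_ord _) (fixes_allowed ltk9 Kx fx).
rewrite -(groupMr _ (word_gen w)); apply: IHd; first exact: ltnW.
  by rewrite groupM // (subsetP gen_sub_K648) ?word_gen.
rewrite -subnSK // -/k; apply: (fixesS (ltk := ltk9)) => [i lti|].
  apply: val_inj; rewrite permM fx // acts_word.
  by apply/eqP/wfix; rewrite mem_iota.
by apply: val_inj; rewrite permM acts_word.
Qed.

Lemma K648_gen : K648 :=: <<[set x in K648_gens]>>.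
Proof.
apply/eqP; rewrite eqEsubset gen_sub_K648 andbT.
by apply/subsetP=> x Kx; apply: (@fixes_gen x 0).
Qed.

End Generators.

(* Main.v *)
Require Import Defs.
From HB Require Import structures.
From mathcomp Require Import all_boot all_order all_fingroup all_algebra all_solvable all_field all_character.
From mathcomp Require Import ring zify.

Set Implicit Arguments.
Unset Strict Implicit.
Unset Printing Implicit Defensive.

Import Order.TTheory GRing.Theory Num.Theory.
Local Open Scope group_scope.

(* The set A of the elements of H having a nontrivial power in J is a TI-set with
   normalizer H, so induction to G is an isometry on the virtual characters of H that
   vanish off A. Let t and s represent the two classes of involutions of H; they are
   not conjugate in G. An involution inverts its products with other involutions, so if
   a product of two conjugates of t or s lies in A, both factors lie in H. Hence, up to
   explicit scalars, the sums of al(uv) over conjugates u, v of t or s are the same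
   for al and for Ind al. Expanded over Irr(G), these sums are quadratic in the values
   X(t), X(s) and involve 1/X(1): with X weighted by X(1) and placed at the point
   (X(t)/X(1), X(s)/X(1)) of the plane, suitably rescaled, they are second moments.
   Six virtual characters of H supported on A, of norm at most 4, then determine a
   common decomposition pattern in Irr(G), and equating the moments of order 0, 1 and 2
   yields an irreducible character of G of degree 3 whose kernel does not contain t.
   Its values on J are 0 or 3, so its kernel meets J nontrivially, hence meets H
   exactly in J; in this kernel J is a Frobenius complement, which is impossible for
   J elementary abelian of order 27 unless the kernel is J. *)

(** * Constituents of the induced virtual characters *)

Local Open Scope ring_scope.

(** The pattern to be forced is that of the case G = H, where the seven constituents other than the
    principal character have degrees 8, 6, 2, 3, 3, 6, 12 up to sign. The order of G and its class
    sizes are unknown. They enter only through the scale of the two coordinates, hence only through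
    the position of the principal character; as all six virtual characters have total weight and
    first moments zero, the origin can be moved there, and no unknown scale survives. The bound on
    the norms makes a finite search possible: a virtual character of norm less than 4 is a sum of
    distinct irreducible characters up to sign, whereas norm 4 also allows twice one of them. The
    two virtual characters of norm 4 have inner product 1 or -1 with the principal character, and
    removing it leaves norm 3. The two of norm 2 are there to discard false patterns. Degrees carry
    unknown signs, so the moment equations are solved by algebra alone, without positivity. *)

Section LinearCombination.

Variable F : numFieldType.

Lemma lincomb (L R a b : F) : L = R -> a - b = L - R -> a = b.
Proof. by move=> -> /eqP; rewrite subrr subr_eq0 => /eqP. Qed.

Lemma addE (a b c d : F) : a = b -> c = d -> a + c = b + d.
Proof. by move=> -> ->. Qed.

Lemma mulE (k a b : F) : a = b -> k * a = k * b.
Proof. by move=> ->. Qed.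

End LinearCombination.

(** A goal [a = b] is proved by naming a combination of known equations, built with [addE] and
    [mulE]; [field] then checks that the difference of its two sides is [a - b]. *)
Local Ltac lc P := apply: (lincomb P); by field.

Fixpoint sign_tuples n : seq (seq int) :=
  if n is n'.+1 then [seq x :: s | x <- [:: 0; 1; -1], s <- sign_tuples n'] else [:: [::]].

Definition coef_norm (cs : seq int) : nat := sumn [seq `|c| ^ 2 | c <- cs]%N.

Lemma coef_normE cs : (coef_norm cs)%:Z = \sum_(c <- cs) c ^+ 2.
Proof.
elim: cs => [|c cs IH]; first by rewrite big_nil.
by rewrite big_cons -IH /coef_norm /= PoszD -abszX gez0_abs ?sqr_ge0.
Qed.

Lemma sign_tuplesP cs : (coef_norm cs < 4)%N -> cs \in sign_tuples (size cs).
Proof.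
elim: cs => [|c cs IH] // N4.
have [Nc Ncs] : (`|c| ^ 2 < 4 /\ coef_norm cs < 4)%N.
  by rewrite /coef_norm /= in N4 *; lia.
apply/allpairsP; exists (c, cs); split=> //=; last exact: IH.
have c1 : (`|c| < 2)%N by rewrite -(ltn_exp2r _ _ (isT : 0 < 2)%N).
by rewrite !inE; case: c Nc N4 c1 => [[|[|]]|[|]].
Qed.

Lemma coef_enum (check : seq int -> bool) (sols : seq (seq int)) cs m n k :
  (m < 4)%N -> m%:Z = \sum_(c <- cs) c ^+ 2 + n%:Z -> size cs = k -> check cs ->
  all (fun s => check s ==> (coef_norm s <= m)%N ==> (s \in sols)) (sign_tuples k) ->
  cs \in sols /\ (coef_norm cs + n)%N = m.
Proof.
rewrite -coef_normE => m4 E <- ck /allP/(_ cs); have {}E : (coef_norm cs + n = m)%N by lia.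
rewrite ck -E leq_addr /= => h; split=> //; apply: h; apply: sign_tuplesP.
by rewrite (leq_ltn_trans _ m4) // -E leq_addr.
Qed.

(** * Expanding virtual characters of small norm over an orthonormal family *)

Section Extend.
Variables (gT : finGroupType) (G : {group gT}).

Lemma Z_cat (xs ys : seq 'CF(G)) :
  {subset xs <= 'Z[irr G]} -> {subset ys <= 'Z[irr G]} ->
  {subset xs ++ ys <= 'Z[irr G]}.
Proof. by move=> Zx Zy u; rewrite mem_cat => /orP[/Zx|/Zy]. Qed.

Lemma dirr1_neq0 (X : 'CF(G)) : X \in dirr G -> X 1%g != 0.
Proof.
by case/dirrP=> b [i ->]; rewrite cfunE mulf_neq0 ?signr_eq0 ?irr1_neq0.
Qed.

Lemma orthonormal_dirr (xs : seq 'CF(G)) :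
  orthonormal xs -> {subset xs <= 'Z[irr G]} -> {subset xs <= dirr G}.
Proof.
move=> /orthonormalP[_ o] Z x xx; apply: dirr_norm1; first exact: Z.
by rewrite o // eqxx.
Qed.

(** Inner products of virtual characters are integers, so the part of [psi] orthogonal to [xs] is
    again a virtual character. Its norm is still below 4, hence it is a sum of as many orthonormal
    virtual characters as its norm. *)
Lemma vchar_extend (xs : seq 'CF(G)) psi n :
    orthonormal xs -> {subset xs <= 'Z[irr G]} ->
    psi \in 'Z[irr G] -> '[psi] = n%:R -> (n < 4)%N ->
  exists c : 'CF(G) -> int, exists ys : seq 'CF(G),
    [/\ forall x, x \in xs -> '[psi, x] = (c x)%:~R,
        orthonormal (xs ++ ys), {subset ys <= 'Z[irr G]},
        psi = \sum_(x <- xs) (c x)%:~R *: x + \sum_(y <- ys) y &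
        (n%:Z = \sum_(x <- xs) c x ^+ 2 + (size ys)%:Z)%R].
Proof.
move=> oxs Zxs Zpsi Npsi n4.
have /orthonormalP[uxs dxs] := oxs.
pose c x : int := Num.floor '[psi, x].
have cE x : x \in xs -> '[psi, x] = (c x)%:~R.
  by move=> xx; apply/esym/eqP; rewrite -intrEfloor Cint_cfdot_vchar // Zxs.
pose sg := \sum_(x <- xs) (c x)%:~R *: x.
pose rho := psi - sg.
have Zsg : sg \in 'Z[irr G].
  rewrite /sg big_seq; apply: rpred_sum => x xx.
  by rewrite scale_zchar ?intr_int ?Zxs.
have Zrho : rho \in 'Z[irr G] by rewrite rpredB.
have sgx x : x \in xs -> '[sg, x] = (c x)%:~R.
  move=> xx; rewrite cfdot_suml (bigD1_seq x) //= cfdotZl dxs // eqxx mulr1.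
  rewrite big_seq_cond big1 ?addr0 // => y /andP[yx ne].
  by rewrite cfdotZl dxs // (negPf ne) mulr0.
have rx x : x \in xs -> '[rho, x] = 0.
  by move=> xx; rewrite cfdotBl sgx // cE // subrr.
have rsg : '[rho, sg] = 0.
  rewrite cfdot_sumr big_seq big1 // => x xx.
  by rewrite cfdotZr rx // mulr0.
have Nsg : '[sg] = (\sum_(x <- xs) c x ^+ 2)%:~R.
  rewrite {2}/sg cfdot_sumr rmorph_sum /= big_seq [RHS]big_seq.
  apply: eq_bigr => x xx.
  by rewrite cfdotZr sgx // aut_intr ?intr_int // rmorphXn expr2.
have Npsi2 : '[psi] = '[sg] + '[rho].
  by rewrite -[psi](subrK sg) -/rho addrC cfnormDd // cfdotC rsg conjC0.
have [k Nrho] : exists k, '[rho] = k%:R by apply/natrP; rewrite Cnat_cfnorm_vchar.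
have En : n%:Z = \sum_(x <- xs) c x ^+ 2 + k%:Z.
  apply: (@intr_inj algC); rewrite rmorphD /= -Nsg.
  by rewrite -!pmulrn -Nrho -Npsi.
have k4 : (k < 4)%N.
  have : 0 <= \sum_(x <- xs) c x ^+ 2 by apply: sumr_ge0 => x _; apply: sqr_ge0.
  by lia.
have [S [oS ZS rE]] := zchar_small_norm Zrho Nrho k4.
exists c, S; split=> //.
- rewrite orthonormal_cat oxs oS /=.
  apply/orthogonalP=> x y xx yS.
  have /orthonormalP[uS dS] := oS.
  have ry : '[rho, y] = 1.
    rewrite rE cfdot_suml (bigD1_seq y) //= dS // eqxx big_seq_cond.
    by rewrite big1 ?addr0 // => z /andP[zS ne]; rewrite dS // (negPf ne).
  have xd := orthonormal_dirr oxs Zxs xx.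
  have yd := orthonormal_dirr oS ZS yS.
  rewrite cfdot_dirr //; case: eqP => [E|_].
    by move: (rx x xx); rewrite E cfdotNr ry => /eqP; rewrite oppr_eq0 oner_eq0.
  case: eqP => [E|//].
  by move: (rx x xx); rewrite E ry => /eqP; rewrite oner_eq0.
- by rewrite -rE -[LHS](subrK sg) addrC.
by rewrite size_tuple.
Qed.

(** [check] collects the linear conditions that known inner products impose on the coefficients. As
    the norm is below 4, all coefficients are 0, 1 or -1, so evaluation over finitely many vectors
    leaves only those in [sols]. *)
Lemma vchar_enum (check : seq int -> bool) (sols : seq (seq int)) (xs : seq 'CF(G)) psi m :
    orthonormal xs -> {subset xs <= 'Z[irr G]} ->
    psi \in 'Z[irr G] -> '[psi] = m%:R -> (m < 4)%N ->
    (forall c, (forall x, x \in xs -> '[psi, x] = (c x)%:~R) -> check (map c xs)) ->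
    all (fun s => check s ==> (coef_norm s <= m)%N ==> (s \in sols))
        (sign_tuples (size xs)) ->
  exists cs : seq int, exists ys : seq 'CF(G),
    [/\ cs \in sols, orthonormal (xs ++ ys), {subset xs ++ ys <= 'Z[irr G]},
        psi = \sum_(p <- zip cs xs) p.1%:~R *: p.2 + \sum_(y <- ys) y &
        (coef_norm cs + size ys = m)%N].
Proof.
move=> oxs Zxs Zpsi Npsi m4 ck al.
have [c [ys [cE oys Zys RE NE]]] := vchar_extend oxs Zxs Zpsi Npsi m4.
have [|cs_sol Ncs] := coef_enum (cs := map c xs) (n := size ys) m4 _ (size_map _ _) (ck c cE) al.
  by rewrite big_map NE.
exists (map c xs), ys; split=> //; first exact: Z_cat.
rewrite {1}RE; congr (_ + _).
by elim: (xs) => [|x s IH]; rewrite ?big_nil //= !big_cons IH.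
Qed.

End Extend.

Lemma perm_swap2 (T : eqType) (x y : T) s : perm_eq (x :: y :: s) (y :: x :: s).
Proof. by apply/seq.permP=> p /=; rewrite addnCA. Qed.

Lemma intr3 (a b c k : int) :
  a%:~R + b%:~R + c%:~R = k%:~R :> algC -> a + b + c = k.
Proof. by rewrite -!rmorphD /= => /intr_inj. Qed.

(** * The moment equations of weighted points in the plane *)

Section Inertia.

Variable F : numFieldType.

Lemma natf_neq0 k : k.+1%:R != 0 :> F.
Proof. by rewrite pnatr_eq0. Qed.

(* n, m, e, c, d, p, q are signed degrees of characters of G and the other variables
   are their positions in the plane, with that of the principal character as origin.
   The hypotheses equate the total weights, first moments and second moments of the
   two sides of the four decompositions in R1_decomp below. *)
Lemma inertia_system (n m e c d p q : F)
    (th1 th2 f1 f2 h1 h2 a1 a2 b1 b2 k1 k2 w1 w2 : F) :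
  [/\ n != 0, m != 0, e != 0 & c != 0] -> [/\ d != 0, p != 0 & q != 0] ->
  n = m + e -> n * th1 = m * f1 + e * h1 -> n * th2 = m * f2 + e * h2 ->
  n * th1 * th1 - m * f1 * f1 - e * h1 * h1 = - (8%:R / 3%:R) ->
  n * th2 * th2 - m * f2 * f2 - e * h2 * h2 = 0 ->
  m = c + d -> m * f1 = c * a1 + d * b1 -> m * f2 = c * a2 + d * b2 ->
  m * f1 * f1 - c * a1 * a1 - d * b1 * b1 = 0 ->
  m * f2 * f2 - c * a2 * a2 - d * b2 * b2 = - (2%:R / 3%:R) ->
  1 + n = d + p -> n * th1 = d * b1 + p * k1 -> n * th2 = d * b2 + p * k2 ->
  n * th1 * th1 - d * b1 * b1 - p * k1 * k1 = 0 ->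
  n * th1 * th2 - d * b1 * b2 - p * k1 * k2 = 4%:R / 3%:R ->
  n * th2 * th2 - d * b2 * b2 - p * k2 * k2 = 2%:R / 3%:R ->
  q = 1 + n + d -> q * w1 = n * th1 + d * b1 -> q * w2 = n * th2 + d * b2 ->
  q * w1 * w1 - n * th1 * th1 - d * b1 * b1 = - (4%:R / 3%:R) ->
  q * w1 * w2 - n * th1 * th2 - d * b1 * b2 = - (2%:R / 3%:R) ->
  q * w2 * w2 - n * th2 * th2 - d * b2 * b2 = - 1 ->
  d = 3%:R /\ b1 != 0.
Proof.
move=> [n0 m0 e0 c0] [d0 p0 q0] R4 R4_1 R4_2 R4_11 R4_22 R3 R3_1 R3_2 R3_11 R3_22.
move=> R2 R2_1 R2_2 R2_11 R2_12 R2_22 R1 R1_1 R1_2 R1_11 R1_12 R1_22.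
have Eq : q = p + 2%:R * d by lc (addE R1 R2).
have [u1 Du1] : exists u1, u1 = k1 - b1 by eexists.
have [u2 Du2] : exists u2, u2 = k2 - b2 by eexists.
have S1 : q * w1 = p * k1 + 2%:R * d * b1 by lc (addE R1_1 R2_1).
have S2 : q * w2 = p * k2 + 2%:R * d * b2 by lc (addE R1_2 R2_2).
(* The sum of the [R1] and [R2] equations makes the point of weight [q] the centroid of points of
   weights [p] and [2 * d]. For two points the defect of the second moment depends only on their
   difference, as for a reduced mass. *)
have gen x y kx ky bx by' t : q * x = p * kx + 2%:R * d * bx ->
    q * y = p * ky + 2%:R * d * by' ->
    q * x * y - p * kx * ky - 2%:R * d * bx * by' = t ->
    2%:R * p * d * (kx - bx) * (ky - by') = - q * t.
  move=> Ex Ey <-.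
  have E : q * x * (q * y) = (p * kx + 2%:R * d * bx) * (p * ky + 2%:R * d * by').
    by rewrite Ex Ey.
  by rewrite Eq in E *; lc E.
have U11 : 2 * p * d * u1 * u1 = - q * (- (4 / 3) + 0).
  by rewrite Du1; apply: (gen _ _ _ _ _ _ _ S1 S1); lc (addE R1_11 R2_11).
have U12 : 2 * p * d * u1 * u2 = - q * (- (2 / 3) + 4 / 3).
  by rewrite Du1 Du2; apply: (gen _ _ _ _ _ _ _ S1 S2); lc (addE R1_12 R2_12).
have u10 : u1 != 0.
  apply/eqP=> u10; move: U11; rewrite u10 mulr0 => /esym/eqP; apply/negP.
  by rewrite addr0 mulrNN !mulf_neq0 ?invr_eq0 ?natf_neq0.
have Eu : u1 = - (2 * u2).
  have pd0 : 2 * p * d * u1 != 0 by rewrite !mulf_neq0 ?natf_neq0.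
  by apply: (mulfI pd0); lc (addE U11 (mulE 2 U12)).
have [h Dh] : exists h, h = - u2 by eexists.
have Eu1 : k1 = b1 + 2 * h by rewrite Dh; lc (addE Eu (mulE (-1) Du1)).
have Eu2 : k2 = b2 - h by rewrite Dh Du2; ring.
have h0 : h != 0 by rewrite Dh oppr_eq0; apply: contra_neq u10 => u20; rewrite Eu u20 mulr0 oppr0.
have Eh : 6 * p * d * h ^+ 2 = q.
  by move: U11; rewrite Du1 Eu1 => U; lc (mulE (3 / 4) U).
have B1 : (1 + n) * b1 = n * th1 - 2 * p * h.
  by rewrite R2; move: R2_1; rewrite Eu1 => U; lc (mulE (-1) U).
have B2 : (1 + n) * b2 = n * th2 + p * h.
  by rewrite R2; move: R2_2; rewrite Eu2 => U; lc (mulE (-1) U).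
rewrite Eu1 in R2_11 R2_12; rewrite Eu2 in R2_12 R2_22.
(* Since [n] is a signed degree, [n = -1] has to be excluded; it would turn the sum of [R2_12] and
   [R2_22] into 2 = 0. *)
have N0 : 1 + n != 0.
  apply/eqP=> N0; have En : n = -1 by apply/eqP; rewrite -addr_eq0 addrC N0.
  have Ed : d = - p by apply/eqP; rewrite -addr_eq0 -R2 N0.
  have Z1 : th1 = - (2 * p * h) by move: B1; rewrite N0 En => U; lc U.
  have Z2 : th2 = p * h by move: B2; rewrite N0 En => U; lc U.
  rewrite Z1 Z2 En Ed in R2_11 R2_12 R2_22.
  have X1 : p * h * (b1 + (p + 1) * h) = 0 by lc (mulE (- (1 / 4)) R2_11).
  have /eqP : b1 + (p + 1) * h = 0.
    by move/eqP: X1; rewrite !mulf_eq0 (negPf p0) (negPf h0) => /eqP.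
  rewrite addr_eq0 => /eqP X; rewrite X in R2_12.
  have /eqP : 2 = 0 :> F by lc (mulE (-1) (addE R2_12 R2_22)).
  by rewrite pnatr_eq0.
(* Multiplying by [1 + n] and inserting the centroid equations removes [b1] and [b2], so that the
   second moments of the point [th] are expressed by the weights and [h]. *)
have T gx gy gbx gby t gux guy : (1 + n) * gbx = n * gx - p * gux ->
    (1 + n) * gby = n * gy - p * guy ->
    n * gx * gy - d * gbx * gby - p * (gbx + gux) * (gby + guy) = t ->
    n * gx * gy = p * d * gux * guy + (1 + n) * t.
  move=> Ex Ey Et.
  have E1 : (1 + n) * gbx * ((1 + n) * gby) = (n * gx - p * gux) * (n * gy - p * guy).
    by rewrite Ex Ey.
  have Ed : d = 1 + n - p by rewrite R2 addrK.
  rewrite -Et Ed.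
  lc (addE E1 (addE (mulE (p * guy) Ex) (mulE (p * gux) Ey))).
have Th11 : n * th1 * th1 = p * d * (2 * h) * (2 * h) + (1 + n) * 0.
  by apply: (T _ _ _ _ _ _ _ _ _ R2_11); lc B1.
have Th12 : n * th1 * th2 = p * d * (2 * h) * (- h) + (1 + n) * (4 / 3).
  by apply: (T _ _ _ _ _ _ _ _ _ R2_12); [lc B1 | lc B2].
have Th22 : n * th2 * th2 = p * d * (- h) * (- h) + (1 + n) * (2 / 3).
  by apply: (T _ _ _ _ _ _ _ _ _ R2_22); lc B2.
have {}Eh : p * d * h ^+ 2 = q / 6 by lc (mulE (1 / 6) Eh).
have {}Th11 : n * th1 * th1 = 2 / 3 * q by lc (addE Th11 (mulE 4 Eh)).
have {}Th12 : n * th1 * th2 = - (q / 3) + 4 / 3 * (1 + n).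
  by lc (addE Th12 (mulE (- 2) Eh)).
have {}Th22 : n * th2 * th2 = q / 6 + 2 / 3 * (1 + n) by lc (addE Th22 Eh).
(* A single point has a moment matrix of rank one; its vanishing determinant ties [q] to [1 + n]. *)
have Eqn : 3 * q = 4 * (1 + n).
  have D : (n * th1 * th1) * (n * th2 * th2) = (n * th1 * th2) * (n * th1 * th2) by ring.
  rewrite Th11 Th12 Th22 in D.
  apply: (mulfI N0); lc (mulE (9 / 4) D).
have Ep : p = 2 * d by move: Eqn; rewrite Eq R2 => U; lc (mulE (- 1) U).
have En : n = 3 * d - 1 by move: R2; rewrite Ep => U; lc U.
have Eqd : q = 4 * d by rewrite Eq Ep; ring.
have {}Eh : 3 * d * h ^+ 2 = 1.
  apply: (mulfI d0); apply: (mulfI (natf_neq0 3)); rewrite Ep Eqd in Eh.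
  by lc (mulE 6 Eh).
have {}Th11 : n * th1 * th1 = 8 / 3 * d by rewrite Th11 Eqd; field.
have {}Th12 : n * th1 * th2 = 8 / 3 * d by rewrite Th12 Eqd En; field.
have th10 : n * th1 != 0.
  have : 8 / 3 * d != 0 :> F by rewrite !mulf_neq0 ?invr_eq0 ?natf_neq0.
  by rewrite -Th11; apply: contra => /eqP->; rewrite mul0r.
have Eth : th2 = th1 by apply: (mulfI th10); rewrite Th11 Th12.
rewrite Eth in R4_2 R4_22 B2.
(* The two-point formula again, now with [n] at the centroid of [m] and [e]; a vanishing moment
   forces equal coordinates. *)
have split2 x y z : n * x = m * y + e * z -> forall t,
    n * x * x - m * y * y - e * z * z = t -> m * e * (y - z) ^+ 2 = - n * t.
  move=> E t <-; have E2 : n * x * (n * x) = (m * y + e * z) * (m * y + e * z) by rewrite E.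
  by rewrite R4 in E2 *; lc E2.
have Ef2 : f2 = th1.
  have := split2 _ _ _ R4_2 _ R4_22; rewrite mulr0 => /eqP.
  rewrite !mulf_eq0 (negPf m0) (negPf e0) /= orbb subr_eq0 => /eqP E.
  apply: (mulfI n0); rewrite R4_2 -E R4; ring.
have D1 : 3 * m * n * (f1 - th1) ^+ 2 = 8 * e.
  have E := split2 _ _ _ R4_1 _ R4_11.
  have E1 : n * (f1 - th1) = e * (f1 - h1) by rewrite mulrBr R4_1 R4; ring.
  have E2 : n * (f1 - th1) * (n * (f1 - th1)) = e * (f1 - h1) * (e * (f1 - h1)) by rewrite E1.
  apply: (mulfI n0); lc (addE (mulE (3 * m) E2) (mulE (3 * e) E)).
have split3 x y z : m * x = c * y + d * z -> forall t,
    m * x * x - c * y * y - d * z * z = t -> c * d * (y - z) ^+ 2 = - m * t.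
  move=> E t <-; have E2 : m * x * (m * x) = (c * y + d * z) * (c * y + d * z) by rewrite E.
  by rewrite R3 in E2 *; lc E2.
have Ef1 : f1 = b1.
  have := split3 _ _ _ R3_1 _ R3_11; rewrite mulr0 => /eqP.
  rewrite !mulf_eq0 (negPf c0) (negPf d0) /= orbb subr_eq0 => /eqP E.
  apply: (mulfI m0); rewrite R3_1 E R3; ring.
have D2 : 3 * m * d * (f2 - b2) ^+ 2 = 2 * c.
  have E := split3 _ _ _ R3_2 _ R3_22.
  have E1 : m * (f2 - b2) = c * (a2 - b2) by rewrite mulrBr R3_2 R3; ring.
  have E2 : m * (f2 - b2) * (m * (f2 - b2)) = c * (a2 - b2) * (c * (a2 - b2)) by rewrite E1.
  apply: (mulfI m0); lc (addE (mulE (3 * d) E2) (mulE (3 * c) E)).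
(* Measuring [th1] in units of [d * h] removes [h] by means of [3 * d * h ^+ 2 = 1] and leaves
   polynomial equations in [y] and the weights. *)
have [y Ey] : exists y, th1 = y * d * h.
  by exists (th1 / (d * h)); field; rewrite d0 h0.
have Eyn : n * y ^+ 2 = 8.
  apply: (mulfI d0); rewrite Ey in Th11.
  lc (addE (mulE 3 Th11) (mulE (- (n * d * y ^+ 2)) Eh)).
have N3 : 1 + n = 3 * d by rewrite En; ring.
rewrite N3 Ep Ey in B1 B2; rewrite Ef1 in D1; rewrite Ef2 in D2; rewrite Ey in D1 D2.
have C1 : 3 * (b1 - y * d * h) = - (h * (y + 4)).
  by apply: (mulfI d0); rewrite En in B1; lc B1.
have C2 : 3 * (y * d * h - b2) = h * (y - 2).
  by apply: (mulfI d0); rewrite En in B2; lc (mulE (- 1) B2).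
have {}D1 : m * n * (y + 4) ^+ 2 = 72 * d * e.
  have C : 3 * (b1 - y * d * h) * (3 * (b1 - y * d * h)) = h * (y + 4) * (h * (y + 4)).
    by rewrite C1 mulrNN.
  lc (addE (mulE (9 * d) D1) (addE (mulE (- 3 * d * m * n) C) (mulE (- m * n * (y + 4) ^+ 2) Eh))).
have {}D2 : m * (y - 2) ^+ 2 = 18 * c.
  have C : 3 * (y * d * h - b2) * (3 * (y * d * h - b2)) = h * (y - 2) * (h * (y - 2)).
    by rewrite C2.
  lc (addE (mulE 9 D2) (addE (mulE (- 3 * d * m) C) (mulE (- m * (y - 2) ^+ 2) Eh))).
have Ey3 : 3 * d * y ^+ 2 = 8 + y ^+ 2 by rewrite En in Eyn; lc Eyn.
have Ec : c = m - d by rewrite R3 addrK.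
have Ee : e = n - m by rewrite R4 addrAC subrr add0r.
have y0 : y != 0.
  apply/eqP=> y0; move/eqP: Eyn; rewrite y0 expr0n mulr0 eq_sym; apply/negP.
  exact: natf_neq0.
have F2 : m * y ^+ 2 * (14 + 4 * y - y ^+ 2) = 6 * (8 + y ^+ 2).
  by rewrite Ec in D2; lc (addE (mulE (- y ^+ 2) D2) (mulE 6 Ey3)).
have F1 : m * y ^+ 2 * (y ^+ 2 + 2 * y + 10) = 6 * (8 + y ^+ 2).
  rewrite Ee in D1.
  have A1 : m * y ^+ 2 * (y + 4) ^+ 2 = 3 * (8 + y ^+ 2) * (8 - m * y ^+ 2).
    apply: (mulfI (natf_neq0 7)).
    lc (addE (mulE (y ^+ 4) D1) (addE (mulE (72 * d * y ^+ 2 - m * y ^+ 2 * (y + 4) ^+ 2) Eyn)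
      (mulE (24 * (8 - m * y ^+ 2)) Ey3))).
  lc (mulE (1 / 4) A1).
(* [F1] comes from the weight [e] and [F2] from the weight [c]. Their difference leaves [y = 2] or
   [y = -1], and [y = 2] would make [c] zero. *)
have Y : m * y ^+ 2 * 2 * ((y - 2) * (y + 1)) = 0 by lc (addE F1 (mulE (- 1) F2)).
have {}Y : y = - 1.
  move/eqP: Y; rewrite !mulf_eq0 (negPf m0) (negPf y0) /= pnatr_eq0 /=.
  rewrite subr_eq0 addr_eq0 => /orP[] /eqP // Y.
  move: D2; rewrite Y subrr expr0n mulr0 => /esym/eqP.
  by rewrite mulf_eq0 (negPf c0) pnatr_eq0.
have En8 : n = 8 by move: Eyn; rewrite Y => U; lc U.
have Ed : d = 3 by apply: (mulfI (natf_neq0 2)); rewrite -N3 En8; ring.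
split=> //; apply/eqP=> b10; move/eqP: C1; rewrite b10 Y Ed.
rewrite -subr_eq0 (_ : _ - _ = 12 * h); last by ring.
by rewrite mulf_eq0 (negPf h0) pnatr_eq0.
Qed.

End Inertia.

(** * The common decomposition pattern of the six virtual characters *)

Section Decomposition.
Variables (gT : finGroupType) (G : {group gT}).
Variables V0 V1 V2 L11 L12 L22 : {additive 'CF(G) -> algC}.
Hypothesis V0_neq0 : {in dirr G, forall X, V0 X != 0}.
Hypothesis L11E : {in dirr G, forall X, L11 X * V0 X = V1 X * V1 X}.
Hypothesis L12E : {in dirr G, forall X, L12 X * V0 X = V1 X * V2 X}.
Hypothesis L22E : {in dirr G, forall X, L22 X * V0 X = V2 X * V2 X}.
Hypothesis V0_1 : V0 1 = 1.

Variables R1 R2 R3 R4 A1 A2 : 'CF(G).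
Let Rs := [:: R1; R2; R3; R4; A1; A2].
Hypothesis ZR : {subset Rs <= 'Z[irr G]}.
Hypothesis VR : {in Rs, forall R, [/\ V0 R = 0, V1 R = 0 & V2 R = 0]}.
Let R1in : R1 \in Rs. Proof. by rewrite !inE eqxx. Qed.
Let R2in : R2 \in Rs. Proof. by rewrite !inE eqxx !orbT. Qed.
Let R3in : R3 \in Rs. Proof. by rewrite !inE eqxx !orbT. Qed.
Let R4in : R4 \in Rs. Proof. by rewrite !inE eqxx !orbT. Qed.
Let A1in : A1 \in Rs. Proof. by rewrite !inE eqxx !orbT. Qed.
Let A2in : A2 \in Rs. Proof. by rewrite !inE eqxx !orbT. Qed.
Hypothesis R_1 : [/\ '[R1, 1] = - 1, '[R2, 1] = 1, '[R3, 1] = 0 &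
                    [/\ '[R4, 1] = 0, '[A1, 1] = 0 & '[A2, 1] = 0]].
Hypothesis R_R4 : [/\ '[R1, R4] = - 1, '[R2, R4] = 1, '[R3, R4] = - 1 &
                    [/\ '[R4, R4] = 3, '[A1, R4] = - 1 & '[A2, R4] = 1]].
Hypothesis R_R3 : [/\ '[R1, R3] = 1, '[R2, R3] = 1, '[R3, R3] = 3 &
                    '[A1, R3] = 1 /\ '[A2, R3] = 0].
Hypothesis R_R2 : [/\ '[R1, R2] = - 1, '[R2, R2] = 4, '[A1, R2] = 0 & '[A2, R2] = 1].
Hypothesis R_R1 : [/\ '[R1, R1] = 4, '[A1, R1] = 0 & '[A2, R1] = - 1].
Hypothesis R_A : '[A1, A1] = 2 /\ '[A2, A2] = 2.
Hypothesis T4 : [/\ L11 R4 = - (8 / 3), L12 R4 = 0 & L22 R4 = 0].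
Hypothesis T3 : [/\ L11 R3 = 0, L12 R3 = 0 & L22 R3 = - (2 / 3)].
Hypothesis T2 : [/\ L11 R2 = 0, L12 R2 = 4 / 3 & L22 R2 = 2 / 3].
Hypothesis T1 : [/\ L11 R1 = - (4 / 3), L12 R1 = - (2 / 3) & L22 R1 = - 1].

Lemma orthonormal_cfun1 : orthonormal [:: (1 : 'CF(G))].
Proof. by rewrite /orthonormal /= cfnorm1 eqxx. Qed.

Lemma R4_decomp : exists Th F E,
  [/\ orthonormal [:: 1; Th; F; E], {subset [:: 1; Th; F; E] <= 'Z[irr G]} &
      R4 = Th + F + E].
Proof.
have Z1 : {subset [:: (1 : 'CF(G))] <= 'Z[irr G]}.
  by move=> x; rewrite inE => /eqP->; exact: cfun1_vchar.
have [_ _ _ [R41 _ _]] := R_1; have [_ _ _ [NR4 _ _]] := R_R4.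
have ZR4 : R4 \in 'Z[irr G] by rewrite ZR // !inE eqxx ?orbT.
have [c [ys [cE oys Zys RE NE]]] := vchar_extend orthonormal_cfun1 Z1 ZR4 NR4 isT.
have c1 : c 1 = 0.
  by apply: (@intr_inj algC); rewrite -cE ?mem_head // R41.
rewrite !big_seq1 c1 scale0r add0r in RE; rewrite big_seq1 c1 expr0n add0r in NE.
case: ys => [|x [|y [|z [|? ?]]]] //= in oys Zys RE NE *.
exists x, y, z; split=> //.
- by move=> u; rewrite inE => /predU1P[->|/Zys//]; exact: cfun1_vchar.
by rewrite RE !big_cons big_nil addr0 addrA.
Qed.

Lemma perm_orthonormal (xs ys : seq 'CF(G)) :
  perm_eq xs ys -> orthonormal xs -> orthonormal ys.
Proof.
move=> p /orthonormalP[u d]; apply/orthonormalP; split; first by rewrite -(perm_uniq p).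
by move=> x y; rewrite -!(perm_mem p); exact: d.
Qed.

Lemma V0_sum2_neq0 x : x \in dirr G -> V0 (x + x) != 0.
Proof. by move=> dx; rewrite raddfD -mulr2n mulrn_eq0 /= V0_neq0. Qed.

Let zcoef1 psi c (xs : seq 'CF(G)) : '[psi, 1] = 0 ->
  (forall x, x \in 1 :: xs -> '[psi, x] = (c x)%:~R) -> c (1 : 'CF(G)) = 0.
Proof. by move=> p1 cE; apply: (@intr_inj algC); rewrite -cE ?mem_head. Qed.

(** As ['[R3, R4] = -1], the coefficients of [R3] at the three constituents of [R4] add up to -1.
    Either one is -1 and the others are 0, which singles out [F]; or they are 1, -1, -1, and then
    [R3 + R4] is twice a constituent although [V0] vanishes at it. *)
Lemma R3_decomp : exists Th F E a b,
  [/\ orthonormal [:: 1; Th; F; E; a; b],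
      {subset [:: 1; Th; F; E; a; b] <= 'Z[irr G]},
      R4 = Th + F + E & R3 = - F + a + b].
Proof.
have [_ _ R31 _] := R_1; have [_ _ R34 _] := R_R4; have [_ _ NR3 _] := R_R3.
have ZR3 := ZR R3in.
have [y1 [y2 [y3 [oxs Zxs R4E]]]] := R4_decomp.
have dxs := orthonormal_dirr oxs Zxs.
have y12 : V0 (R3 + R4) = 0.
  by have [V3 _ _] := VR R3in; have [V4 _ _] := VR R4in; rewrite raddfD /= V3 V4 addr0.
pose check (s : seq int) := let c := nth 0 s in (c 0%N == 0) && (c 1%N + c 2%N + c 3%N == -1).
pose sols : seq (seq int) := [:: [:: 0; -1; 0; 0]; [:: 0; 0; -1; 0]; [:: 0; 0; 0; -1];
  [:: 0; 1; -1; -1]; [:: 0; -1; 1; -1]; [:: 0; -1; -1; 1]].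
have [||cs [ys [cs_sol oys Zys RE NE]]] := vchar_enum (check := check) (sols := sols) oxs Zxs ZR3 NR3 isT.
- move=> c cE; rewrite /check /= (zcoef1 R31 cE) eqxx /=; apply/eqP/intr3.
  by rewrite -!cE ?inE ?eqxx ?orbT //; move: R34; rewrite R4E !cfdotDr.
- by vm_compute.
have bad y : y \in [:: 1; y1; y2; y3] -> R3 + R4 = y + y -> False.
  by move=> /dxs yd E; case/eqP: (V0_sum2_neq0 yd); rewrite -E.

have fin u v w : perm_eq [:: 1; y1; y2; y3] [:: 1; v; u; w] -> R4 = v + u + w ->
    R3 = - u + \sum_(y <- ys) y -> size ys = 2%N ->
    exists Th F E a b,
  [/\ orthonormal [:: 1; Th; F; E; a; b],
      {subset [:: 1; Th; F; E; a; b] <= 'Z[irr G]},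
      R4 = Th + F + E & R3 = - F + a + b].
  move=> p E4 E3 S; case: ys => [|a [|b [|? ?]]] // in oys Zys RE NE E3 S *.
  exists v, u, w, a, b; have p6 := perm_cat p (perm_refl [:: a; b]); split=> //.
  - exact: perm_orthonormal p6 oys.
  - by move=> x; rewrite -(perm_mem p6); exact: Zys.
  by rewrite E3 !big_cons big_nil addr0 addrA.

move: cs_sol RE NE; rewrite !inE; do 5?case/predU1P; try (move=> ->); last move/eqP=> ->;
  rewrite /= !big_cons big_nil /= !(scale0r, scale1r, scaleN1r, add0r, addr0) => RE NE.
- apply: (fin y1 y2 y3) => //; last exact: (@addnI 1 _ 2 NE).
  + by rewrite perm_cons perm_swap2.
  by rewrite R4E; ring.
- apply: (fin y2 y1 y3) => //; last exact: (@addnI 1 _ 2 NE).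
- apply: (fin y3 y1 y2) => //; last exact: (@addnI 1 _ 2 NE).
  + by rewrite !perm_cons perm_swap2.
  by rewrite R4E; ring.
all: have {NE} : size ys = 0%N by exact: (@addnI 3 _ 0 NE).
all: move=> /size0nil E; rewrite {}E big_nil addr0 in RE; exfalso.
- by apply: (bad y1); rewrite ?inE ?eqxx ?orbT // RE R4E; ring.
- by apply: (bad y2); rewrite ?inE ?eqxx ?orbT // RE R4E; ring.
by apply: (bad y3); rewrite ?inE ?eqxx ?orbT // RE R4E; ring.
Qed.

Lemma cfdot1_l (R : 'CF(G)) : '[R, 1] = 0 -> '[1, R] = 0.
Proof. by move=> E; rewrite cfdotC E conjC0. Qed.

Lemma cfun1_dirr : (1 : 'CF(G)) \in dirr G.
Proof. by rewrite -irr0 irr_dirr. Qed.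

(** Proportional weights and first moments mean the same point of the plane, so the second moments
    are in the same proportion. *)
Lemma L12_cfun1 (X : 'CF(G)) k : X \in dirr G -> V0 1 = k * V0 X -> V1 1 = k * V1 X ->
  V2 1 = k * V2 X -> L12 1 = k * L12 X.
Proof.
move=> dX; rewrite V0_1 => E0 E1 E2; have X0 := V0_neq0 dX.
have := L12E cfun1_dirr; rewrite V0_1 mulr1 E1 E2 mulrACA -(L12E dX) => ->.
by rewrite -[RHS]mulr1 [in RHS]E0; ring.
Qed.

(** Six coefficient vectors are possible for [R2 - 1]. Two of them give [R2 - R4 = 1 - 2 F] or
    [R2 - R3 = 1 + 2 F]; then 1 and [F] lie at one point and a mixed moment would be 0 instead of
    4/3. The other four agree up to exchanging [Th] with [E] and [a] with [b]. *)
Lemma R2_decomp : exists Th F E a b Z,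
  [/\ orthonormal [:: 1; Th; F; E; a; b; Z],
      {subset [:: 1; Th; F; E; a; b; Z] <= 'Z[irr G]},
      R4 = Th + F + E, R3 = - F + a + b & R2 = 1 + Th + b + Z].
Proof.
have [_ R21 R31 [R41 _ _]] := R_1; have [_ R24 _ _] := R_R4; have [_ R23 _ _] := R_R3.
have [_ NR2 _ _] := R_R2; have [_ L2 _] := T2; have [_ L4 _] := T4; have [_ L3 _] := T3.
have [Th [F [E [a [b [oxs Zxs R4E R3E]]]]]] := R3_decomp.
have dxs := orthonormal_dirr oxs Zxs.
have dF : F \in dirr G by rewrite dxs // !inE eqxx ?orbT.
have ZS : R2 - 1 \in 'Z[irr G] by rewrite rpredB ?cfun1_vchar ?ZR.
have R21' : '[1, R2] = 1 by rewrite cfdotC R21 conjC1.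
have NS : '[R2 - 1] = 3%:R.
  by rewrite cfnormB NR2 cfnorm1 R21 conjC1; ring.
have S1 : '[R2 - 1, 1] = 0 by rewrite cfdotBl R21 cfnorm1 subrr.
pose check (s : seq int) := let c := nth 0 s in [&& c 0%N == 0,
  c 1%N + c 2%N + c 3%N == 1 & - c 2%N + c 4%N + c 5%N == 1].
pose sols : seq (seq int) := [:: [:: 0; 1; -1; 1; 0; 0]; [:: 0; 0; 1; 0; 1; 1];
  [:: 0; 1; 0; 0; 0; 1]; [:: 0; 1; 0; 0; 1; 0]; [:: 0; 0; 0; 1; 0; 1]; [:: 0; 0; 0; 1; 1; 0]].
have [||cs [ys [cs_sol oys Zys RE NE]]] := vchar_enum (check := check) (sols := sols) oxs Zxs ZS NS isT.
- move=> c cE; rewrite /check /= (zcoef1 S1 cE) eqxx /=.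
  apply/andP; split; apply/eqP/intr3; rewrite ?rmorphN /= -!cE ?inE ?eqxx ?orbT //.
    by rewrite -!cfdotDr -R4E cfdotBl R24 (cfdot1_l R41) subr0.
  by rewrite -cfdotNr -!cfdotDr -R3E cfdotBl R23 (cfdot1_l R31) subr0.
- by vm_compute.
have {}RE := canRL (subrK 1) RE.
have [V02 V12 V22] := VR R2in; have [V04 V14 V24] := VR R4in; have [V03 V13 V23] := VR R3in.
have L12N0 : 4 / 3 <> 0 :> algC by apply/eqP; rewrite mulf_neq0 ?invr_eq0 ?pnatr_eq0.
have fin th e a' b' : perm_eq [:: 1; Th; F; E; a; b] [:: 1; th; F; e; a'; b'] ->
    R4 = th + F + e -> R3 = - F + a' + b' ->
    R2 = 1 + th + b' + \sum_(y <- ys) y -> size ys = 1%N ->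
    exists Th F E a b Z,
  [/\ orthonormal [:: 1; Th; F; E; a; b; Z],
      {subset [:: 1; Th; F; E; a; b; Z] <= 'Z[irr G]},
      R4 = Th + F + E, R3 = - F + a + b & R2 = 1 + Th + b + Z].
  move=> p E4 E3 E2 S; case: ys => [|z [|? ?]] // in oys Zys RE NE E2 S *.
  exists th, F, e, a', b', z; have p7 := perm_cat p (perm_refl [:: z]); split=> //.
  - exact: perm_orthonormal p7 oys.
  - by move=> x; rewrite -(perm_mem p7); exact: Zys.
  by rewrite E2 big_seq1.
have swE s : perm_eq [:: Th, F, E & s] [:: E, F, Th & s].
  by apply/seq.permP=> p /=; rewrite !addnA; congr (_ + _)%N; rewrite addnC addnA addnAC.
have swa : perm_eq [:: a; b] [:: b; a] by rewrite perm_swap2.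
have R4E' : R4 = E + F + Th by rewrite R4E; ring.
have R3E' : R3 = - F + b + a by rewrite R3E; ring.
have D24 : R2 - R4 = 1 - (F + F) -> False.
  move=> D; have Vi (V : {additive 'CF(G) -> algC}) : V R2 = 0 -> V R4 = 0 -> V 1 = 2 * V F.
    move=> v2 v4; have := congr1 V D; rewrite !raddfB raddfD /= v2 v4 subrr.
    by move/esym/eqP; rewrite subr_eq0 => /eqP ->; ring.
  apply: L12N0; have -> : 4 / 3 = L12 (R2 - R4) by rewrite raddfB /= L2 L4 subr0.
  by rewrite D raddfB raddfD /= (@L12_cfun1 F 2) ?Vi // -mulr2n mulr_natl subrr.
have D23 : R2 - R3 = 1 + (F + F) -> False.
  move=> D; have Vi (V : {additive 'CF(G) -> algC}) : V R2 = 0 -> V R3 = 0 -> V 1 = - 2 * V F.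
    move=> v2 v3; have := congr1 V D; rewrite !raddfB !raddfD /= v2 v3 subrr.
    by move/esym/eqP; rewrite addr_eq0 => /eqP ->; ring.
  apply: L12N0; have -> : 4 / 3 = L12 (R2 - R3) by rewrite raddfB /= L2 L3 subr0.
  by rewrite D !raddfD /= (@L12_cfun1 F (- 2)) ?Vi // -mulr2n mulNr mulr_natl addNr.
move: cs_sol RE NE; rewrite !inE; do 5?case/predU1P; try (move=> ->); last move/eqP=> ->;
  rewrite /= !big_cons big_nil /= !(scale0r, scale1r, scaleN1r, add0r, addr0) => RE NE.
- have /size0nil E0 : size ys = 0%N by exact: (@addnI 3 _ 0 NE).
  by case: D24; rewrite RE E0 big_nil R4E; ring.
- have /size0nil E0 : size ys = 0%N by exact: (@addnI 3 _ 0 NE).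
  by case: D23; rewrite RE E0 big_nil R3E; ring.
- apply: (fin Th E a b); rewrite ?RE //; [ring | exact: (@addnI 2 _ 1 NE)].
- apply: (fin Th E b a); rewrite ?RE ?perm_cons //; [ring | exact: (@addnI 2 _ 1 NE)].
- apply: (fin E Th a b); rewrite ?RE ?perm_cons //; [ring | exact: (@addnI 2 _ 1 NE)].
apply: (fin E Th b a); rewrite ?RE //; [| ring | exact: (@addnI 2 _ 1 NE)].
by rewrite perm_cons; apply: perm_trans (swE _) _; rewrite !perm_cons.
Qed.

Lemma L22_ratio X r : X \in dirr G -> V2 X = r * V0 X -> L22 X = r ^+ 2 * V0 X.
Proof.
by move=> dX Xr; apply: (mulIf (V0_neq0 dX)); rewrite (L22E dX) Xr; ring.
Qed.

(** Three nonzero weights with sum zero and with vanishing first and second moment in one coordinate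
    all have the same coordinate: one weight is minus the sum of the other two, and the two-point
    formula leaves a vanishing square. *)
Lemma R4_ratio Th F E : {subset [:: Th; F; E] <= dirr G} -> R4 = Th + F + E ->
  exists r, [/\ V2 Th = r * V0 Th, V2 F = r * V0 F & V2 E = r * V0 E].
Proof.
move=> d R4E; have [_ _ l4] := T4; have [v0 _ v2] := VR R4in.
have [dT dF dE] : [/\ Th \in dirr G, F \in dirr G & E \in dirr G].
  by split; apply: d; rewrite !inE eqxx ?orbT.
have [T0 F0 E0] := And3 (V0_neq0 dT) (V0_neq0 dF) (V0_neq0 dE).
have [LT LF LE] := And3 (L22E dT) (L22E dF) (L22E dE).
rewrite R4E !raddfD /= in v0 v2 l4.
pose r := V2 F / V0 F; have Fr : V2 F = r * V0 F by rewrite divfK.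
have LF' := L22_ratio dF Fr.
have D0 : V0 Th = - (V0 F + V0 E) by apply/eqP; rewrite -addr_eq0 addrA v0.
have D2 : V2 Th = - (V2 F + V2 E) by apply/eqP; rewrite -addr_eq0 addrA v2.
have Dl : L22 Th = - (L22 F + L22 E) by apply/eqP; rewrite -addr_eq0 addrA l4.
have Er : V2 E = r * V0 E.
  rewrite Dl D0 D2 LF' Fr in LT.
  have S : (V2 E - r * V0 E) ^+ 2 * V0 F = 0.
    move/eqP: LT; rewrite -subr_eq0 => /eqP/(congr1 ( *%R (V0 E))); rewrite mulr0 => <-.
    have -> : L22 E = V2 E * V2 E / V0 E by rewrite -LE mulfK.
    by field.
  by move/eqP: S; rewrite mulf_eq0 (negPf F0) orbF sqrf_eq0 subr_eq0 => /eqP.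
by exists r; split=> //; rewrite D2 D0 Fr Er; ring.
Qed.

Lemma L11_scale X Y k : X \in dirr G -> Y \in dirr G ->
  V0 X = k * V0 Y -> V1 X = k * V1 Y -> L11 X = k * L11 Y.
Proof.
move=> dX dY E0 E1; apply: (mulIf (V0_neq0 dX)); rewrite (L11E dX) E1 E0.
by rewrite mulrACA -(L11E dY); ring.
Qed.

(** Five coefficient vectors are possible for [R1 + 1], and the first is the pattern sought. Each of
    the others puts so many constituents at one point or on the line [V2 = r * V0] that a nonzero
    second moment, or a nonzero determinant of second moments, would vanish. *)
Lemma R1_decomp : exists Th F E a b Z W,
  [/\ {subset [:: Th; F; E; a; b; Z; W] <= dirr G},
      R4 = Th + F + E, R3 = - F + a + b, R2 = 1 + Th + b + Z &
      R1 = - 1 - Th + b + W].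
Proof.
have [R11 R21 R31 [R41 A11 A21]] := R_1; have [R14 R24 _ [_ A14 A24]] := R_R4.
have [R13 _ _ [A13 A23]] := R_R3; have [R12 _ A12 A22] := R_R2; have [NR1 A1R1 A2R1] := R_R1.
have [NA1 NA2] := R_A.
have [l11_1 l12_1 l22_1] := T1; have [l11_2 _ l22_2] := T2.
have [l11_3 _ l22_3] := T3; have [l11_4 _ l22_4] := T4.
have [Th [F [E [a [b [Z [oxs Zxs R4E R3E R2E]]]]]]] := R2_decomp.
have dxs := orthonormal_dirr oxs Zxs.
have [dT dF dE] : [/\ Th \in dirr G, F \in dirr G & E \in dirr G].
  by split; apply: dxs; rewrite !inE eqxx ?orbT.
have [da db dZ] : [/\ a \in dirr G, b \in dirr G & Z \in dirr G].
  by split; apply: dxs; rewrite !inE eqxx ?orbT.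
have [r [rT rF rE]] : exists r, [/\ V2 Th = r * V0 Th, V2 F = r * V0 F & V2 E = r * V0 E].
  apply: (R4_ratio _ R4E) => x xin; apply: dxs; move: xin.
  by rewrite !inE; case/or3P=> /eqP->; rewrite eqxx ?orbT.
have R21' : '[1, R2] = 1 by rewrite cfdotC R21 conjC1.
have R11' : '[1, R1] = - 1 by rewrite cfdotC R11 rmorphN1.
have ZS : R1 + 1 \in 'Z[irr G] by rewrite rpredD ?cfun1_vchar ?ZR.
have NS : '[R1 + 1] = 3%:R.
  by rewrite cfnormD NR1 cfnorm1 R11 rmorphN1; ring.
have S1 : '[R1 + 1, 1] = 0 by rewrite cfdotDl R11 cfnorm1 addNr.
pose check (s : seq int) := let c := nth 0 s in [&& c 0%N == 0,
  c 1%N + c 2%N + c 3%N == -1, - c 2%N + c 4%N + c 5%N == 1 & c 1%N + c 5%N + c 6%N == 0].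
pose sols : seq (seq int) := [:: [:: 0; -1; 0; 0; 0; 1; 0]; [:: 0; 0; -1; 0; 0; 0; 0];
  [:: 0; -1; 0; 0; 1; 0; 1]; [:: 0; 0; 0; -1; 1; 0; 0]; [:: 0; 0; 0; -1; 0; 1; -1]].
have [||cs [ys [cs_sol oys Zys RE NE]]] := vchar_enum (check := check) (sols := sols) oxs Zxs ZS NS isT.
- move=> c cE; rewrite /check /= (zcoef1 S1 cE) eqxx /=.
  apply/and3P; split; apply/eqP/intr3; rewrite ?rmorphN /= -!cE ?inE ?eqxx ?orbT //.
  + by rewrite -!cfdotDr -R4E cfdotDl R14 (cfdot1_l R41) addr0.
  + by rewrite -cfdotNr -!cfdotDr -R3E cfdotDl R13 (cfdot1_l R31) addr0.
  rewrite -!cfdotDr (_ : Th + b + Z = R2 - 1) ?cfdotBr ?S1 ?subr0; last by rewrite R2E; ring.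
  by rewrite cfdotDl R12 R21' addNr.
- by vm_compute.
have {}RE := canRL (addrK 1) RE.
have dys := orthonormal_dirr oys Zys.
have [V02 V12 V22] := VR R2in; have [V04 V14 V24] := VR R4in; have [V03 V13 V23] := VR R3in.
have [V01 V11 V21] := VR R1in.
have nz3 : 3^-1 <> 0 :> algC by apply/eqP; rewrite invr_eq0 pnatr_eq0.
move: cs_sol RE NE; rewrite !inE; do 4?case/predU1P; try (move=> ->); last move/eqP=> ->;
  rewrite /= !big_cons big_nil /= !(scale0r, scale1r, scaleN1r, add0r, addr0) => RE NE.
- have S : size ys = 1%N by exact: (@addnI 2 _ 1 NE).
  case: ys => [|W [|? ?]] // in oys Zys dys RE NE S *.
  exists Th, F, E, a, b, Z, W; split.
  - by move=> x xin; apply: dys; rewrite in_cons xin orbT.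
  - by [].
  - by [].
  - by [].
  by rewrite RE big_seq1; ring.
(* Here [R1 = -1 - F + n1 + n2]. Then [A1] is [-F - n1] or [-F - n2], which [rank1] excludes, or it
   gives [b] or [a] the ratio [r], which [rankab] excludes. *)
- exfalso; have S : size ys = 2%N by exact: (@addnI 1 _ 2 NE).
  case: ys => [|n1 [|n2 [|? ?]]] // in oys Zys dys RE NE S *.
  rewrite !big_cons big_nil addr0 in RE.
  have [V0A V1A V2A] := VR A1in.
  pose chk (s : seq int) := let c := nth 0 s in [&& c 0%N == 0,
    c 1%N + c 2%N + c 3%N == -1, - c 2%N + c 4%N + c 5%N == 1,
    c 1%N + c 5%N + c 6%N == 0 & - c 2%N + c 7%N + c 8%N == 0].
  pose sls : seq (seq int) := [:: [:: 0; 0; -1; 0; 0; 0; 0; -1; 0];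
    [:: 0; 0; -1; 0; 0; 0; 0; 0; -1]; [:: 0; -1; 0; 0; 0; 1; 0; 0; 0];
    [:: 0; 0; 0; -1; 1; 0; 0; 0; 0]].
  have [||cs' [zs [cs'_sol _ _ AE NA]]] := vchar_enum (check := chk) (sols := sls) oys Zys (ZR A1in) NA1 isT.
  + move=> c cE; rewrite /chk /= (zcoef1 A11 cE) eqxx /=.
    apply/and4P; split; apply/eqP/intr3; rewrite ?rmorphN /= -!cE ?inE ?eqxx ?orbT //.
    * by rewrite -!cfdotDr -R4E.
    * by rewrite -cfdotNr -!cfdotDr -R3E.
    * by rewrite -!cfdotDr (_ : Th + b + Z = R2 - 1) ?cfdotBr ?A11 ?subr0 //; rewrite R2E; ring.
    by rewrite -cfdotNr -!cfdotDr (_ : - F + n1 + n2 = R1 + 1) ?cfdotDr ?A11 ?addr0 //; rewrite RE; ring.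
  + by vm_compute.
  have V1E (V : {additive 'CF(G) -> algC}) : V R1 = 0 -> V 1 = - V F + V n1 + V n2.
    by rewrite RE raddfB !raddfD raddfN /= => /eqP; rewrite subr_eq0 addrA => /eqP.
  have dn u : u \in [:: n1; n2] -> u \in dirr G.
    by move=> uin; apply: dys; rewrite mem_cat uin orbT.
  (* [u] lies at the point of [F] with the opposite weight, so that 1 is a centroid of [F] and [w]
     only. The moment matrix of [R1] would have rank one, but its determinant is 8/9. *)
  have rank1 u w : u \in dirr G -> w \in dirr G -> R1 = - F + u + w - 1 ->
      (forall V : {additive 'CF(G) -> algC}, V A1 = 0 -> V u = - V F) -> False.
    move=> du dw R1E uF.
    have [p1 [p2 [pF1 pF2]]] : exists p1 p2, V1 F = V0 F * p1 /\ V2 F = V0 F * p2.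
      by exists (V1 F / V0 F), (V2 F / V0 F); rewrite !(mulrC (V0 F)) !divfK ?V0_neq0.
    have [q1 [q2 [pw1 pw2]]] : exists q1 q2, V1 w = V0 w * q1 /\ V2 w = V0 w * q2.
      by exists (V1 w / V0 w), (V2 w / V0 w); rewrite !(mulrC (V0 w)) !divfK ?V0_neq0.
    have sc (L VA VB : {additive 'CF(G) -> algC}) (X : 'CF(G)) x1 x2 :
        L X * V0 X = VA X * VB X -> X \in dirr G ->
        VA X = V0 X * x1 -> VB X = V0 X * x2 -> L X = V0 X * x1 * x2.
      move=> LX /V0_neq0 X0 EA EB; apply: (mulIf X0); rewrite LX EA EB; ring.
    have uF0 := uF _ V0A; have uF1 := uF _ V1A; have uF2 := uF _ V2A.
    have pu1 : V1 u = V0 u * p1 by rewrite uF0 uF1 pF1 mulNr.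
    have pu2 : V2 u = V0 u * p2 by rewrite uF0 uF2 pF2 mulNr.
    have E0 : 1 = - V0 F + V0 u + V0 w :> algC.
      by have := V01; rewrite R1E raddfB !raddfD raddfN /= V0_1 => e; lc (mulE (-1) e).
    have E1 : V1 1 = - V1 F + V1 u + V1 w.
      by have := V11; rewrite R1E raddfB !raddfD raddfN /= => e; lc (mulE (-1) e).
    have E2 : V2 1 = - V2 F + V2 u + V2 w.
      by have := V21; rewrite R1E raddfB !raddfD raddfN /= => e; lc (mulE (-1) e).
    move: l11_1 l12_1 l22_1; rewrite R1E.
    rewrite !raddfB !raddfD !raddfN /=.
    have := L11E cfun1_dirr; have := L12E cfun1_dirr; have := L22E cfun1_dirr.
    rewrite V0_1 !mulr1 E1 E2 => -> -> ->.
    rewrite (sc _ _ _ F _ _ (L11E dF) dF pF1 pF1) (sc _ _ _ F _ _ (L12E dF) dF pF1 pF2)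
      (sc _ _ _ F _ _ (L22E dF) dF pF2 pF2) (sc _ _ _ u _ _ (L11E du) du pu1 pu1)
      (sc _ _ _ u _ _ (L12E du) du pu1 pu2) (sc _ _ _ u _ _ (L22E du) du pu2 pu2)
      (sc _ _ _ w _ _ (L11E dw) dw pw1 pw1) (sc _ _ _ w _ _ (L12E dw) dw pw1 pw2)
      (sc _ _ _ w _ _ (L22E dw) dw pw2 pw2) uF1 uF2 pF1 pF2 pw1 pw2 uF0.
    have Ew : V0 w = 1 + 2 * V0 F by rewrite uF0 in E0; lc (mulE (-1) E0).
    rewrite Ew => t11 t12 t22.
    have : (4 / 3) * 1 - (2 / 3) ^+ 2 = 0 :> algC.
      pose k := - 2 * V0 F * (1 + 2 * V0 F).
      have s11 : k * (p1 - q1) ^+ 2 = - (4 / 3) by rewrite -t11 /k; ring.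
      have s12 : k * (p1 - q1) * (p2 - q2) = - (2 / 3) by rewrite -t12 /k; ring.
      have s22 : k * (p2 - q2) ^+ 2 = - 1 by rewrite -t22 /k; ring.
      have : k * (p1 - q1) ^+ 2 * (k * (p2 - q2) ^+ 2) -
        (k * (p1 - q1) * (p2 - q2)) ^+ 2 = 0 by ring.
      by rewrite s11 s12 s22 mulrNN sqrrN.
    apply/eqP; rewrite (_ : _ - _ = 8 / 9); last by field.
    by rewrite mulf_neq0 ?invr_eq0 ?pnatr_eq0.
  (* All constituents of [R3] would have the ratio [r], and [L22 R3] would be 0 instead of -2/3. *)
  have rankab : V2 a = r * V0 a \/ V2 b = r * V0 b -> False.
    move=> ab; move: V03 V23 l22_3; rewrite R3E !raddfD !raddfN /= rF => e0 e2 e3.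
    have [ra rb] : V2 a = r * V0 a /\ V2 b = r * V0 b.
      case: ab => rab; split=> //; rewrite rab in e2; lc (addE e2 (mulE (- r) e0)).
    rewrite (L22_ratio dF rF) (L22_ratio da ra) (L22_ratio db rb) in e3.
    have : 2 / 3 = 0 :> algC by lc (addE e3 (mulE (- r ^+ 2) e0)).
    by apply/eqP; rewrite mulf_neq0 ?invr_eq0 ?pnatr_eq0.
  have Nk (N : nat) : (2 + N = 2 -> N = 0)%N by move/(@addnI 2 N 0).
  move: cs'_sol AE NA; rewrite !inE; do 3?case/predU1P; try (move=> ->); last move/eqP=> ->;
    move=> AE /Nk/size0nil E0; move: AE; rewrite {}E0;
    rewrite /= !big_cons !big_nil /= !(scale0r, scale1r, scaleN1r, add0r, addr0) => AE.
  + apply: (rank1 n1 n2); rewrite ?dn ?inE ?eqxx ?orbT // ?RE ?addrA // => V.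
    by rewrite AE raddfB raddfN /= => /eqP; rewrite subr_eq0 => /eqP <-.
  + apply: (rank1 n2 n1); rewrite ?dn ?inE ?eqxx ?orbT //; first by rewrite RE; ring.
    by move=> V; rewrite AE raddfB raddfN /= => /eqP; rewrite subr_eq0 => /eqP <-.
  + apply: rankab; right; move: V0A V2A; rewrite AE !raddfD !raddfN /= rT => e0 e2.
    by lc (addE e2 (mulE (- r) e0)).
  apply: rankab; left; move: V0A V2A; rewrite AE !raddfD !raddfN /= rE => e0 e2.
  by lc (addE e2 (mulE (- r) e0)).
(* Here [R1 + R2 - R3 = F + 2 Z] puts [F] and [Z] at one point, so [L11] would vanish instead of
   being -4/3. *)
- exfalso; have /size0nil E0 : size ys = 0%N by exact: (@addnI 3 _ 0 NE).
  have D : R1 + R2 - R3 = F + (Z + Z) by rewrite RE E0 big_nil R2E R3E; ring.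
  have Vi (V : {additive 'CF(G) -> algC}) : V R1 = 0 -> V R2 = 0 -> V R3 = 0 -> V F = - 2 * V Z.
    move=> v1 v2 v3; have := congr1 V D; rewrite raddfB !raddfD /= v1 v2 v3 !addr0 subr0.
    by move/esym/eqP; rewrite addr_eq0 => /eqP ->; ring.
  have := congr1 L11 D; rewrite raddfB !raddfD /= l11_1 l11_2 l11_3 addr0 subr0.
  rewrite (@L11_scale F Z (- 2)) ?Vi // (_ : _ + _ = 0); last by ring.
  move/eqP; apply/negP.
  by rewrite oppr_eq0 mulf_neq0 ?invr_eq0 ?pnatr_eq0.
(* Here [R1 = -1 - E + a + n]. Either form of [A2] gives [n] and [Z] the ratio [r], so
   [L22 (R1 + R2 - R3 - R4)] would vanish instead of being 1/3. *)
- exfalso; have S : size ys = 1%N by exact: (@addnI 2 _ 1 NE).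
  case: ys => [|n [|? ?]] // in oys Zys dys RE NE S *.
  rewrite big_seq1 in RE.
  have [V0A V1A V2A] := VR A2in.
  pose chk (s : seq int) := let c := nth 0 s in [&& c 0%N == 0,
    c 1%N + c 2%N + c 3%N == 1, - c 2%N + c 4%N + c 5%N == 0,
    c 1%N + c 5%N + c 6%N == 1 & - c 3%N + c 4%N + c 7%N == -1].
  pose sls : seq (seq int) := [:: [:: 0; 1; 0; 0; 0; 0; 0; -1];
    [:: 0; 0; 0; 1; 0; 0; 1; 0]].
  have [||cs' [zs [cs'_sol _ _ AE NA]]] := vchar_enum (check := chk) (sols := sls) oys Zys (ZR A2in) NA2 isT.
  + move=> c cE; rewrite /chk /= (zcoef1 A21 cE) eqxx /=.
    apply/and4P; split; apply/eqP/intr3; rewrite ?rmorphN /= -!cE ?inE ?eqxx ?orbT //.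
    * by rewrite -!cfdotDr -R4E.
    * by rewrite -cfdotNr -!cfdotDr -R3E.
    * by rewrite -!cfdotDr (_ : Th + b + Z = R2 - 1) ?cfdotBr ?A21 ?subr0 //; rewrite R2E; ring.
    by rewrite -cfdotNr -!cfdotDr (_ : - E + a + n = R1 + 1) ?cfdotDr ?A21 ?addr0 //; rewrite RE; ring.
  + by vm_compute.
  have dn : n \in dirr G by apply: dys; rewrite mem_cat mem_head orbT.
  have D : R1 + R2 - R3 - R4 = Z + n - (E + E) by rewrite RE R2E R3E R4E; ring.
  have D0 := congr1 V0 D; have D2 := congr1 V2 D; have Dl := congr1 L22 D.
  rewrite !(raddfB, raddfD) /= ?V01 ?V02 ?V03 ?V04 ?V21 ?V22 ?V23 ?V24 ?l22_1 ?l22_2 ?l22_3 ?l22_4 in D0 D2 Dl.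
  have rn_rZ : V2 n = r * V0 n /\ V2 Z = r * V0 Z.
    have Nk (N : nat) : (2 + N = 2 -> N = 0)%N by move/(@addnI 2 N 0).
    move: cs'_sol AE NA; rewrite !inE; case/predU1P; [|move/eqP] => -> AE /Nk/size0nil E0; move: AE; rewrite {}E0;
      rewrite /= !big_cons !big_nil /= !(scale0r, scale1r, scaleN1r, add0r, addr0) => AE;
      move: V0A V2A; rewrite AE !(raddfB, raddfD) /= ?rT ?rE => e0 e2; rewrite rE in D2.
    * have rn : V2 n = r * V0 n by lc (addE (mulE (-1) e2) (mulE r e0)).
      by split=> //; rewrite rn in D2; lc (addE (mulE (-1) D2) (mulE r D0)).
    have rZ : V2 Z = r * V0 Z by lc (addE e2 (mulE (- r) e0)).
    by split=> //; rewrite rZ in D2; lc (addE (mulE (-1) D2) (mulE r D0)).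
  move: Dl; rewrite (L22_ratio dn rn_rZ.1) (L22_ratio dZ rn_rZ.2) (L22_ratio dE rE) => Dl.
  by apply: nz3; lc (addE Dl (mulE (- r ^+ 2) D0)).
(* Here [R1 + R2 = Th - E + 2 b], so [b] has the ratio [r] too and [L22 (R1 + R2)] would vanish
   instead of being -1/3. *)
exfalso; have /size0nil E0 : size ys = 0%N by exact: (@addnI 3 _ 0 NE).
have D : R1 + R2 = Th - E + (b + b) by rewrite RE E0 big_nil R2E; ring.
have rb : V2 b = r * V0 b.
  have := congr1 V2 D; have := congr1 V0 D.
  rewrite !(raddfB, raddfD) /= V01 V02 V21 V22 rT rE => e0 e2.
  by lc (addE (mulE (- (1 / 2)) e2) (mulE (r / 2) e0)).
have := congr1 L22 D; have := congr1 V0 D; rewrite !(raddfB, raddfD) /= l22_1 l22_2 V01 V02.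
rewrite (L22_ratio dT rT) (L22_ratio dE rE) (L22_ratio db rb) => e0 e2.
case: nz3; transitivity (- (r ^+ 2 * (0 + 0) : algC)); last by rewrite addr0 mulr0 oppr0.
by rewrite e0 !mulrDr mulrN -e2; field.
Qed.

(* Positions V_i X / V_0 X are taken relative to the one of the principal
   character; the quadratic functionals do not see this translation. *)
Lemma positions X : X \in dirr G -> exists x1 x2,
  [/\ V1 X = V0 X * (x1 + V1 1), V2 X = V0 X * (x2 + V2 1),
      L11 X = V0 X * (x1 + V1 1) ^+ 2,
      L12 X = V0 X * (x1 + V1 1) * (x2 + V2 1) &
      L22 X = V0 X * (x2 + V2 1) ^+ 2].
Proof.
move=> dX; have X0 := V0_neq0 dX.
exists (V1 X / V0 X - V1 1), (V2 X / V0 X - V2 1); rewrite !subrK.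
have V1X : V0 X * (V1 X / V0 X) = V1 X by rewrite mulrC divfK.
have V2X : V0 X * (V2 X / V0 X) = V2 X by rewrite mulrC divfK.
split; rewrite ?V1X ?V2X //; apply: (mulIf X0).
- by rewrite (L11E dX) expr2 mulrA V1X -mulrA (mulrC _ (V0 X)) V1X.
- by rewrite (L12E dX) -mulrA (mulrC _ (V0 X)) V2X.
by rewrite (L22E dX) expr2 mulrA V2X -mulrA (mulrC _ (V0 X)) V2X.
Qed.

Theorem degree3_constituent : exists2 X, X \in dirr G & V0 X = 3 /\ V1 X != 3 * V1 1.
Proof.
have [Th [F [E [a [b [Z [W [dxs R4E R3E R2E R1E]]]]]]]] := R1_decomp.
have [dT dF dE da] : [/\ Th \in dirr G, F \in dirr G, E \in dirr G & a \in dirr G].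
  by split; apply: dxs; rewrite !inE eqxx ?orbT.
have [db dZ dW] : [/\ b \in dirr G, Z \in dirr G & W \in dirr G].
  by split; apply: dxs; rewrite !inE eqxx ?orbT.
have [t1 [t2 [T1E T2E T11 T12 T22]]] := positions dT.
have [f1 [f2 [F1E F2E F11 F12 F22]]] := positions dF.
have [e1 [e2 [E1E E2E E11 E12 E22]]] := positions dE.
have [a1 [a2 [a1E a2E a11 a12 a22]]] := positions da.
have [b1 [b2 [b1E b2E b11 b12 b22]]] := positions db.
have [z1 [z2 [Z1E Z2E Z11 Z12 Z22]]] := positions dZ.
have [w1 [w2 [W1E W2E W11 W12 W22]]] := positions dW.
have l1 := L11E cfun1_dirr; have l12 := L12E cfun1_dirr; have l2 := L22E cfun1_dirr.
rewrite V0_1 !mulr1 in l1 l12 l2.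
have [l11_1 l12_1 l22_1] := T1; have [l11_2 l12_2 l22_2] := T2.
have [l11_3 l12_3 l22_3] := T3; have [l11_4 l12_4 l22_4] := T4.
have [v01 v11 v21] := VR R1in; have [v02 v12 v22] := VR R2in.
have [v03 v13 v23] := VR R3in; have [v04 v14 v24] := VR R4in.
rewrite R1E !(raddfD, raddfN) /= ?V0_1 ?T1E ?T2E ?b1E ?b2E ?W1E ?W2E in v01 v11 v21.
rewrite R2E !(raddfD, raddfN) /= ?V0_1 ?T1E ?T2E ?b1E ?b2E ?Z1E ?Z2E in v02 v12 v22.
rewrite R3E !(raddfD, raddfN) /= ?F1E ?F2E ?a1E ?a2E ?b1E ?b2E in v03 v13 v23.
rewrite R4E !(raddfD, raddfN) /= ?T1E ?T2E ?F1E ?F2E ?E1E ?E2E in v04 v14 v24.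
rewrite R1E !(raddfD, raddfN) /= ?l1 ?l12 ?l2 ?T11 ?T12 ?T22 ?b11 ?b12 ?b22 ?W11 ?W12 ?W22 in l11_1 l12_1 l22_1.
rewrite R2E !(raddfD, raddfN) /= ?l1 ?l12 ?l2 ?T11 ?T12 ?T22 ?b11 ?b12 ?b22 ?Z11 ?Z12 ?Z22 in l11_2 l12_2 l22_2.
rewrite R3E !(raddfD, raddfN) /= ?F11 ?F12 ?F22 ?a11 ?a12 ?a22 ?b11 ?b12 ?b22 in l11_3 l12_3 l22_3.
rewrite R4E !(raddfD, raddfN) /= ?T11 ?T12 ?T22 ?F11 ?F12 ?F22 ?E11 ?E12 ?E22 in l11_4 l12_4 l22_4.
(* With these signs all seven weights are positive in the model case G = H. *)
have key := @inertia_system algC (V0 Th) (- V0 F) (- V0 E) (- V0 a) (- V0 b) (- V0 Z) (V0 W)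
  t1 t2 f1 f2 e1 e2 a1 a2 b1 b2 z1 z2 w1 w2.
move: (V1 1) (V2 1) T1E T2E F1E F2E E1E E2E a1E a2E b1E b2E l1 l12 l2
  v01 v11 v21 v02 v12 v22 v03 v13 v23 v04 v14 v24
  l11_1 l12_1 l22_1 l11_2 l12_2 l22_2 l11_3 l12_3 l22_3 l11_4 l12_4 l22_4 => o1 o2.
move=> _ _ _ _ _ _ _ _ b1E _ _ _ _ v01 v11 v21 v02 v12 v22 v03 v13 v23 v04 v14 v24.
move=> l11_1 l12_1 l22_1 l11_2 l12_2 l22_2 l11_3 l12_3 l22_3 l11_4 l12_4 l22_4.
have v11' : V0 W * w1 = V0 Th * t1 - V0 b * b1 by lc (addE v11 (mulE (- o1) v01)).
have v21' : V0 W * w2 = V0 Th * t2 - V0 b * b2 by lc (addE v21 (mulE (- o2) v01)).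
have v12' : V0 Th * t1 + V0 b * b1 + V0 Z * z1 = 0 by lc (addE v12 (mulE (- o1) v02)).
have v22' : V0 Th * t2 + V0 b * b2 + V0 Z * z2 = 0 by lc (addE v22 (mulE (- o2) v02)).
have v13' : - V0 F * f1 + V0 a * a1 + V0 b * b1 = 0 by lc (addE v13 (mulE (- o1) v03)).
have v23' : - V0 F * f2 + V0 a * a2 + V0 b * b2 = 0 by lc (addE v23 (mulE (- o2) v03)).
have v14' : V0 Th * t1 + V0 F * f1 + V0 E * e1 = 0 by lc (addE v14 (mulE (- o1) v04)).
have v24' : V0 Th * t2 + V0 F * f2 + V0 E * e2 = 0 by lc (addE v24 (mulE (- o2) v04)).
have [] := key.
- by split; rewrite ?oppr_eq0 V0_neq0.
- by split; rewrite ?oppr_eq0 V0_neq0.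
- by lc v04.
- by lc v14'.
- by lc v24'.
- by lc (addE l11_4 (addE (mulE (- 2 * o1) v14') (mulE (- o1 ^+ 2) v04))).
- by lc (addE l22_4 (addE (mulE (- 2 * o2) v24') (mulE (- o2 ^+ 2) v04))).
- by lc v03.
- by lc v13'.
- by lc v23'.
- by lc (addE l11_3 (addE (mulE (- 2 * o1) v13') (mulE (- o1 ^+ 2) v03))).
- by lc (addE l22_3 (addE (mulE (- 2 * o2) v23') (mulE (- o2 ^+ 2) v03))).
- by lc v02.
- by lc v12'.
- by lc v22'.
- by lc (addE l11_2 (addE (mulE (- 2 * o1) v12') (mulE (- o1 ^+ 2) v02))).
- by lc (addE l12_2 (addE (addE (mulE (- o2) v12') (mulE (- o1) v22')) (mulE (- o1 * o2) v02))).
- by lc (addE l22_2 (addE (mulE (- 2 * o2) v22') (mulE (- o2 ^+ 2) v02))).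
- by lc v01.
- by lc v11'.
- by lc v21'.
- by lc (addE l11_1 (addE (mulE (- 2 * o1) v11') (mulE (- o1 ^+ 2) v01))).
- by lc (addE l12_1 (addE (addE (mulE (- o2) v11') (mulE (- o1) v21')) (mulE (- o1 * o2) v01))).
- by lc (addE l22_1 (addE (mulE (- 2 * o2) v21') (mulE (- o2 ^+ 2) v01))).
(* [b1 != 0] says that the first coordinate of [b] differs from that of the principal character. *)
move=> b3 b10; exists (- b); first by rewrite rpredN.
rewrite !raddfN /= b1E b3; split=> //; rewrite -mulNr b3 (inj_eq (mulfI _)) ?pnatr_eq0 //.
by rewrite -subr_eq0 addrK.
Qed.

End Decomposition.

(** * Class products and induction from a TI-set *)

Section ClassProduct.
Variables (gT : finGroupType) (G : {group gT}).

(** The linear extension of [X(y) X(z) / X(1)] from the irreducible characters; [class_product_sum]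
    identifies it with a normalized sum over products of conjugates. *)
Definition class_coef (y z : gT) (phi : 'CF(G)) : algC :=
  \sum_i '[phi, 'chi_i] * ('chi_i y * 'chi_i z / 'chi_i 1%g).

Lemma class_coef_is_additive y z : additive (class_coef y z).
Proof.
move=> u v; rewrite -sumrB; apply: eq_bigr => i _.
by rewrite cfdotBl mulrBl.
Qed.
HB.instance Definition _ y z := GRing.isAdditive.Build 'CF(G) algC
  (class_coef y z) (class_coef_is_additive y z).

Lemma class_coef_irr y z i : class_coef y z 'chi_i = 'chi_i y * 'chi_i z / 'chi_i 1%g.
Proof.
rewrite /class_coef (bigD1 i) //= cfdot_irr eqxx mul1r big1 ?addr0 // => j ji.
by rewrite cfdot_irr eq_sym (negPf ji) mul0r.
Qed.

Lemma class_coef_dirr y z X : X \in dirr G -> class_coef y z X * X 1%g = X y * X z.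
Proof.
have irrE i : class_coef y z 'chi_i * 'chi_i 1%g = 'chi_i y * 'chi_i z.
  by rewrite class_coef_irr divfK ?irr1_neq0.
case/dirrP=> -[] [i ->]; last by rewrite scale1r irrE.
by rewrite scaleN1r raddfN !cfunE !mulrNN irrE.
Qed.

(** The central character of ['chi_i] sends the class sum of [y] to
    [#|y ^: G| * 'chi_i y / 'chi_i 1] and is multiplicative on the centre of the group ring. *)
Lemma irr_class_product i y z : y \in G -> z \in G ->
  \sum_(u in y ^: G) \sum_(v in z ^: G) 'chi[G]_i (u * v)%g =
    (#|y ^: G| * #|z ^: G|)%:R * ('chi_i y * 'chi_i z / 'chi_i 1%g).
Proof.
move=> Gy Gz; have /= sKG x : x \in G -> {subset x ^: G <= G}.
  by move=> Gx; apply/subsetP; rewrite class_subG.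
pose k x := enum_rank_in (classes1 G) (x ^: G).
have kE x : x \in G -> enum_val (k x) = x ^: G.
  by move=> Gx; rewrite enum_rankK_in ?mem_classes.
have := gring_irr_modeM i (gring_class_sum_central algCfield (k y)) (gring_class_sum_central algCfield (k z)).
rewrite (gring_mode_class_sum_eq i (g := y)) ?kE ?class_refl //.
rewrite (gring_mode_class_sum_eq i (g := z)) ?kE ?class_refl //.
rewrite unlock xcfunZl => E.
have -> : \sum_(u in y ^: G) \sum_(v in z ^: G) 'chi[G]_i (u * v)%g =
    xcfun 'chi_i (gring_class_sum algCfield (k y) *m gring_class_sum algCfield (k z)).
  rewrite /gring_class_sum /gset_mx !kE // mulmx_suml raddf_sum /=.
  apply: eq_bigr => u yu; rewrite mulmx_sumr raddf_sum /=; apply: eq_bigr => v zv.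
  have [Gu Gv] := (sKG _ Gy u yu, sKG _ Gz v zv).
  by rewrite -repr_mxM // xcfunG ?groupM.
have i0 := irr1_neq0 i.
by apply: (mulfI (_ : ('chi_i 1%g)^-1 != 0)); rewrite ?invr_eq0 //; rewrite E natrM; field.
Qed.

Lemma class_product_sum (phi : 'CF(G)) y z : y \in G -> z \in G ->
  \sum_(u in y ^: G) \sum_(v in z ^: G) phi (u * v)%g =
    (#|y ^: G| * #|z ^: G|)%:R * class_coef y z phi.
Proof.
move=> Gy Gz; rewrite {1}[phi]cfun_sum_cfdot /class_coef mulr_sumr.
rewrite (eq_bigr (fun u => \sum_(v in z ^: G) \sum_i '[phi, 'chi_i] * 'chi_i (u * v)%g)); last first.
  move=> u _; apply: eq_bigr => v _; rewrite sum_cfunE.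
  by apply: eq_bigr => i _; rewrite cfunE.
rewrite (eq_bigr (fun u => \sum_i \sum_(v in z ^: G) '[phi, 'chi_i] * 'chi_i (u * v)%g)); last first.
  by move=> u _; rewrite exchange_big.
rewrite exchange_big; apply: eq_bigr => i _ /=.
rewrite mulrCA -irr_class_product // mulr_sumr; apply: eq_bigr => u _.
by rewrite mulr_sumr.
Qed.

Definition scaled_val (c : algC) (y : gT) (phi : 'CF(G)) : algC := c * phi y.

Lemma scaled_val_is_additive c y : additive (scaled_val c y).
Proof. by move=> u v; rewrite /scaled_val !cfunE mulrBr. Qed.

HB.instance Definition _ c y := GRing.isAdditive.Build 'CF(G) algC
  (scaled_val c y) (scaled_val_is_additive c y).

Definition scaled_coef (c : algC) (y z : gT) (phi : 'CF(G)) : algC := c * class_coef y z phi.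

Lemma scaled_coef_is_additive c y z : additive (scaled_coef c y z).
Proof. by move=> u v; rewrite /scaled_coef raddfB mulrBr. Qed.

HB.instance Definition _ c y z := GRing.isAdditive.Build 'CF(G) algC
  (scaled_coef c y z) (scaled_coef_is_additive c y z).

Lemma scaled_coef_dirr c d y z X : X \in dirr G ->
  scaled_coef (c * d) y z X * scaled_val 1 1%g X = scaled_val c y X * scaled_val d z X.
Proof.
move=> dX; rewrite /scaled_coef /scaled_val mul1r -[_ * _ * X 1%g]mulrA class_coef_dirr //.
by rewrite mulrACA.
Qed.

End ClassProduct.

(** * Induction of class functions supported on a TI-set *)

Section Induction.
Variables (gT : finGroupType) (G H : {group gT}).
Hypothesis sHG : H \subset G.

(** Conjugation by [g] permutes both classes of [G], so every term [g] of the induction formula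
    contributes the same sum; the hypothesis cuts that sum down to the classes of [H]. *)
Lemma class_coef_Ind (al : 'CF(H)) y z : y \in H -> z \in H ->
    (forall u v, u \in y ^: G -> v \in z ^: G -> al (u * v)%g != 0 ->
       u \in y ^: H /\ v \in z ^: H) ->
  (#|y ^: G| * #|z ^: G|)%:R * class_coef y z ('Ind[G] al) =
    #|G : H|%:R * (#|y ^: H| * #|z ^: H|)%:R * class_coef y z al.
Proof.
move=> Hy Hz loc; have [Gy Gz] := (subsetP sHG _ Hy, subsetP sHG _ Hz).
rewrite -class_product_sum // -mulrA -class_product_sum //.
have sub x : x \in H -> x ^: H \subset x ^: G by move=> _; exact: imsetS.
pose S := \sum_(u in y ^: G) \sum_(v in z ^: G) al (u * v)%g.
have -> : \sum_(u in y ^: H) \sum_(v in z ^: H) al (u * v)%g = S.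
  rewrite /S [RHS](big_setID (y ^: H)) /= (setIidPr (sub y Hy)) [X in _ + X]big1 ?addr0.
    apply: eq_bigr => u yu; rewrite [RHS](big_setID (z ^: H)) /= (setIidPr (sub z Hz)).
    rewrite [X in _ + X]big1 ?addr0 // => v /setDP[zv nzv].
    apply: contraNeq nzv => nz; have [] // := loc u v _ zv nz.
    exact: subsetP (sub y Hy) u yu.
  move=> u /setDP[yu nyu]; rewrite big1 // => v zv.
  by apply: contraNeq nyu => nz; have [] := loc u v yu zv nz.
have conj_sum g : g \in G -> \sum_(u in y ^: G) \sum_(v in z ^: G) al ((u * v) ^ g)%g = S.
  move=> Gg; have memc x u : ((u ^ g)%g \in x ^: G) = (u \in x ^: G).
    by rewrite class_sym classGidl // class_sym.
  rewrite /S [RHS](reindex_inj (conjg_inj g)) /=; apply: eq_big => [u | u _]; first by rewrite memc.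
  rewrite [RHS](reindex_inj (conjg_inj g)) /=; apply: eq_big => [v | v _]; first by rewrite memc.
  by rewrite conjMg.
transitivity (\sum_(u in y ^: G) \sum_(v in z ^: G)
   \sum_(g in G) #|H|%:R^-1 * al ((u * v) ^ g)%g).
  by apply: eq_bigr => u _; apply: eq_bigr => v _; rewrite cfIndE // mulr_sumr.
rewrite (eq_bigr (fun u => \sum_(g in G) \sum_(v in z ^: G) #|H|%:R^-1 * al ((u * v) ^ g)%g)); last first.
  by move=> u _; rewrite exchange_big.
rewrite exchange_big /= (eq_bigr (fun=> #|H|%:R^-1 * S)); last first.
  move=> g Gg; rewrite -(conj_sum g Gg) mulr_sumr; apply: eq_bigr => u _.
  by rewrite mulr_sumr.
rewrite sumr_const -[LHS]mulr_natl mulrA; congr (_ * _).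
by rewrite natf_indexg.
Qed.

(* The normalisation that turns the class coefficients of an induced function into
   those of the function. *)
Definition class_scale y : algC := #|y ^: G|%:R / (sqrtC #|G : H|%:R * #|y ^: H|%:R).

Lemma scaled_coef_Ind (al : 'CF(H)) y z : y \in H -> z \in H ->
    (forall u v, u \in y ^: G -> v \in z ^: G -> al (u * v)%g != 0 ->
       u \in y ^: H /\ v \in z ^: H) ->
  scaled_coef (class_scale y * class_scale z) y z ('Ind[G] al) = class_coef y z al.
Proof.
move=> Hy Hz loc; have := class_coef_Ind Hy Hz loc; rewrite /scaled_coef /class_scale !natrM.
have class_neq0 x : #|x ^: H|%:R != 0 :> algC.
  by rewrite pnatr_eq0 -lt0n; apply/card_gt0P; exists x; apply: class_refl.
have index_neq0 : #|G : H|%:R != 0 :> algC by rewrite pnatr_eq0 -lt0n indexg_gt0.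
rewrite -[X in _ = X * _ * _]sqrtCK; move: (index_neq0) (class_neq0 y) (class_neq0 z).
rewrite -sqrtC_eq0; set k := sqrtC _; move: (#|y ^: H|%:R) (#|z ^: H|%:R) => a b k0 a0 b0 E.
have -> : class_coef y z al = (k ^+ 2 * (a * b))^-1 * (k ^+ 2 * (a * b) * class_coef y z al).
  by rewrite mulKf // !mulf_neq0 ?expf_neq0.
rewrite -E; move: (class_coef _ _ _) => q; field.
by rewrite k0 a0 b0.
Qed.

Variable A : {set gT}.
Hypothesis sAH : A \subset H.
Hypothesis TI_A : forall h g, h \in A -> g \in G -> (h ^ g)%g \in A -> g \in H.

Lemma cfInd_TI (al : 'CF(H)) h : al \in 'CF(H, A) -> h \in A -> 'Ind[G] al h = al h.
Proof.
move=> /cfun_onP alA Ah; have Hh := subsetP sAH h Ah.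
rewrite cfIndE // (big_setID H) /= (setIidPr sHG) [X in _ + X]big1 ?addr0; last first.
  move=> g /setDP[Gg nHg]; apply: alA; apply: contra nHg; exact: TI_A.
rewrite (eq_bigr (fun=> al h)) => [|g Hg]; last by rewrite cfunJ.
by rewrite sumr_const -[al h *+ _]mulr_natl mulKf ?neq0CG.
Qed.

(** By Frobenius reciprocity the inner product is taken on [H], where ['Ind be] agrees with [be] on
    [A] and [al] vanishes elsewhere. *)
Lemma cfdot_Ind_TI : {in 'CF(H, A) &, isometry 'Ind[G, H]}.
Proof.
move=> al be alA beA; rewrite -cfdot_Res_r; rewrite !cfdotE; congr (_ * _).
have [/cfun_onP al0 _] := (alA, beA).
apply: eq_bigr => h Hh; have [Ah | nAh] := boolP (h \in A); last by rewrite al0 ?mul0r.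
by rewrite cfResE // (cfInd_TI beA).
Qed.

Lemma cfInd_eq0 (al : 'CF(H)) x :
  al \in 'CF(H, A) -> (forall g, g \in G -> (x ^ g)%g \notin A) -> 'Ind[G] al x = 0.
Proof.
move=> /cfun_onP alA xA; rewrite cfIndE // big1 ?mulr0 // => g Gg.
by rewrite alA ?xA.
Qed.

End Induction.

(** * Characters of degree 3 on elements of order 3 *)

Section DegreeThree.
Variables (gT : finGroupType) (G : {group gT}) (chi : 'CF(G)).
Hypotheses (chi_char : chi \is a character) (chi3 : chi 1%g = 3).

(** The multiplicity of the trivial character on [<[j]>] is [n = (3 + 2 * chi j) / 3], so [chi j] is
    rational, hence an integer [m] with [2 m = 3 (n - 1)] and absolute value at most 3; [m = -3]
    would make [n] negative. *)
Lemma char3_order3 j : j \in G -> (j ^+ 3 = 1)%g -> chi j^-1%g = chi j -> chi j = 0 \/ chi j = 3.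
Proof.
move=> Gj j3 rj; have [->|j1] := eqVneq j 1%g; first by right.
have o3 : #[j]%g = 3%N by apply: nt_prime_order.
have jV : (j^-1 = j ^+ 2)%g by apply/eqP; rewrite eq_invg_mul -expgS j3.
have nj : j != (j^-1)%g.
  apply: contraNneq j1 => E; have jj : (j * j = 1)%g by rewrite {2}E mulgV.
  by move: j3; rewrite expgS expg2 jj mulg1 => ->.
have cycE : <[j]>%g = [set 1%g; j; (j^-1)%g].
  apply/esym/eqP; rewrite eqEcard -orderE o3; apply/andP; split.
    by rewrite !subUset !sub1set group1 groupV cycle_id.
  by rewrite setUC cardsU1 cards2 !inE invg_eq1 (negPf j1) [1%g == j]eq_sym j1 [_ == j]eq_sym (negPf nj).
have sjG : <[j]>%g \subset G by rewrite cycle_subG.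
have : '['Res[<[j]>%g] chi, 1] \is a Num.nat by rewrite Cnat_cfdot_char ?cfRes_char ?cfun1_char.
have -> : '['Res[<[j]>%g] chi, 1] = (3 + 2 * chi j) / 3.
  have E x : x \in <[j]>%g -> ('Res[<[j]>%g] chi x) * ((1 : 'CF(<[j]>%g)) x)^* = chi x.
    by move=> jx; rewrite cfResE // cfun1E jx rmorph1 mulr1.
  rewrite cfdotE (eq_bigr _ E) -orderE o3 mulrC cycE setUC big_setU1 /=; last first.
    by rewrite !inE invg_eq1 negb_or j1 eq_sym.
  by rewrite big_setU1 ?inE 1?eq_sym // big_set1 rj chi3 /=; ring.
case/natrP=> n En.
have cE : chi j = (3 * n%:R - 3) / 2.
  have -> : 3 * n%:R = 3 * ((3 + 2 * chi j) / 3) :> algC by rewrite En.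
  by field.
have /intrP[m Em] : chi j \is a Num.int.
  apply: Cint_rat_Aint (Aint_char _ chi_char).
  by rewrite cE rpred_div ?rpredB ?rpredM ?rpred_nat.
have /andP[lem gem] : (- 3 <= m <= 3)%R.
  have := char1_ge_norm j chi_char; rewrite chi3 Em -intr_norm -[3]/(3%:~R) ler_int.
  by rewrite ler_norml.
have {cE} E : 2 * m = 3 * n%:Z - 3.
  apply: (@intr_inj algC); rewrite rmorphM rmorphB rmorphM /= -Em cE -pmulrn.
  by field.
rewrite Em; have [->|->] : m = 0 \/ m = 3 by lia.
  by left.
by right.
Qed.

(** Otherwise [chi] vanishes on [J^#], and the multiplicity of the trivial character on [J] would be
    [3 / #|J|], which is not an integer. *)
Lemma char3_ker (J : {group gT}) : J \subset G -> (9 < #|J|)%N ->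
    (forall j, j \in J -> (j ^+ 3 = 1)%g /\ chi j^-1%g = chi j) ->
  exists2 j, j \in J^#%g & j \in cfker chi.
Proof.
move=> sJG oJ J3; apply/exists_inP; apply: contraLR (oJ) => /exists_inPn nk.
have : '['Res[J] chi, 1] \is a Num.nat by rewrite Cnat_cfdot_char ?cfRes_char ?cfun1_char.
have -> : '['Res[J] chi, 1] = 3 / #|J|%:R.
  rewrite cfdotE mulrC (big_setD1 1%g) //= big1 => [|j Jj].
    by rewrite cfResE // cfun1E group1 rmorph1 chi3 mulr1 addr0.
  have [_ Jj'] := setD1P Jj; have [j3 rj] := J3 j Jj'.
  rewrite cfResE //; have [-> |E] := char3_order3 (subsetP sJG j Jj') j3 rj; first by rewrite mul0r.
  by case/negP: (nk j Jj); rewrite cfkerEchar // inE (subsetP sJG) // E chi3 eqxx.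
case/natrP=> n En; have : (3 = n * #|J|)%N.
  apply/eqP; rewrite -(eqr_nat algC) natrM -En divfK //.
  by rewrite pnatr_eq0 -lt0n cardG_gt0.
case: n {En} => [|n] // E; rewrite -leqNgt.
apply: (@leq_trans 3%N) => //. by rewrite [leqRHS]E mulSn leq_addr.
Qed.

End DegreeThree.

Local Close Scope ring_scope.

(** * Strongly closed subgroups *)

Section Semiregular.
Variables (gT : finGroupType) (Z J : {group gT}).

Lemma mulg_interchange (x1 x2 y1 y2 : gT) :
  commute x2 y1 -> x1 * x2 * (y1 * y2) = x1 * y1 * (x2 * y2).
Proof. by move=> c; rewrite -!mulgA; congr (_ * _); rewrite !mulgA c. Qed.

(** The product is fixed by [a], and [a] has no nontrivial fixed point in [Z]. *)
Lemma semiregular_norm3 a v : abelian Z -> J \subset 'N(Z) -> semiregular Z J ->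
  a \in J^# -> a ^+ 3 = 1 -> v \in Z -> v * (v ^ a * v ^ (a ^+ 2)) = 1.
Proof.
move=> abZ nZJ reg Ja a3 Zv; have [_ aJ] := setD1P Ja.
have Zc x : x \in J -> v ^ x \in Z by move=> Jx; rewrite memJ_norm ?(subsetP nZJ).
have C u w : u \in Z -> w \in Z -> commute u w by move=> Zu Zw; exact: (centsP abZ).
apply/set1gP; rewrite -(reg a Ja); apply/setIP; split.
  by apply: groupM => //; apply: groupM; apply: Zc; rewrite ?groupX.
apply/cent1P; apply/commgP/conjg_fixP.
rewrite conjMg (conjMg (v ^ a)) -!conjgM -expgSr a3 conjg1 mulgA (_ : a * a = a ^+ 2) //.
by apply: C => //; apply: groupM; apply: Zc; rewrite ?groupX.
Qed.

(** Norms over each of the four subgroups of order 3 of [<a, b>] are trivial, and so are those over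
    cosets of [<a>]. The conjugates of [v] by the six elements outside [<a>] multiply to 1 by
    cosets, and to [v ^- 3] by the other three subgroups. *)
Lemma semiregular_rank2 a b : abelian Z -> J \subset 'N(Z) -> semiregular Z J ->
  coprime #|Z| 3 -> a \in J^# -> b \in J^# -> commute a b -> a ^+ 3 = 1 -> b ^+ 3 = 1 ->
  a * b != 1 -> a ^+ 2 * b != 1 -> Z :=: 1.
Proof.
move=> abZ nZJ reg co Ja Jb cab a3 b3 ab1 aab1.
have [[_ aJ] [_ bJ]] := (setD1P Ja, setD1P Jb).
apply/trivgP/subsetP=> v Zv.
have Zc u x : u \in Z -> x \in J -> u ^ x \in Z.
  by move=> Zu Jx; rewrite memJ_norm ?(subsetP nZJ).
have C u w : u \in Z -> w \in Z -> commute u w by move=> Zu Zw; exact: (centsP abZ).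
have n3 x : x \in J -> x != 1 -> x ^+ 3 = 1 -> v * (v ^ x * v ^ (x ^+ 2)) = 1.
  by move=> Jx x1 x3; apply: semiregular_norm3; rewrite // !inE x1.
have cabn m n : commute (a ^+ m) (b ^+ n) by apply: commuteX2.
have ab3 : (a * b) ^+ 3 = 1 by rewrite expgMn // a3 b3 mulg1.
have aab3 : (a ^+ 2 * b) ^+ 3 = 1.
  by rewrite expgMn ?b3 -?expgM ?(expgM a 3 2) ?a3 ?expg1n ?mulg1 //; exact: (cabn 2 1%N).
have E1 := n3 b bJ (proj1 (setD1P Jb)) b3.
have E2 := n3 _ (groupM aJ bJ) ab1 ab3.
have E3 := n3 _ (groupM (groupX 2 aJ) bJ) aab1 aab3.
have F i : v ^ (b ^+ i) * v ^ (a * b ^+ i) * v ^ (a ^+ 2 * b ^+ i) = 1.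
  rewrite (conjgM v a) (conjgM v (a ^+ 2)) -!conjMg -mulgA.
  by rewrite (semiregular_norm3 abZ nZJ reg Ja a3 Zv) conj1g.
have X1 : (a * b) ^+ 2 = a ^+ 2 * b ^+ 2 by rewrite expgMn.
have X2 : (a ^+ 2 * b) ^+ 2 = a * b ^+ 2.
  rewrite expgMn; last exact: (cabn 2 1%N).
  by rewrite -expgM (_ : (2 * 2 = 1 + 3)%N) // expgD a3 mulg1.
rewrite X1 in E2; rewrite X2 in E3.
have [F1 F2] := (F 1%N, F 2); rewrite expg1 in F1.
have Ja2b : a ^+ 2 * b \in J by rewrite groupM ?groupX.
have Jab2 i : a * b ^+ i \in J by rewrite groupM ?groupX.
have Ja2b2 : a ^+ 2 * b ^+ 2 \in J by rewrite groupM ?groupX.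
have Jab : a * b \in J by rewrite groupM.
have G1 : v ^ b * v ^ (b ^+ 2) * (v ^ (a * b) * v ^ (a ^+ 2 * b ^+ 2)) *
          (v ^ (a ^+ 2 * b) * v ^ (a * b ^+ 2)) = 1.
  rewrite (mulg_interchange (v ^ b)); last by apply: C; apply: Zc; rewrite ?groupX.
  rewrite (mulg_interchange (v ^ b * v ^ (a * b))); last first.
    by apply: C; [apply: groupM|]; apply: Zc; rewrite ?groupX.
  rewrite F1 mul1g -mulgA (C (v ^ (a ^+ 2 * b ^+ 2))) ?Zc // mulgA.
  exact: F2.
have I u : v * u = 1 -> u = v^-1 by move/(canRL (mulKg v)); rewrite mulg1.
rewrite (I _ E1) (I _ E2) (I _ E3) in G1.
have v3 : v ^+ 3 = 1.
  by apply/eqP; rewrite -invg_eq1 -expVgn !expgS expg0 mulg1 mulgA G1.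
have : #[v] %| gcdn #|Z| 3 by rewrite dvdn_gcd order_dvdG // order_dvdn v3 eqxx.
by rewrite (eqP co) dvdn1 order_eq1 => /eqP ->; rewrite inE.
Qed.

End Semiregular.

(** * Fusion in G of elements of J and of the involutions of H *)

Section Local.
Variables (gT : finGroupType) (G H J : {group gT}).
Hypotheses (sHG : H \subset G) (nsJH : J <| H) (abJ : abelian J) (oJ : #|J| = 27).
Hypothesis expJ : forall j, j \in J -> j ^+ 3 = 1.
Hypothesis cJ : forall j, j \in J^# -> 'C_G[j] \subset H.
Hypothesis scJ : strongly_closed J H G.
Variables e1 j2 : gT.
Hypotheses (e1J : e1 \in J^#) (j2J : j2 \in J^#).
Hypotheses (e1H : #|e1 ^: H| = 6) (j2H : #|j2 ^: H| = 12).

Let sJH : J \subset H := normal_sub nsJH.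

(** Since [cJ] puts the centralizers of [J^#] in [H], the classes of ['N_G(J)] in [J^#] are larger
    than those of [H] by the factor [#|'N_G(J) : H|]. There are 26 elements, so the factor is at
    most 2, and 2 would give disjoint classes of sizes 12 and 24. *)
Lemma normalizer_J : 'N_G(J) = H.
Proof.
have sHN : H \subset 'N_G(J) by rewrite subsetI sHG normal_norm.
have cls j : j \in J^# -> #|j ^: 'N_G(J)| = (#|'N_G(J) : H| * #|j ^: H|)%N.
  move=> Jj; rewrite -!index_cent1.
  have -> : 'C_('N_G(J))[j] = 'C_H[j].
    apply/eqP; rewrite eqEsubset [X in _ && X]setSI // andbT subsetI subsetIr andbT.
    by apply: subset_trans (cJ Jj); rewrite setSI // subsetIl.
  by rewrite Lagrange_index // subsetIl.
have sub j : j \in J^# -> j ^: 'N_G(J) \subset J^#.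
  by move=> Jj; rewrite class_sub_norm // normsD1 // subsetIr.
have oJ1 : #|J^#| = 26 by apply: succn_inj; rewrite -oJ (cardsD1 1 J) group1.
have le2 : (#|'N_G(J) : H| * 12 <= 26)%N.
  by rewrite -{1}j2H -cls // -oJ1 subset_leq_card ?sub.
have idx : #|'N_G(J) : H| = 1%N.
  have i0 := indexg_gt0 'N_G(J)%G H.
  have [i2|//] : #|'N_G(J) : H| = 2%N \/ #|'N_G(J) : H| = 1%N.
    by move: i0 le2; case: #|_ : _| => [|[|[|n]]] // _ _; [right | left].
  have := subset_leq_card (_ : e1 ^: 'N_G(J) :|: j2 ^: 'N_G(J) \subset J^#).
  rewrite subUset !sub // => /(_ isT); rewrite oJ1 cardsU !cls // i2 e1H j2H.
  have [-> | [x /setIP[xe xj]]] := set_0Vmem (e1 ^: 'N_G(J) :&: j2 ^: 'N_G(J)).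
    by rewrite cards0.
  have := cls _ e1J; rewrite -(class_eqP xe) (class_eqP xj) cls // e1H j2H i2.
  by [].
exact: esym (index1g sHN idx).
Qed.

(** [J :^ g] is abelian and contains [j ^ g], so it centralizes an element of [J^#] and lies in [H];
    strong closure then makes it equal to [J]. *)
Lemma J_TI j g : j \in J^# -> g \in G -> j ^ g \in J -> g \in H.
Proof.
move=> Jj Gg Jjg; have [jn1 jJ] := setD1P Jj.
have Jjg1 : j ^ g \in J^# by rewrite !inE conjg_eq1 jn1.
have sJg : J :^ g \subset H.
  apply: subset_trans (cJ Jjg1); rewrite subsetI conj_subG ?(subset_trans sJH) //=.
  by rewrite cent1J conjSg sub_cent1 (subsetP abJ).
suff : J :^ g = J.
  by move=> nJ; rewrite -normalizer_J !inE Gg nJ subxx.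
have := scJ Gg; rewrite (setIidPl sJg) => sub.
by apply/eqP; rewrite eqEcard sub cardJg leqnn.
Qed.

(** The set A of the overview. *)
Definition J_roots := [set h in H | <[h]> :&: J != 1].

Lemma J_rootsP h : h \in J_roots -> exists2 k, h ^+ k \in J^# & h \in H.
Proof.
rewrite inE => /andP[Hh /trivgPn[x /setIP[/cycleP[k ->] Jx] x1]].
by exists k; rewrite // !inE x1.
Qed.

Lemma J_expg3 j : j \in J^# -> #[j] = 3.
Proof.
move=> /setD1P[j1 Jj]; apply/eqP; have := order_dvdn j 3; rewrite expJ // eqxx.
rewrite dvdn_divisors // !inE => /orP[|//].
by rewrite order_eq1 (negPf j1).
Qed.

(** The powers of [h] and of [h ^ g] that lie in [J^#] may have different exponents, but the cyclic
    group [<[h]>] has a single subgroup of order 3, so one exponent serves both and [J_TI]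
    applies. *)
Lemma J_roots_TI h g : h \in J_roots -> g \in G -> h ^ g \in J_roots -> g \in H.
Proof.
move=> /J_rootsP[k hk Hh] Gg /J_rootsP[m hm _].
have hm1 : h ^+ m != 1.
  by case/setD1P: hm => + _; rewrite -conjXg conjg_eq1.
have Jhm : h ^+ m \in J^#.
  have ohm : #[h ^+ m] = 3 by rewrite -(orderJ _ g) conjXg J_expg3.
  have : <[h ^+ m]> = <[h ^+ k]>.
    apply/eqP; rewrite (eq_subG_cyclic (cycle_cyclic h)) ?cycle_subG ?mem_cycle //.
    by rewrite -!orderE ohm J_expg3.
  move=> E; rewrite !inE hm1; have := cycle_id (h ^+ m); rewrite E.
  by apply: subsetP; rewrite cycle_subG; case/setD1P: hk.
by apply: (J_TI Jhm Gg); rewrite conjXg; case/setD1P: hm.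
Qed.

Lemma involution_notin_J_roots y g : y ^+ 2 = 1 -> y ^ g \notin J_roots.
Proof.
move=> y2; apply/negP => /J_rootsP[k Jk _].
have := J_expg3 Jk; rewrite -conjXg orderJ => o3.
have : #[y ^+ k] %| 2 by rewrite order_dvdn -expgM mulnC expgM y2 expg1n.
by rewrite o3.
Qed.

Lemma J_roots_inverted u w : w \in J_roots -> u \in G -> w ^ u = w^-1 -> u \in H.
Proof.
move=> /J_rootsP[k Jk _] Gu wu; apply: (J_TI Jk Gu).
by rewrite conjXg wu expgVn groupV; case/setD1P: Jk.
Qed.

Variables t s : gT.
Hypotheses (Ht : t \in H) (Hs : s \in H) (t2 : t ^+ 2 = 1) (s2 : s ^+ 2 = 1).
Hypotheses (t1 : t != 1) (s1 : s != 1).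
Hypotheses (te1 : commute t e1) (sj2 : commute s j2).
Hypothesis cs6 : ~~ (9 %| #|'C_H[s] :&: 'C[j2]|)%N.
Hypothesis invH : forall u, u \in H -> u ^+ 2 = 1 -> u != 1 -> u \in t ^: H :|: s ^: H.

(** A Sylow 3-subgroup of ['C_G[s]] is just [<[j2]>]. If [t ^ g = s], then [e1 ^ g] centralizes [s]
    and is conjugate into [<[j2]>]; by [J_TI] this fusion takes place in [H], where the classes have
    sizes 6 and 12. *)
Lemma not_conjugate_ts g : g \in G -> t ^ g = s -> False.
Proof.
move=> Gg tg; have [j2n1 Jj2] := setD1P j2J.
have Hj2 := subsetP sJH _ Jj2; have Gj2 := subsetP sHG _ Hj2.
have o3 := J_expg3 j2J.
pose C := 'C_G[s]%G.
have Cj2 : <[j2]> \subset C by rewrite cycle_subG inE Gj2; apply/cent1P/esym.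
have pj2 : 3.-group <[j2]> by rewrite /pgroup -orderE o3.
have [P sylP sj2P] := Sylow_superset Cj2 pj2.
have pP := pHall_pgroup sylP; have sPC := pHall_sub sylP.
have cPj2 : 'C_P[j2] = <[j2]>.
  apply/eqP; rewrite eq_sym eqEcard subsetI sj2P cycle_subG cent1id /=.
  rewrite -orderE o3.
  have [n oC] := p_natP (pgroupS (subsetIl P 'C[j2]) pP).
  have dv : #|'C_P[j2]| %| #|'C_H[s] :&: 'C[j2]|.
    apply: cardSg; rewrite subsetI subsetIr andbT subsetI.
    rewrite (subset_trans _ (cJ j2J)) /=; last first.
      by rewrite setSI // (subset_trans sPC) ?subsetIl.
    by apply: subset_trans (subsetIl _ _) (subset_trans sPC (subsetIr _ _)).
  rewrite oC in dv *; case: n oC dv => [|[|n]] // oC dv.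
  by case/negP: cs6; apply: dvdn_trans dv; rewrite !expnS mulnA dvdn_mulr.
(* As ['C_P[j2]] is [<[j2]>], of prime order, the nontrivial centre of [P] equals it; so [P]
   centralizes [j2]. *)
have Pj2 : P :=: <[j2]>.
  have nP1 : P :!=: 1.
    apply: contraNneq j2n1 => P1; move: sj2P; rewrite P1 => /trivgP/eqP.
    by rewrite cycle_eq1.
  have sZ : 'Z(P) \subset <[j2]>.
    rewrite -cPj2 subsetI center_sub -cent_cycle.
    by apply: subset_trans (centS sj2P); rewrite subsetIr.
  have oj2 : prime #|<[j2]>| by rewrite -orderE o3.
  have Z1 : 'Z(P) != 1 by rewrite (center_nil_eq1 (pgroup_nil pP)).
  have ZE : <[j2]> \subset 'Z(P).
    apply: contraR Z1 => /(prime_TIg oj2) <-.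
    by rewrite eqEsubset subsetIr subsetI sZ subxx.
  apply/eqP; rewrite eqEsubset sj2P andbT -cPj2 subsetI subxx /=.
  by rewrite -cent_cycle (subset_trans _ (centS ZE)) // centsC subsetIr.
have [e1n1 Je1] := setD1P e1J.
have Ce1 : <[e1 ^ g]> \subset C.
  have Ge1 : e1 \in G by rewrite (subsetP sHG) ?(subsetP sJH).
  rewrite cycle_subG inE groupJ //=.
  by rewrite -tg; apply/cent1P; rewrite /commute -!conjMg te1.
have pe1 : 3.-group <[e1 ^ g]> by rewrite /pgroup -orderE orderJ J_expg3.
have [c Cc sub] := Sylow_subJ sylP Ce1 pe1.
have Gc : c \in G by case/setIP: Cc.
have inj : e1 ^ (g * c^-1) \in <[j2]>.
  by rewrite conjgM -mem_conjg -Pj2 -cycle_subG.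
have Hx : g * c^-1 \in H.
  apply: (J_TI e1J); first by rewrite groupM ?groupV.
  by apply: subsetP inj; rewrite cycle_subG.
have E : <[e1 ^ (g * c^-1)]> = <[j2]>.
  by apply/eqP; rewrite eqEcard cycle_subG inj -!orderE orderJ o3 J_expg3.
have : e1 ^ (g * c^-1) \in e1 ^: H by exact: imset_f.
move/class_eqP => E2.
have := e1H; rewrite -E2 -index_cent1 -cent_cycle E cent_cycle index_cent1 j2H.
by [].
Qed.

Lemma class_local y z u v : y \in [:: t; s] -> z \in [:: t; s] ->
  u \in y ^: G -> v \in z ^: G -> u * v \in J_roots -> u \in y ^: H /\ v \in z ^: H.
Proof.
move=> yts zts yu zv Auv.
have Gy x : x \in [:: t; s] -> x \in G.
  by rewrite !inE => /orP[]/eqP->; exact: (subsetP sHG).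
have Gcls x w : x \in [:: t; s] -> w \in x ^: G -> w \in G.
  by move=> /Gy Gx; apply: subsetP; rewrite class_subG.
have inv x w : x \in [:: t; s] -> w \in x ^: G -> w ^+ 2 = 1.
  move=> xts /imsetP[g _ ->]; rewrite -conjXg.
  by move: xts; rewrite !inE => /orP[]/eqP->; rewrite ?t2 ?s2 conj1g.
have [u2 v2] := (inv y u yts yu, inv z v zts zv).
have [Gu Gv] := (Gcls _ _ yts yu, Gcls _ _ zts zv).
have Vu : u^-1 = u by apply: invg_inj; rewrite invgK; apply: (mulgI u); rewrite mulgV.
have Vv : v^-1 = v by apply: invg_inj; rewrite invgK; apply: (mulgI v); rewrite mulgV.
have uH : u \in H.
  apply: (J_roots_inverted Auv Gu); rewrite invMg Vu Vv conjgE Vu.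
  by rewrite !mulgA -expg2 u2 mul1g.
have Huv : u * v \in H by move: Auv; rewrite inE => /andP[].
have vH : v \in H by rewrite groupMl in Huv.
(* An involution of [H] in the wrong one of the two classes would fuse [t] and [s] in [G]. *)
have fin x w : x \in [:: t; s] -> w \in x ^: G -> w \in H -> w ^+ 2 = 1 -> w \in x ^: H.
  move=> xts xw Hw w2; have w1 : w != 1.
    move: xts; rewrite !inE => /orP[]/eqP E; case/imsetP: xw => g _ ->; rewrite conjg_eq1 E.
      exact: t1.
    exact: s1.
  have link x' : w \in x' ^: H -> exists2 k, k \in G & x ^ k = x'.
    case/imsetP: xw => g Gg wE /imsetP[h Hh wE'].
    exists (g * h^-1); first by rewrite groupM // groupV (subsetP sHG).
    by rewrite conjgM -wE wE' conjgK.
  have [cw|cw] := setUP (invH Hw w2 w1).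
    move: xts; rewrite !inE => /orP[]/eqP E; first by rewrite E.
    have [k Gk] := link t cw; rewrite E => sk.
    case: (@not_conjugate_ts k^-1); first by rewrite groupV.
    by rewrite -sk conjgK.
  move: xts; rewrite !inE => /orP[]/eqP E; last by rewrite E.
  have [k Gk] := link s cw; rewrite E => tk.
  by case: (not_conjugate_ts Gk tk).
by split; apply: fin; rewrite // ?u2 ?v2.
Qed.

Lemma class_cycle_size x y : <[x]> = <[y]> -> #|x ^: H| = #|y ^: H|.
Proof. by move=> E; rewrite -!index_cent1 -!cent_cycle E. Qed.

(** If [K] is not [J], then [J] is a Frobenius complement in [K]. A conjugate of any Sylow subgroup
    of the kernel is normalized by [J], and on its centre [semiregular_rank2] is contradicted. *)
Lemma normal_subgroup_J (K : {group gT}) : K <| G -> J \subset K -> K :&: H \subset J ->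
  G :=: H.
Proof.
move=> nsKG sJK KHJ; have sKG := normal_sub nsKG.
suff KJ : K :=: J.
  apply/eqP; rewrite eqEsubset sHG andbT -normalizer_J subsetI subxx -KJ.
  exact: normal_norm.
apply/eqP/idPn => KJ.
have frob : [Frobenius K with complement J].
  rewrite /Frobenius_group_with_complement eq_sym KJ; apply/normedTI_memJ_P; split=> //.
    by apply/set0Pn; exists e1.
  move=> j g Jj Kg; apply/idP/idP=> [Jjg | Jg]; last by rewrite memJ_norm // normD1 (subsetP (normG J)).
  apply: (subsetP KHJ); rewrite inE Kg (J_TI Jj) ?(subsetP sKG) //.
  by case/setD1P: Jjg.
have [N frobN] := Frobenius_kernel_exists frob.
have reg := Frobenius_reg_ker frobN; have [defK N1 _ _ _] := Frobenius_context frobN.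
have co := Frobenius_coprime frobN; rewrite oJ in co.
have [nsNK _ _ nNJ tiNJ] := sdprod_context defK.
have [sNK nNK] := andP nsNK.
pose q := pdiv #|N|.
have [Q sylQ] := Sylow_exists q N.
have Q1 : Q :!=: 1.
  rewrite -cardG_gt1 (card_Hall sylQ) p_part_gt1 /q pi_pdiv cardG_gt1 //.
have [P sylP] := Sylow_exists 3 'N_K(Q)%G.
have oK : #|K| = (#|N| * 27)%N by rewrite -(sdprod_card defK) oJ.
(* By the Frattini argument ['N_K(Q)] supplements [N] in [K], so it contains a full Sylow 3-subgroup
   of [K], which has the order of [J]. *)
have oP : #|P| = 27.
  have defK2 : N * 'N_K(Q) = K := Frattini_arg nsNK sylQ.
  have N0 := cardG_gt0 N.
  have dv : 27 %| #|'N_K(Q)|.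
    have := mul_cardG N 'N_K(Q)%G; rewrite /= defK2 oK -mulnA => /eqP.
    rewrite eqn_pmul2l // => /eqP ->.
    exact: dvdn_mulr.
  have dvP : 27 %| #|P|.
    rewrite (card_Hall sylP) p_part; apply: (@dvdn_exp2l 3 3).
    by rewrite -pfactor_dvdn.
  have : #|P| %| #|N| * 27 by rewrite -oK; apply: cardSg (subset_trans (pHall_sub sylP) (subsetIl _ _)).
  rewrite Gauss_dvdr => [dv2|]; first by apply/eqP; rewrite eqn_dvd dv2.
  rewrite -(part_pnat_id (pHall_pgroup sylP)) p_part coprimeXl // coprime_sym.
  by rewrite (coprime_dvdr _ co).
have [sPN nQP] : P \subset K /\ P \subset 'N(Q).
  by have := pHall_sub sylP; rewrite subsetI => /andP.
have sylPK : 3.-Sylow(K) P.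
  rewrite pHallE sPN oP oK partnM // (part_pnat_id (isT : 3.-nat 27)).
  by rewrite part_p'nat ?mul1n // p'natE // -prime_coprime // coprime_sym (coprime_dvdr _ co).
have sJK3 : 3.-group J by rewrite /pgroup oJ.
have [k Kk JP] := Sylow_subJ sylPK sJK sJK3.
have nQJ : J \subset 'N(Q :^ k) by rewrite normJ (subset_trans JP) // conjSg.
have sQN : Q :^ k \subset N by rewrite -(normsP nNK k Kk) conjSg (pHall_sub sylQ).
pose Z := 'Z(Q :^ k)%G.
have sZN : Z \subset N := subset_trans (center_sub _) sQN.
have qQ : q.-group (Q :^ k) by rewrite pgroupJ (pHall_pgroup sylQ).
have [e1n1 Je1] := setD1P e1J; have [j2n1 Jj2] := setD1P j2J.
have Z1 : Z :=: 1.
  apply: (@semiregular_rank2 _ Z J e1 j2); rewrite ?expJ //.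
  - exact: center_abelian.
  - exact: subset_trans nQJ (char_norms (center_char _)).
  - by move=> x Jx; apply/trivgP; rewrite -(reg x Jx) setSI.
  - by rewrite (coprime_dvdl (cardSg sZN)) // (coprime_dvdr _ co).
  - exact: (centsP abJ).
  - apply/eqP=> E; have Ei : j2 = e1^-1 by rewrite -[j2](mulKg e1) E mulg1.
    by have := j2H; rewrite (@class_cycle_size j2 e1) ?e1H // Ei cycleV.
  apply/eqP=> E; have Ei : j2 = e1.
    by rewrite -[j2](mulKg (e1 ^+ 2)) E mulg1; apply: (mulgI (e1 ^+ 2)); rewrite mulgV -expgSr expJ.
  by have := j2H; rewrite Ei e1H.
case/eqP: Q1; apply: (@conjsg_inj _ k); rewrite conjs1g.
by have := trivg_center_pgroup qQ Z1.
Qed.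

End Local.

(** * Tables for the normalizer of E27 in Alt(9) *)

(* Permutations of 'I_9 are represented by the lists of their values, on which the
   group K648 can be tabulated and checked by evaluation. *)
Definition tab (p : {perm 'I_9}) : seq nat := [seq val (p i) | i <- enum 'I_9].

Definition tcomp (l m : seq nat) := [seq nth 0 m k | k <- l].
Definition tid := iota 0 9.
Definition tinv (l : seq nat) := [seq index i l | i <- tid].
Definition tconj l m := tcomp (tinv m) (tcomp l m).
Definition tpow l n := iter n (tcomp^~ l) tid.

Definition tgen n : seq nat := nth tid
  [:: [:: 1; 2; 0; 3; 4; 5; 6; 7; 8];
      [:: 3; 4; 5; 6; 7; 8; 0; 1; 2];
      [:: 1; 0; 2; 4; 3; 5; 6; 7; 8];
      [:: 3; 4; 5; 0; 1; 2; 7; 6; 8]]%N n.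

Definition tword (w : seq nat) := foldr (fun n l => tcomp (tgen n) l) tid w.

Definition te1 := tgen 0.
Definition te2 := tword [:: 3; 0; 3]%N.
Definition te3 := tword [:: 1; 0; 1; 1]%N.

Definition Jtabs : seq (seq nat) :=
  [seq tcomp (tpow te1 a) m | a <- iota 0 3,
     m <- [seq tcomp (tpow te2 b) (tpow te3 c) | b <- iota 0 3, c <- iota 0 3]].

(** Words in the four generators for representatives of the 24 cosets of J. *)
Definition Lwords : seq (seq nat) :=
  [:: [::]; [:: 1; 0; 1; 0; 2; 1]; [:: 0; 1; 0; 2; 1; 1]; [:: 3; 0; 3; 0; 2];
      [:: 3; 1; 0; 0; 1]; [:: 3; 0; 1; 2; 1]; [:: 0; 2; 1; 3];
      [:: 0; 3; 0; 2; 1; 0; 0; 1]; [:: 1; 0; 1; 1; 3]; [:: 1; 3; 1; 0; 0];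
      [:: 0; 2; 1; 3; 1]; [:: 1; 0; 3; 0; 2; 1; 0; 0]; [:: 1];
      [:: 3; 0; 1; 1; 3; 0; 0]; [:: 0; 1; 0; 2]; [:: 3; 0; 3; 0; 2; 1]; [:: 1; 1];
      [:: 1; 0; 1; 0; 2]; [:: 0; 1; 0; 2; 1]; [:: 0; 2; 1; 1; 0; 0];
      [:: 3; 1; 0; 0]; [:: 3; 0; 1; 2]; [:: 0; 1; 1; 3]; [:: 0; 3; 0; 2; 1; 0; 0]]%N.

Definition Ltabs := [seq tword w | w <- Lwords].
Definition Htabs := [seq tcomp l j | l <- Ltabs, j <- Jtabs].

Lemma nth_tab p (i : 'I_9) : nth 0 (tab p) i = p i.
Proof. by rewrite (nth_map i) ?size_enum_ord ?ltn_ord // nth_ord_enum. Qed.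

Lemma tab_inj : injective tab.
Proof. by move=> p q E; apply/permP=> i; apply: val_inj; rewrite /= -!nth_tab E. Qed.

Lemma tabM p q : tab (p * q) = tcomp (tab p) (tab q).
Proof. by rewrite /tcomp /tab -map_comp; apply: eq_map => i; rewrite /= permM -nth_tab. Qed.

Lemma tab1 : tab 1 = tid.
Proof. by rewrite /tab (eq_map (fun i => congr1 val (perm1 i))) val_enum_ord. Qed.

Definition tswap i j : seq nat :=
  [seq if k == i.-1 then j.-1 else if k == j.-1 then i.-1 else k | k <- tid].

Lemma tab_cyc2 i j : 0 < i <= 9 -> 0 < j <= 9 -> tab (cyc2 i j) = tswap i j.
Proof.
case: i j => [//|i] [//|j] ilt jlt.
rewrite /tswap /tid -val_enum_ord -map_comp; apply: eq_map => k.
rewrite /cyc2 /= permE /= -!val_eqE /= (inordK ilt) (inordK jlt) !(fun_if val) /=.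
by rewrite (inordK ilt) (inordK jlt).
Qed.

Lemma tab_gen n : tab (nth 1 K648_gens n) = tgen n.
Proof.
case: n => [|[|[|[|n]]]] /=; rewrite /cyc3 ?tabM ?tab_cyc2 //.
by rewrite nth_nil tab1 /tgen nth_default.
Qed.

(** [Htabs] contains the identity and is closed under right multiplication by the generators, so it
    contains every word in them. *)
Lemma tab_K648 p : p \in K648 -> tab p \in Htabs.
Proof.
have cl : all (fun l => all (fun n => tcomp l (tgen n) \in Htabs) (iota 0 4)) Htabs.
  by vm_compute.
rewrite K648_gen => /gen_prodgP[n [c cA ->]].
elim: n c cA => [|n IH] c cA; first by rewrite big_ord0 tab1; vm_compute.
rewrite big_ord_recr tabM; have := cA ord_max; rewrite inE => /(nthP 1)[k kn <-].
rewrite tab_gen; have /allP/(_ _ (IH _ (fun i => cA (widen_ord (leqnSn n) i)))) := cl.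
by move/allP; apply; rewrite mem_iota.
Qed.

Lemma K648_tab l0 : l0 \in Htabs -> exists2 p, p \in K648 & tab p = l0.
Proof.
pose S l := exists2 p, p \in K648 & tab p = l.
have SM l m : S l -> S m -> S (tcomp l m).
  by move=> [p Kp <-] [q Kq <-]; exists (p * q); rewrite ?groupM ?tabM.
have Sw w : S (tword w).
  elim: w => [|k w IH] /=; first by exists 1; rewrite ?group1 ?tab1.
  apply: SM IH; exists (nth 1 K648_gens k); last exact: tab_gen.
  rewrite K648_gen; have [ltk|lek] := ltnP k (size K648_gens); last by rewrite nth_default ?group1.
  by apply: mem_gen; rewrite inE mem_nth.
have SX l n : S l -> S (tpow l n).
  move=> Sl; elim: n => [|n IH] /=; first exact: (Sw [::]).
  exact: SM.
case/allpairsP=> -[a j] [/mapP[w _ ->] + ->]; rewrite /Jtabs.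
case/allpairsP=> -[b m] [_ + ->]; case/allpairsP=> -[c d] [_ _ ->].
have S1 : S te1 by exact: (Sw [:: 0]).
exact: (SM _ _ (Sw w) (SM _ _ (SX _ _ S1) (SM _ _ (SX _ _ (Sw _)) (SX _ _ (Sw _))))).
Qed.

Lemma Htabs_uniq : uniq Htabs.
Proof. by vm_compute. Qed.

Section TableFunctions.
Local Open Scope nat_scope.

(** The nine points form three blocks of three consecutive points, permuted by K648. In [tpos] and
    [tblk] the index is a point; in [orient] it is a block, and the test is whether its cyclic order
    is preserved. *)
Definition tpos (l : seq nat) i := nth 0 l i %% 3.
Definition tblk (l : seq nat) i := nth 0 l i %/ 3.
Definition orient (l : seq nat) i := tpos l (3 * i).+1 == (tpos l (3 * i)).+1 %% 3.

(* The representatives 1, t, s, u, x, e1, e1 e2, e1 e2 e3, t e1, s e1 e2, u e1, u e1^2,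
   x e1, x e1^2 of the conjugacy classes. *)
Definition reps : seq (seq nat) :=
  let t := tword [:: 1; 0; 1; 0; 2; 1] in let s := tword [:: 1; 0; 1; 1; 3] in
  let u := tword [:: 3; 1; 0; 0; 1] in let x := tword [:: 1] in
  let j2 := tcomp te1 te2 in
  [:: tid; t; s; u; x; te1; j2; tcomp j2 te3; tcomp t te1; tcomp s j2;
      tcomp u te1; tcomp u (tpow te1 2); tcomp x te1; tcomp x (tpow te1 2)].

Definition rep i := nth tid reps i.

Definition tcommute l m := tcomp l m == tcomp m l.
Definition cent_sizes : seq nat := [:: 648; 24; 12; 12; 9; 108; 54; 81; 12; 6; 12; 12; 9; 9].
Definition cent_size i := nth 0 cent_sizes i.

Lemma cent_sizeE : all (fun i => count (tcommute (rep i)) Htabs == cent_size i) (iota 0 14).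
Proof. by vm_compute. Qed.

Lemma reps_nonconj : all (fun i => all (fun j =>
   (i == j) || (cent_size i != cent_size j) || all (fun m => tconj (rep i) m != rep j) Htabs)
  (iota 0 14)) (iota 0 14).
Proof. by vm_compute. Qed.

Lemma reps_Htabs : all (mem Htabs) reps.
Proof. by vm_compute. Qed.

Lemma tinv_Htabs : all (fun l => (tinv l \in Htabs) && (tcomp l (tinv l) == tid)) Htabs.
Proof. by vm_compute. Qed.

(** [P] cuts out a subgroup, and [k] gives the exponents of a linear character of it with values in
    the 12th roots of unity. *)
Definition mono_ok (P : pred (seq nat)) (k : seq nat -> nat) :=
  let M := filter P Htabs in
  P tid && all (fun a => all (fun b =>
    let c := tcomp a b in P c && (k c %% 12 == (k a + k b) %% 12)) M) M.

(** The exponents occurring in the induced character at [l]. Conjugating by coset representatives of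
    J is enough when the subgroup contains J. *)
Definition mono_exps (P : pred (seq nat)) (k : seq nat -> nat) l :=
  [seq k c | c <- [seq c <- [seq tconj l m | m <- Ltabs] | P c]].

End TableFunctions.

(** * Nine nonprincipal irreducible characters of K648, all monomial *)

Section CharacterTables.
Local Open Scope ring_scope.

(* Coordinates of the powers of a primitive 12th root of unity z in the basis
   1, z, z^2, z^3. *)
Definition zcoord (j : nat) : seq int :=
  nth [:: 0; 0; 0; 0]
    [:: [:: 1; 0; 0; 0]; [:: 0; 1; 0; 0]; [:: 0; 0; 1; 0]; [:: 0; 0; 0; 1];
        [:: -1; 0; 1; 0]; [:: 0; -1; 0; 1]; [:: -1; 0; 0; 0]; [:: 0; -1; 0; 0];
        [:: 0; 0; -1; 0]; [:: 0; 0; 0; -1]; [:: 1; 0; -1; 0]; [:: 0; 1; 0; -1]] j.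

Definition zvec (ks : seq nat) : seq int :=
  foldr (fun k v => [seq p.1 + p.2 | p <- zip (zcoord (k %% 12)) v]) [:: 0; 0; 0; 0] ks.

(* The value a + b sqrt 3 of a character is encoded as (a, b). *)
Definition char_table_ok (P : pred (seq nat)) (k : seq nat -> nat) (m : nat)
    (vals : seq (int * int)) :=
  [&& mono_ok P k, all P Jtabs, (count P Htabs == 27 * m)%N, (0 < m)%N,
      all (fun i => let v := nth (0, 0) vals i in
        zvec (mono_exps P k (rep i)) ==
          [:: v.1 * m%:Z; 2%:Z * v.2 * m%:Z; 0; - (v.2 * m%:Z)]) (iota 0 14),
      all (fun v : int * int => (v.1 == 0) || (v.2 == 0)) vals &
      foldr (fun i s => let v := nth (0, 0) vals i in
        (v.1 * v.1 + 3%:Z * (v.2 * v.2)) * (648 %/ cent_size i)%N%:Z + s) 0 (iota 0 14)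
        == 648%:Z].

(** Subgroups containing J, of orders 324, 216, 108, 81 and 54; their indices are the degrees 2, 3,
    6, 8 and 12 of the induced characters. *)
Definition PE l := tblk l 3 == ((tblk l 0).+1 %% 3)%N.
Definition P1 l := tblk l 0 == 0%N.
Definition P4 l := (tblk l 0 == 0%N) && orient l 0.
Definition P3 l := [&& orient l 0, orient l 1 & orient l 2].
Definition P2 l := [&& orient l 0, orient l 1, (tblk l 0 < 2)%N & (tblk l 3 < 2)%N].

(** In these exponents of a primitive 12th root of unity, 4 stands for a cube root of unity, 6 for a
    sign, and 3 and 9 for the square roots of -1. *)
Definition kE l := (4 * tblk l 0)%N.
Definition kT1 l := if orient l 0 then 0%N else 6%N.
Definition keps l := if tblk l 3 == 1%N then 0%N else 6%N.
Definition kT2 l := (kT1 l + keps l)%N.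
Definition kquarter l :=
  if tblk l 3 == 1%N then (if orient l 1 then 0 else 6)%N
  else if orient l 1 then 3%N else 9%N.
Definition k61 l := (4 * tpos l 0)%N.
Definition k63 l := (k61 l + kquarter l)%N.
Definition k64 l := (k63 l + keps l)%N.
Definition k8 n l := (4 * (tpos l 0 + tpos l 3 + tpos l 6 + n * tblk l 0))%N.
Definition k12 l := (4 * (tpos l 0 + tpos l 3))%N.

Definition re (l : seq int) : seq (int * int) := [seq (a, 0) | a <- l].

Definition vE := re [:: 2; 2; 0; 0; -1; 2; 2; 2; 2; 0; 0; 0; -1; -1].
Definition vT1 := re [:: 3; -1; -1; 1; 0; 3; 3; 3; -1; -1; 1; 1; 0; 0].
Definition vT2 := re [:: 3; -1; 1; -1; 0; 3; 3; 3; -1; 1; -1; -1; 0; 0].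
Definition v61 := re [:: 6; 2; 0; 2; 0; 3; 0; -3; -1; 0; -1; -1; 0; 0].
Definition v63 : seq (int * int) :=
  re [:: 6; -2; 0; 0; 0; 3; 0; -3; 1; 0] ++ [:: (0, -1); (0, 1); (0, 0); (0, 0)].
Definition v64 : seq (int * int) :=
  re [:: 6; -2; 0; 0; 0; 3; 0; -3; 1; 0] ++ [:: (0, 1); (0, -1); (0, 0); (0, 0)].
Definition v81 := re [:: 8; 0; 0; 0; -1; -4; 2; -1; 0; 0; 0; 0; -1; 2].
Definition v82 := re [:: 8; 0; 0; 0; -1; -4; 2; -1; 0; 0; 0; 0; 2; -1].
Definition v12 := re [:: 12; 0; 2; 0; 0; 0; -3; 3; 0; -1; 0; 0; 0; 0].

Lemma tableE : char_table_ok PE kE 12 vE. Proof. by vm_compute. Qed.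
Lemma tableT1 : char_table_ok P1 kT1 8 vT1. Proof. by vm_compute. Qed.
Lemma tableT2 : char_table_ok P1 kT2 8 vT2. Proof. by vm_compute. Qed.
Lemma table61 : char_table_ok P4 k61 4 v61. Proof. by vm_compute. Qed.
Lemma table63 : char_table_ok P4 k63 4 v63. Proof. by vm_compute. Qed.
Lemma table64 : char_table_ok P4 k64 4 v64. Proof. by vm_compute. Qed.
Lemma table81 : char_table_ok P3 (k8 1) 3 v81. Proof. by vm_compute. Qed.
Lemma table82 : char_table_ok P3 (k8 2) 3 v82. Proof. by vm_compute. Qed.
Lemma table12 : char_table_ok P2 k12 2 v12. Proof. by vm_compute. Qed.

End CharacterTables.

Section GroupChecks.

Definition nonJ := [:: 1; 2; 3; 4; 8; 9; 10; 11; 12; 13]%N.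

Lemma Jtabs_closed : all (fun a => all (fun b => tcomp a b \in Jtabs) Jtabs) Jtabs.
Proof. by vm_compute. Qed.

Lemma Jtabs_normal : all (fun l => all (fun j => tconj j l \in Jtabs) Jtabs) Htabs.
Proof. by vm_compute. Qed.

Lemma Jtabs_abelian : all (fun a => all (tcommute a) Jtabs) Jtabs.
Proof. by vm_compute. Qed.

Lemma Jtabs_cube : all (fun a => tcomp a (tcomp a a) == tid) Jtabs.
Proof. by vm_compute. Qed.

Lemma Jtabs_inverted : all (fun a => has (fun l => tconj a l == tinv a) Ltabs) Jtabs.
Proof. by vm_compute. Qed.

Lemma reps_Jtabs : all (fun i => (rep i \in Jtabs) == (i \notin nonJ)) (iota 0 14).
Proof. by vm_compute. Qed.

(** Modulo J, a commutator of each representative outside J is conjugate to [t]; hence a normal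
    subgroup that properly contains J contains [t]. *)
Lemma reps_commutator : all (fun i => has (fun l => has (fun m =>
    tcomp (tinv (tconj (rep 1) m)) (tcomp (tinv (rep i)) (tconj (rep i) l)) \in Jtabs) Ltabs)
  Ltabs) nonJ.
Proof. by vm_compute. Qed.

(** This makes J minimal normal: the normal closure of any element of [J^#] contains [e1], and so
    its conjugates [e2] and [e3]. *)
Lemma reps_generate : all (fun i => has (fun l => has (fun m =>
    tconj (tcomp (rep i) (tconj (rep i) l)) m == te1) Ltabs) Ltabs) [:: 5; 6; 7]%N.
Proof. by vm_compute. Qed.

Lemma te1_conjugates : has (fun l => tconj te1 l == te2) Ltabs && has (fun l => tconj te1 l == te3) Ltabs.
Proof. by vm_compute. Qed.

Lemma reps_involution : all (fun i => (tcomp (rep i) (rep i) == tid) == (i < 3)) (iota 0 14).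
Proof. by vm_compute. Qed.

(** Hence the complement of A in H is covered by the classes numbered 0 to 4. *)
Lemma reps_roots : all (fun i => has (fun k =>
    (tpow (rep i) k \in Jtabs) && (tpow (rep i) k != tid)) (iota 0 5)) (iota 5 9).
Proof. by vm_compute. Qed.

Lemma reps_commute : tcommute (rep 1) (rep 5) && tcommute (rep 2) (rep 6).
Proof. by vm_compute. Qed.

Lemma cent_s_j2 : count (fun l => tcommute (rep 2) l && tcommute (rep 6) l) Htabs = 6.
Proof. by vm_compute. Qed.

End GroupChecks.

Section VirtualCharacterTables.
Local Open Scope ring_scope.

Definition irr_table j : seq (int * int) :=
  nth [::] [:: re (nseq 14 1); vE; vT1; vT2; v61; v63; v64; v81; v82; v12] j.

(** Only entries that are both rational or both multiples of the square root of 3 are compared, so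
    no linear independence is called for. *)
Lemma irr_table_neq : all (fun j => all (fun k => (j == k) || has (fun i =>
    let v := nth (0, 0) (irr_table j) i in let w := nth (0, 0) (irr_table k) i in
    [&& v.2 == 0, w.2 == 0 & v.1 != w.1] || [&& v.1 == 0, w.1 == 0 & v.2 != w.2])
  (iota 0 14)) (iota 0 10)) (iota 0 10).
Proof. by vm_compute. Qed.

Definition vdot (c d : seq int) : int := foldr (fun j s => c`_j * d`_j + s) 0 (iota 0 10).

Definition vvals (c : seq int) i : int * int :=
  (foldr (fun j s => c`_j * (nth (0, 0) (irr_table j) i).1 + s) 0 (iota 0 10),
   foldr (fun j s => c`_j * (nth (0, 0) (irr_table j) i).2 + s) 0 (iota 0 10)).

(* 24 is a common multiple of the degrees in irr_table. *)
Definition vcoef (c : seq int) a b : int :=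
  foldr (fun j s => let v i := (nth (0, 0) (irr_table j) i).1 in
    c`_j * (v a * v b * (24%N %/ v 0%N)%Z) + s) 0 (iota 0 10).

Lemma irr_table_rat : all (fun j => let v i := nth (0, 0) (irr_table j) i in
   [&& (v 0%N).1 != 0, ((v 0%N).1 * (24%N %/ (v 0%N).1)%Z == 24%N%:Z), (v 0%N).2 == 0,
       (v 1%N).2 == 0 & (v 2%N).2 == 0]) (iota 0 10).
Proof. by vm_compute. Qed.

End VirtualCharacterTables.

(* Otherwise unification and [//] unfold these 648-element lists. *)
Opaque Htabs Jtabs Ltabs te1 te2 te3 tid.

(** * The group H and its characters *)

Section Tabulated.
Variables (gT : finGroupType) (H : {group gT}) (tb : gT -> seq nat).
Hypothesis tbM : {in H &, forall x y, tb (x * y) = tcomp (tb x) (tb y)}.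
Hypothesis tb_inj : {in H &, injective tb}.
Hypothesis tbH : forall x, x \in H -> tb x \in Htabs.
Hypothesis tbS : forall l, l \in Htabs -> exists2 x, x \in H & tb x = l.

Definition elt l : gT := odflt 1 [pick x in H | tb x == l].

Lemma elt_spec l : l \in Htabs -> elt l \in H /\ tb (elt l) = l.
Proof.
move=> Hl; rewrite /elt; case: pickP => [x /andP[Hx /eqP]|no] //.
by have [x Hx E] := tbS Hl; have := no x; rewrite Hx E eqxx.
Qed.

Lemma elt_in l : l \in Htabs -> elt l \in H. Proof. by case/elt_spec. Qed.
Lemma eltK l : l \in Htabs -> tb (elt l) = l. Proof. by case/elt_spec. Qed.
Lemma tbK x : x \in H -> elt (tb x) = x.
Proof. by move=> Hx; apply: tb_inj; rewrite ?elt_in ?eltK ?tbH. Qed.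

Lemma tb1 : tb 1 = tid.
Proof.
have [x Hx E] : exists2 x, x \in H & tb x = tid by apply: tbS; vm_compute.
suff <- : x = 1 by [].
by apply: (mulgI x); rewrite mulg1; apply: tb_inj; rewrite ?groupM // tbM // E.
Qed.

Lemma tbV : {in H, forall x, tb x^-1 = tinv (tb x)}.
Proof.
move=> x Hx; have /allP/(_ _ (tbH Hx))/andP[Hi /eqP xi] := tinv_Htabs.
suff -> : x^-1 = elt (tinv (tb x)) by rewrite eltK.
apply: (mulgI x); rewrite mulgV; apply: tb_inj; rewrite ?groupM ?elt_in //.
by rewrite tbM ?elt_in // eltK // xi tb1.
Qed.

Lemma tbJ : {in H &, forall x y, tb (x ^ y) = tconj (tb x) (tb y)}.
Proof. by move=> x y Hx Hy; rewrite conjgE !tbM ?groupM ?groupV // tbV. Qed.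

Lemma enum_tabs : perm_eq (enum H) [seq elt l | l <- Htabs].
Proof.
apply: uniq_perm; rewrite ?enum_uniq //.
  rewrite map_inj_in_uniq ?Htabs_uniq // => l m Hl Hm E.
  by rewrite -(eltK Hl) E eltK.
move=> x; rewrite mem_enum; apply/idP/mapP=> [Hx | [l Hl ->]]; last exact: elt_in.
by exists (tb x); rewrite ?tbK ?tbH.
Qed.

Lemma card_H : #|H| = 648.
Proof. by rewrite cardE (perm_size enum_tabs) size_map. Qed.

Lemma sum_tabs (R : nmodType) (F : gT -> R) :
  (\sum_(x in H) F x = \sum_(l <- Htabs) F (elt l))%R.
Proof. by rewrite -big_enum (perm_big _ enum_tabs) big_map. Qed.

Lemma card_tabs (P : pred (seq nat)) : #|[set x in H | P (tb x)]| = count P Htabs.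
Proof.
rewrite -sum1_card (eq_bigl (fun x => (x \in H) && P (tb x))) => [|x]; last by rewrite inE.
rewrite big_mkcondr -big_enum (perm_big _ enum_tabs) big_map /= -big_mkcond sum1_count.
by apply: eq_in_count => l Hl; rewrite eltK.
Qed.

Definition r i := elt (rep i).

Lemma rep_in i : rep i \in Htabs.
Proof.
have [lti|lei] := ltnP i 14; last by rewrite /rep nth_default //; vm_compute.
by have /(_ (rep i)) := allP reps_Htabs; apply; apply: mem_nth.
Qed.

Lemma r_in i : r i \in H. Proof. exact/elt_in/rep_in. Qed.

Lemma card_cent_r i : i < 14 -> #|'C_H[r i]| = cent_size i.
Proof.
move=> lti; have /allP/(_ i) := cent_sizeE; rewrite mem_iota => /(_ lti)/eqP <-.
rewrite -card_tabs; congr #|pred_of_set _|; apply/setP=> y; rewrite in_setI [RHS]inE.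
apply: andb_id2l => Hy; apply/cent1P/eqP => [c|c].
  by have := congr1 tb (c : _ * _ = _ * _); rewrite !tbM ?r_in // eltK ?rep_in.
by apply: tb_inj; rewrite ?groupM ?r_in // !tbM ?r_in // eltK ?rep_in.
Qed.

Lemma r_nonconj i j : i < 14 -> j < 14 -> i != j -> r j \notin r i ^: H.
Proof.
move=> lti ltj nij; apply/imsetP=> -[y Hy E].
have /allP/(_ i) := reps_nonconj; rewrite mem_iota => /(_ lti)/allP/(_ j).
rewrite mem_iota (negPf nij) => /(_ ltj) /orP[/eqP [] | /allP/(_ _ (tbH Hy))].
  rewrite -!card_cent_r // E -['C_H[_]]/(H :&: _) cent1J -{2}(conjGid Hy) -conjIg cardJg //.
by rewrite -[rep i]eltK ?rep_in // -tbJ ?r_in // -E eltK ?rep_in ?eqxx.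
Qed.

Lemma card_class_r i : i < 14 -> #|r i ^: H| = 648 %/ cent_size i.
Proof.
move=> lti; rewrite -index_cent1 -card_cent_r // -card_H.
by rewrite -(divgS (subsetIl _ _)).
Qed.

Lemma classes_disjoint (i j : 'I_14) : i != j -> [disjoint r i ^: H & r j ^: H].
Proof.
move=> nij; apply/pred0P=> x /=; apply/negP=> /andP[xi xj].
have /negP[] := r_nonconj (ltn_ord i) (ltn_ord j) nij.
by rewrite -(class_eqP xi) (class_eqP xj) class_refl.
Qed.

(** The fourteen classes are disjoint, and the sizes [648 %/ cent_size i] add up to 648. *)
Lemma classes_cover : \bigcup_(i < 14) r i ^: H = H.
Proof.
apply/eqP; rewrite eqEcard; apply/andP; split.
  by apply/bigcupsP=> i _; rewrite class_subG ?r_in.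
rewrite card_H -sum1_card partition_disjoint_bigcup //; last exact: classes_disjoint.
rewrite (eq_bigr (fun i : 'I_14 => 648 %/ cent_size i)) => [|i _]; last first.
  by rewrite sum1_card card_class_r.
by rewrite -(big_mkord xpredT (fun i => 648 %/ cent_size i)) /index_iota unlock; vm_compute.
Qed.

Lemma class_rep x : x \in H -> exists2 i, i < 14 & x \in r i ^: H.
Proof. by rewrite -{1}classes_cover => /bigcupP[i _ xi]; exists i. Qed.

Lemma sum_classes (R : nmodType) (F : gT -> R) :
    (forall x y, x \in H -> y \in H -> F (x ^ y) = F x) ->
  (\sum_(x in H) F x = \sum_(i < 14) F (r i) *+ (648 %/ cent_size i))%R.
Proof.
move=> FJ; rewrite -[in LHS]classes_cover partition_disjoint_bigcup; last exact: classes_disjoint.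
apply: eq_bigr => i _; rewrite -card_class_r // -sumr_const; apply: eq_bigr => _ /imsetP[y Hy ->].
exact: FJ (r_in i) Hy.
Qed.

Lemma Ltabs_Htabs : {subset Ltabs <= Htabs}.
Proof. by apply/allP; vm_compute. Qed.

Lemma Jtabs_Htabs : {subset Jtabs <= Htabs}.
Proof. by apply/allP; vm_compute. Qed.

Lemma eltM l m : l \in Htabs -> m \in Htabs -> tcomp l m \in Htabs ->
  elt (tcomp l m) = elt l * elt m.
Proof.
move=> Hl Hm Hlm; apply: tb_inj; rewrite ?groupM ?elt_in //.
by rewrite tbM ?elt_in // !eltK.
Qed.

Lemma sum_L (F : gT -> algC) :
    (forall y j, y \in H -> j \in H -> tb j \in Jtabs -> F (y * j) = F y) ->
  (\sum_(x in H) F x = 27%:R * \sum_(l <- Ltabs) F (elt l))%R.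
Proof.
move=> FJ; rewrite sum_tabs big_allpairs_dep mulr_sumr big_seq [RHS]big_seq.
apply: eq_bigr => l Ll; rewrite big_seq (eq_bigr (fun=> F (elt l))) => [|j Jj].
  by rewrite -big_seq big_const_seq count_predT iter_addr_0 mulr_natl.
have Hl := Ltabs_Htabs Ll; have Hj := Jtabs_Htabs Jj.
by rewrite eltM ?FJ ?elt_in ?eltK // allpairs_f.
Qed.

Local Open Scope ring_scope.

Variable z : algC.
Hypotheses (z6 : z ^+ 6 = -1) (z4 : z ^+ 4 = z ^+ 2 - 1) (zC : z^* = z^-1).

Section MonomialCharacter.
Variables (P : pred (seq nat)) (k : seq nat -> nat) (m : nat).
Hypothesis okPk : mono_ok P k.
Hypothesis JP : all P Jtabs.
Hypothesis card_P : count P Htabs = (27 * m)%N.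
Hypothesis m_gt0 : (0 < m)%N.

Let M0 := [set x in H | P (tb x)].

Let closed a b : a \in M0 -> b \in M0 ->
  P (tb (a * b)%g) && (k (tb (a * b)%g) == k (tb a) + k (tb b) %[mod 12])%N.
Proof.
rewrite !inE => /andP[Ha Pa] /andP[Hb Pb].
case/andP: okPk => _ /allP/(_ (tb a)); rewrite mem_filter Pa tbH // => /(_ isT).
by move/allP/(_ (tb b)); rewrite mem_filter Pb tbH // tbM // => /(_ isT).
Qed.

Let M_group : group_set M0.
Proof.
apply/group_setP; split=> [|x y Mx My].
  by rewrite inE group1 tb1; case/andP: okPk.
have /andP[+ _] := closed Mx My; move: Mx My; rewrite !inE => /andP[Hx _] /andP[Hy _] ->.
by rewrite groupM.
Qed.
Let M := Group M_group.

Lemma zX12 n : z ^+ (n %% 12) = z ^+ n.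
Proof.
have z12 : z ^+ 12 = 1 by rewrite (exprM z 6 2) z6 sqrrN expr1n.
by rewrite [in RHS](divn_eq n 12) exprD mulnC exprM z12 expr1n mul1r.
Qed.

Lemma mono_lin : exists2 th : 'CF(M), th \is a character &
  {in M, forall x, th x = z ^+ k (tb x)}.
Proof.
have zk x y : x \in M -> y \in M -> z ^+ k (tb (x * y)%g) = z ^+ k (tb x) * z ^+ k (tb y).
  by move=> Mx My; have /andP[_ /eqP E] := closed Mx My; rewrite -zX12 E zX12 exprD.
have z_neq0 : z != 0.
  by apply/eqP=> z0; move/eqP: z6; rewrite z0 expr0n eq_sym oppr_eq0 oner_eq0.
have zk1 : z ^+ k (tb 1%g) = 1.
  have := zk 1%g 1%g (group1 _) (group1 _); rewrite mulg1 => E.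
  by apply: (mulfI (_ : z ^+ k (tb 1%g) != 0)); rewrite ?expf_neq0 // -E mulr1.
pose rG x : 'M[algC]_1 := (z ^+ k (tb x))%:M.
have rG_repr : mx_repr M rG.
  split=> [|x y Mx My]; first by rewrite /rG zk1.
  by rewrite /rG zk // scalar_mxM.
exists (cfRepr (MxRepresentation rG_repr)); first exact: cfRepr_char.
by move=> x Mx; rewrite cfunE Mx mulr1n mxtrace_scalar.
Qed.

(** As [M] contains J, the induction sum is constant on cosets of J, and the 24 representatives give
    it up to the factor 27. *)
Lemma mono_char : exists2 chi : 'CF(H), chi \is a character &
  {in Htabs, forall l, chi (elt l) = m%:R^-1 * \sum_(e <- mono_exps P k l) z ^+ e}.
Proof.
have [th th_char thE] := mono_lin.
exists ('Ind[H] th); first exact: cfInd_char.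
have sMH : M \subset H by apply/subsetP=> x; rewrite inE => /andP[].
move=> l Hl; rewrite cfIndE // (@sum_L (fun y => th (elt l ^ y)%g)); last first.
  move=> y j Hy Hj Jj; rewrite conjgM cfunJ // inE Hj; exact: (allP JP).
have -> : #|M| = (27 * m)%N by rewrite -card_P -card_tabs.
have E0 : (27 * m)%:R^-1 * 27%:R = m%:R^-1 :> algC.
  by rewrite natrM; field; rewrite pnatr_eq0 -lt0n.
rewrite mulrA E0; congr (_ * _).
rewrite /mono_exps [RHS]big_map [RHS]big_filter [RHS]big_map [RHS]big_mkcond big_seq [RHS]big_seq.
apply: eq_bigr => c Lc; have Hc := Ltabs_Htabs Lc.
have E : tb (elt l ^ elt c)%g = tconj l c by rewrite tbJ ?elt_in ?eltK.
have Hx : (elt l ^ elt c)%g \in H by rewrite groupJ ?elt_in.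
case: ifP => Pc; first by rewrite thE ?E // inE Hx E.
by rewrite cfun0 // inE Hx E Pc.
Qed.

End MonomialCharacter.

Lemma zcoordE j : (j < 12)%N ->
  z ^+ j = ((zcoord j)`_0)%:~R + ((zcoord j)`_1)%:~R * z + ((zcoord j)`_2)%:~R * z ^+ 2 +
           ((zcoord j)`_3)%:~R * z ^+ 3.
Proof.
have z5 : z ^+ 5 = z ^+ 3 - z by rewrite exprS z4 mulrBr -exprS mulr1.
case: j => [|[|[|[|[|[|j]]]]]]; rewrite /zcoord /= ?z4 ?z5; try by move=> _; ring.
have zS i : z ^+ i.+4.+2 = - z ^+ i by rewrite -[i.+4.+2]/(6 + i)%N exprD z6 mulN1r.
by case: j => [|[|[|[|[|[|//]]]]]] _; rewrite zS ?z4 ?z5 /=; ring.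
Qed.

Lemma zvecE ks : \sum_(e <- ks) z ^+ e =
  ((zvec ks)`_0)%:~R + ((zvec ks)`_1)%:~R * z + ((zvec ks)`_2)%:~R * z ^+ 2 +
  ((zvec ks)`_3)%:~R * z ^+ 3.
Proof.
have zc4 i : (i < 12)%N -> size (zcoord i) = 4 by do 12?[case: i => [|i] //].
suff [] : size (zvec ks) = 4 /\ \sum_(e <- ks) z ^+ e =
  ((zvec ks)`_0)%:~R + ((zvec ks)`_1)%:~R * z + ((zvec ks)`_2)%:~R * z ^+ 2 +
  ((zvec ks)`_3)%:~R * z ^+ 3 by [].
elim: ks => [|k ks [sz IH]]; first by split; rewrite ?big_nil //=; ring.
have lt12 : (k %% 12 < 12)%N by rewrite ltn_mod.
rewrite big_cons IH -zX12 zcoordE //= /zvec /= -/(zvec ks).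
move: (zc4 _ lt12) sz; move: (zcoord _) (zvec ks) => [|a0 [|a1 [|a2 [|a3 [|? ?]]]]] //.
move=> [|b0 [|b1 [|b2 [|b3 [|? ?]]]]] //= _ _; split=> //.
by rewrite !rmorphD /=; ring.
Qed.

(** This is [z + z^-1], because [z^-1 = z - z ^+ 3]. *)
Definition sqrt3 := 2%:R * z - z ^+ 3.

Lemma sqrt3_sqr : sqrt3 * sqrt3 = 3%:R.
Proof.
rewrite /sqrt3; have -> : (2%:R * z - z ^+ 3) * (2%:R * z - z ^+ 3) =
  4%:R * z ^+ 2 - 4%:R * z ^+ 4 + z ^+ 6 by ring.
by rewrite z6 z4; ring.
Qed.

Lemma sqrt3_real : sqrt3^* = sqrt3.
Proof.
have z_neq0 : z != 0.
  by apply/eqP=> z0; move/eqP: z6; rewrite z0 expr0n eq_sym oppr_eq0 oner_eq0.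
have zV : z^-1 = z - z ^+ 3.
  apply: (mulfI z_neq0); rewrite divff // mulrBr -exprS z4; ring.
have z5 : z ^+ 5 = z ^+ 3 - z by rewrite exprS z4 mulrBr -exprS mulr1.
rewrite /sqrt3 rmorphB rmorphM rmorphXn /= zC zV rmorph_nat.
have -> : (z - z ^+ 3) ^+ 3 = z ^+ 3 - 3%:R * z ^+ 5 + 3%:R * z ^+ 6 * z - z ^+ 6 * z ^+ 3 by ring.
by rewrite z5 z6; ring.
Qed.

Definition tval (vals : seq (int * int)) i : algC :=
  let v := nth (0, 0) vals i in v.1%:~R + v.2%:~R * sqrt3.

Lemma table_irr P k m vals : char_table_ok P k m vals ->
  exists2 chi : 'CF(H), chi \in irr H & forall i, (i < 14)%N -> chi (r i) = tval vals i.
Proof.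
case/and5P=> ok JP /eqP cP m0 /and3P[/allP vok /allP v0 /eqP norm].
have [chi chi_char chiE] := mono_char ok JP cP m0.
have valE i : (i < 14)%N -> chi (r i) = tval vals i.
  move=> lti; rewrite /r chiE ?rep_in // zvecE.
  have := vok i; rewrite mem_iota => /(_ lti)/eqP -> /=.
  rewrite /tval /sqrt3 !rmorphN !rmorphM /= -pmulrn; field.
  by rewrite pnatr_eq0 -lt0n.
exists chi => //; rewrite irrEchar chi_char /= cfdotE.
rewrite (@sum_classes _ (fun x => chi x * (chi x)^*)); last first.
  by move=> x y Hx Hy; rewrite cfunJ.
rewrite card_H (eq_bigr (fun i : 'I_14 => ((let v := nth (0, 0) vals i in
        (v.1 * v.1 + 3%:Z * (v.2 * v.2)) * (648 %/ cent_size i)%N%:Z) : int)%:~R)); last first.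
  move=> i _; rewrite valE // /tval rmorphD rmorphM /= sqrt3_real !aut_intr ?intr_int //.
  (* One of the two coordinates is zero, so the square of the value is [a ^+ 2 + 3 * b ^+ 2] without
     a cross term. *)
  have ab : (nth (0, 0) vals i).1%:~R * (nth (0, 0) vals i).2%:~R = 0 :> algC.
    apply/eqP; rewrite mulf_eq0 !intr_eq0.
    have [lti|lei] := ltnP i (size vals); last by rewrite nth_default.
    exact: v0 _ (mem_nth _ lti).
  rewrite rmorphM rmorphD !rmorphM /= -[in RHS]pmulrn mulr_natr -sqrt3_sqr; congr (_ *+ _).
  move: ab; set a := (_ .1)%:~R; set b := (_ .2)%:~R => ab.
  have -> : (a + b * sqrt3) * (a + b * sqrt3) = a * a + 2%:R * sqrt3 * (a * b) + b * b * (sqrt3 * sqrt3) by ring.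
  by rewrite ab; ring.
rewrite -rmorph_sum /= (_ : \sum_i _ = 648%:Z).
  by rewrite -pmulrn mulVf ?pnatr_eq0.
rewrite -norm -(big_mkord xpredT (fun i => (let v := nth (0, 0) vals i in
        (v.1 * v.1 + 3%:Z * (v.2 * v.2)) * (648 %/ cent_size i)%N%:Z) : int)).
by rewrite /index_iota unlock.
Qed.

Local Close Scope ring_scope.

Definition J0 := [set x in H | tb x \in Jtabs].

Lemma in_J0 x : (x \in J0) = (x \in H) && (tb x \in Jtabs).
Proof. exact: in_set. Qed.

Lemma J0_group_set : group_set J0.
Proof.
apply/group_setP; split=> [|x y]; first by rewrite in_J0 group1 tb1; vm_compute.
rewrite !in_J0 => /andP[Hx Jx] /andP[Hy Jy]; rewrite groupM // tbM //.
by have /allP/(_ _ Jx)/allP/(_ _ Jy) := Jtabs_closed.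
Qed.

Canonical J0_group := Group J0_group_set.

Lemma J0_sub : J0 \subset H.
Proof. by apply/subsetP=> x; rewrite in_J0 => /andP[]. Qed.

Lemma card_J0 : #|J0| = 27.
Proof. by rewrite card_tabs; vm_compute. Qed.

Lemma J0_normal : J0 <| H.
Proof.
apply/andP; split; first exact: J0_sub.
apply/subsetP=> y Hy; rewrite inE; apply/subsetP=> _ /imsetP[x + ->].
rewrite !in_J0 => /andP[Hx Jx]; rewrite groupJ // tbJ //.
by have /allP/(_ _ (tbH Hy))/allP/(_ _ Jx) := Jtabs_normal.
Qed.

Lemma J0_abelian : abelian J0.
Proof.
apply/centsP=> x + y; rewrite !in_J0 => /andP[Hx Jx] /andP[Hy Jy].
apply: tb_inj; rewrite ?groupM // !tbM //.
by have /allP/(_ _ Jx)/allP/(_ _ Jy)/eqP := Jtabs_abelian.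
Qed.

Lemma J0_cube x : x \in J0 -> x ^+ 3 = 1.
Proof.
rewrite in_J0 => /andP[Hx Jx]; apply: tb_inj; rewrite ?groupX // tb1 !expgS expg0 mulg1.
by rewrite !tbM ?groupM //; have /allP/(_ _ Jx)/eqP := Jtabs_cube.
Qed.

Lemma r_J0 i : i < 14 -> (r i \in J0) = (i \notin nonJ).
Proof.
move=> lti; have /allP/(_ i) := reps_Jtabs; rewrite mem_iota => /(_ lti)/eqP <-.
by rewrite in_J0 r_in eltK ?rep_in.
Qed.

Lemma r0 : r 0 = 1.
Proof. by apply: tb_inj; rewrite ?r_in // eltK ?rep_in // tb1. Qed.

(** * Normal subgroups of H in relation to J *)

Section NormalSubgroups.
Variable N : {group gT}.
Hypothesis nsNH : N <| H.

Let nH x y : y \in H -> (x ^ y \in N) = (x \in N).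
Proof. by move=> Hy; rewrite memJ_norm // (subsetP (normal_norm nsNH)). Qed.

Lemma class_normal x i : x \in N -> x \in r i ^: H -> r i \in N.
Proof. by move=> Nx /imsetP[y Hy E]; rewrite E nH in Nx. Qed.

Lemma nonJ_t i : J0 \subset N -> i \in nonJ -> r i \in N -> r 1 \in N.
Proof.
move=> sJN iJ Ni; have /allP/(_ i iJ)/hasP[l Ll /hasP[m Lm Jj]] := reps_commutator.
have [Hl Hm] := (Ltabs_Htabs Ll, Ltabs_Htabs Lm).
pose c := (r i)^-1 * r i ^ elt l; pose t' := r 1 ^ elt m.
have Hc : c \in H by rewrite groupM ?groupV ?groupJ ?r_in ?elt_in.
have Ht : t' \in H by rewrite groupJ ?r_in ?elt_in.
have Nj : t'^-1 * c \in N.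
  apply: (subsetP sJN); rewrite in_J0 groupM ?groupV //= (tbM (groupVr Ht) Hc) tbV //.
  rewrite (tbM (groupVr (r_in i)) (groupJ (r_in i) (elt_in Hl))) tbV ?r_in //.
  by rewrite !(tbJ (r_in _)) ?elt_in // !eltK ?rep_in.
rewrite -(nH _ (elt_in Hm)) -/t' -groupV -(groupMr _ (_ : c \in N)) //.
by rewrite groupM ?groupV // nH ?elt_in.
Qed.

Lemma J0_minnormal x : x \in N -> x \in J0 -> x != 1 -> J0 \subset N.
Proof.
move=> Nx Jx x1; have [i lti xi] := class_rep (subsetP J0_sub x Jx).
have Ni := class_normal Nx xi.
have Ji : r i \in J0.
  by case/imsetP: xi => y Hy E; move: Jx; rewrite E memJ_norm // (subsetP (normal_norm J0_normal)).
have i0 : i != 0.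
  by apply: contraNneq x1 => E; case/imsetP: xi => y _ ->; rewrite E r0 conj1g.
have i567 : i \in [:: 5; 6; 7].
  move: Ji i0; rewrite r_J0 //; move: lti {xi Ni}.
  by do 14?[case: i => [|i] //].
have /allP/(_ i i567)/hasP[l Ll /hasP[m Lm /eqP E]] := reps_generate.
have [Hl Hm] := (Ltabs_Htabs Ll, Ltabs_Htabs Lm).
have te1H : te1 \in Htabs by vm_compute.
have N1 : elt te1 \in N.
  have -> : elt te1 = (r i * r i ^ elt l) ^ elt m.
    have Hil := groupJ (r_in i) (elt_in Hl); have Hx := groupM (r_in i) Hil.
    apply: tb_inj; rewrite ?elt_in //; first exact: groupJ (elt_in Hm).
    rewrite (tbJ Hx) ?elt_in // (tbM (r_in i) Hil) (tbJ (r_in i)) ?elt_in //.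
    by rewrite !eltK ?rep_in.
  by rewrite nH ?elt_in // groupM // nH ?elt_in.
have Nc te : has (fun l => tconj te1 l == te) Ltabs -> te \in Htabs -> elt te \in N.
  move=> /hasP[l' /Ltabs_Htabs Hl' /eqP E'] Hte.
  have -> : elt te = elt te1 ^ elt l'.
    by apply: tb_inj; rewrite ?groupJ ?elt_in // tbJ ?elt_in // !eltK.
  by rewrite nH ?elt_in.
have /andP[h2 h3] := te1_conjugates.
have te2H : te2 \in Htabs by vm_compute.
have te3H : te3 \in Htabs by vm_compute.
have [N2 N3] := (Nc _ h2 te2H, Nc _ h3 te3H).
have pw te n : te \in Htabs -> elt te \in N -> exists2 y, y \in N & y \in H /\ tb y = tpow te n.
  move=> Hte Nte; exists (elt te ^+ n); first exact: groupX.
  split; first by rewrite groupX ?elt_in.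
  elim: n => [|n IH]; first by rewrite expg0 tb1.
  by rewrite expgSr tbM ?groupX ?elt_in // eltK // IH.
apply/subsetP=> y; rewrite in_J0 => /andP[Hy].
case/allpairsP=> -[a d] [_ + Ey]; case/allpairsP=> -[b c] [_ _ Ed].
move: Ey; rewrite Ed => Ey.
have [ya Na [Ha Ea]] := pw te1 a te1H N1.
have [yb Nb [Hb Eb]] := pw te2 b te2H N2.
have [yc Ncc [Hc Ec]] := pw te3 c te3H N3.
have -> : y = ya * (yb * yc).
  by apply: tb_inj; rewrite ?groupM // !tbM ?groupM // Ea Eb Ec.
by rewrite !groupM.
Qed.

Lemma J0_maximal : J0 \subset N -> r 1 \notin N -> N \subset J0.
Proof.
move=> sJN nt; apply/subsetP=> x Nx.
have Hx := subsetP (normal_sub nsNH) x Nx; have [i lti xi] := class_rep Hx.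
have Ni := class_normal Nx xi.
have Ji : r i \in J0.
  by rewrite r_J0 //; apply: contra nt => iJ; apply: nonJ_t Ni.
by case/imsetP: xi => y Hy ->; rewrite memJ_norm // (subsetP (normal_norm J0_normal)).
Qed.

End NormalSubgroups.

Lemma r_order2 i : i < 14 -> (r i ^+ 2 == 1) = (i < 3).
Proof.
move=> lti; have /allP/(_ i) := reps_involution; rewrite mem_iota => /(_ lti)/eqP <-.
apply/eqP/eqP => E.
  by have := congr1 tb E; rewrite expg2 tbM ?r_in // eltK ?rep_in // tb1.
by apply: tb_inj; rewrite ?groupX ?r_in // expg2 tbM ?r_in // eltK ?rep_in // tb1.
Qed.

Lemma r_neq1 i : 0 < i < 14 -> r i != 1.
Proof.
case/andP=> i0 lti; apply/eqP=> E; have := r_nonconj (isT : 0 < 14) lti.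
by rewrite eq_sym -lt0n i0 E r0 class_refl => /(_ isT).
Qed.

(** By [J0_maximal] a larger normal subgroup would contain the involution [r 1], which no 3-group
    does. *)
Lemma J0E : 'O_3(H) = J0.
Proof.
have sJO : J0 \subset 'O_3(H) by rewrite pcore_max ?J0_normal // /pgroup card_J0.
apply/eqP; rewrite eqEsubset sJO andbT.
apply: J0_maximal sJO _; first exact: pcore_normal.
apply/negP=> Ot; have := mem_p_elt (pcore_pgroup 3 H) Ot.
have r2 : r 1 ^+ 2 = 1 by apply/eqP; rewrite r_order2.
by rewrite /p_elt (orderE (r 1)) -orderE (nt_prime_order _ r2) ?r_neq1.
Qed.

Lemma r_commute i j : tcommute (rep i) (rep j) -> commute (r i) (r j).
Proof.
move/eqP=> E; apply: (tb_inj (groupM (r_in i) (r_in j)) (groupM (r_in j) (r_in i))).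
by rewrite (tbM (r_in i) (r_in j)) (tbM (r_in j) (r_in i)) !eltK ?rep_in.
Qed.

Lemma card_cent_r26 : #|'C_H[r 2] :&: 'C[r 6]| = 6.
Proof.
rewrite -[RHS]cent_s_j2 -card_tabs; apply: eq_card => y; rewrite !in_setI [RHS]in_set -andbA.
apply: andb_id2l => Hy; have c i : (y \in 'C[r i]) = tcommute (rep i) (tb y).
  apply/cent1P/eqP => [E|E].
    by have := congr1 tb (E : _ * _ = _ * _); rewrite !tbM ?r_in // eltK ?rep_in.
  by apply: tb_inj; rewrite ?groupM ?r_in // !tbM ?r_in // eltK ?rep_in.
by rewrite !c.
Qed.

Lemma J0_inverted x : x \in J0 -> x^-1 \in x ^: H.
Proof.
rewrite in_J0 => /andP[Hx Jx]; have /allP/(_ _ Jx)/hasP[l Ll /eqP E] := Jtabs_inverted.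
have Hl := Ltabs_Htabs Ll; apply/imsetP; exists (elt l); first exact: elt_in.
by apply: tb_inj; rewrite ?groupV ?groupJ ?elt_in // tbV // tbJ ?elt_in // eltK.
Qed.

Lemma involution_class x : x \in H -> x ^+ 2 = 1 -> x != 1 -> x \in r 1 ^: H \/ x \in r 2 ^: H.
Proof.
move=> Hx x2 x1; have [i lti xi] := class_rep Hx.
have ri2 : r i ^+ 2 == 1.
  case/imsetP: xi => y Hy E; rewrite -(conjg_eq1 _ y) conjXg -E; exact/eqP.
have i0 : i != 0.
  by apply: contraNneq x1 => E; case/imsetP: xi => y _ ->; rewrite E r0 conj1g.
by move: ri2 xi i0; rewrite r_order2 //; case: i {lti} => [|[|[|i]]] // _ xi _; [left|right].
Qed.

Lemma r_roots i : 4 < i < 14 -> <[r i]> :&: J0 != 1.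
Proof.
move=> lti; have /allP/(_ i) := reps_roots; rewrite mem_iota => /(_ lti)/hasP[k _ /andP[Jk k1]].
have E : tb (r i ^+ k) = tpow (rep i) k.
  elim: k {Jk k1} => [|k IH]; first by rewrite expg0 tb1.
  by rewrite expgSr tbM ?groupX ?r_in // IH eltK ?rep_in.
apply/trivgPn; exists (r i ^+ k).
  by rewrite inE mem_cycle in_J0 groupX ?r_in // E.
by apply: contraNneq k1 => E1; rewrite -E E1 tb1.
Qed.

Lemma class_roots h : h \in H -> <[h]> :&: J0 = 1 -> exists2 i, i < 5 & h \in r i ^: H.
Proof.
move=> Hh; have [i lti /imsetP[y Hy ->]] := class_rep Hh.
have nJ := subsetP (normal_norm J0_normal) _ Hy.
rewrite cycleJ -(normP nJ) -conjIg => /(canRL (conjsgK y)); rewrite conjs1g => E.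
exists i; last exact: memJ_class.
by rewrite ltnNge; apply/negP=> le5; case/eqP: (r_roots (introT andP (conj le5 lti))).
Qed.

Local Open Scope ring_scope.

Section VirtualCharacters.
Variable X : nat -> 'CF(H).
Hypothesis X_irr : forall j, (j < 10)%N -> X j \in irr H.
Hypothesis X_val : forall j i, (j < 10)%N -> (i < 14)%N -> X j (r i) = tval (irr_table j) i.

Definition vchar (c : seq int) : 'CF(H) := \sum_(j < 10) (c`_j)%:~R *: X j.

Lemma sqrt3_neq0 : sqrt3 != 0.
Proof. by apply/eqP=> E; have := sqrt3_sqr; rewrite E mul0r => /esym/eqP; rewrite pnatr_eq0. Qed.

Lemma X_inj j k : (j < 10)%N -> (k < 10)%N -> j != k -> X j != X k.
Proof.
move=> ltj ltk njk; apply/eqP=> E.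
have /allP/(_ j) := irr_table_neq; rewrite mem_iota => /(_ ltj)/allP/(_ k).
rewrite mem_iota (negPf njk) => /(_ ltk)/hasP[i]; rewrite mem_iota => lti.
have := X_val ltk lti; rewrite -E X_val // /tval /=.
case: nth => a b; case: nth => a' b' /= Eab /orP[]/and3P[/eqP E0 /eqP E1]; rewrite {}E0 {}E1 in Eab.
  by rewrite !mul0r !addr0 in Eab; rewrite (intr_inj Eab) eqxx.
by rewrite !add0r in Eab; rewrite (intr_inj (mulIf sqrt3_neq0 Eab)) eqxx.
Qed.

Lemma cfdot_X j k : (j < 10)%N -> (k < 10)%N -> '[X j, X k] = (j == k)%:R.
Proof.
move=> ltj ltk; have /irrP[a Ea] := X_irr ltj; have /irrP[b Eb] := X_irr ltk.
rewrite Ea Eb cfdot_irr; have [E|njk] := eqVneq j k.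
  by rewrite -(inj_eq irr_inj) -Ea -Eb E eqxx.
by have := X_inj ltj ltk njk; rewrite Ea Eb (inj_eq irr_inj) => /negPf->.
Qed.

Lemma vchar_Z c : vchar c \in 'Z[irr H].
Proof.
rewrite rpred_sum // => j _; rewrite scaler_int rpredMz //.
by have /irrP[a ->] := X_irr (ltn_ord j); apply: irr_vchar.
Qed.

Lemma foldr_ord (F : nat -> int) n : foldr (fun j s => F j + s) 0 (iota 0 n) = \sum_(j < n) F j.
Proof. by rewrite -(big_mkord xpredT) /index_iota subn0 unlock. Qed.

Lemma vchar_dot c d : '[vchar c, vchar d] = (vdot c d)%:~R.
Proof.
rewrite /vdot foldr_ord rmorph_sum cfdot_suml; apply: eq_bigr => j _ /=.
rewrite cfdot_sumr (bigD1 j) //= big1 ?addr0 => [|k kj].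
  by rewrite cfdotZl cfdotZr cfdot_X // eqxx mulr1 rmorphM aut_intr ?intr_int.
by rewrite cfdotZl cfdotZr cfdot_X // val_eqE eq_sym (negPf kj) !mulr0.
Qed.

Lemma vchar_eq0 c i : (i < 14)%N -> vvals c i == (0, 0) -> vchar c (r i) = 0.
Proof.
move=> lti; rewrite /vvals !foldr_ord xpair_eqE => /andP[/eqP E1 /eqP E2].
rewrite /vchar sum_cfunE.
transitivity ((\sum_(j < 10) c`_j * (nth (0, 0) (irr_table j) i).1)%:~R +
   (\sum_(j < 10) c`_j * (nth (0, 0) (irr_table j) i).2)%:~R * sqrt3); last first.
  by rewrite E1 E2 mul0r addr0.
rewrite !rmorph_sum mulr_suml -big_split; apply: eq_bigr => j _ /=.
by rewrite cfunE X_val // /tval !rmorphM; ring.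
Qed.

Lemma vchar_class_coef c a b : a \in [:: 1; 2]%N -> b \in [:: 1; 2]%N ->
  class_coef (r a) (r b) (vchar c) = (vcoef c a b)%:~R / 24.
Proof.
move=> ha hb; rewrite /vchar raddf_sum /vcoef foldr_ord rmorph_sum mulr_suml; apply: eq_bigr => j _ /=.
have := allP irr_table_rat j; rewrite mem_iota => /(_ (ltn_ord j))/and5P[d0 /eqP dE /eqP e0 /eqP e1 /eqP e2].
rewrite scaler_int raddfMz /= -mulrzl; move: dE; set q := (_ %/ _)%Z; move: q => q dE; rewrite !rmorphM /= -!mulrA; congr (_ * _).
have -> : class_coef (r a) (r b) (X j) = X j (r a) * X j (r b) / X j 1%g.
  by have /irrP[i ->] := X_irr (ltn_ord j); rewrite class_coef_irr.
have eab x : x \in [:: 1; 2]%N -> X j (r x) = ((nth (0, 0) (irr_table j) x).1)%:~R.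
  by rewrite !inE => /orP[]/eqP->; rewrite X_val // /tval ?e1 ?e2 mul0r addr0.
rewrite !eab // -r0 X_val // /tval e0 mul0r addr0 -mulrA; congr (_ * (_ * _)).
have := congr1 (intr : int -> algC) dE; rewrite rmorphM /= => dE'.
have d0' : ((nth (0, 0) (irr_table j) 0).1)%:~R != 0 :> algC by rewrite intr_eq0.
by apply: (mulfI d0'); rewrite divff // mulrA dE' divff // pnatr_eq0.
Qed.

End VirtualCharacters.

Lemma irr_table_exists : exists X : nat -> 'CF(H),
  [/\ forall j, (j < 10)%N -> X j \in irr H,
      forall j i, (j < 10)%N -> (i < 14)%N -> X j (r i) = tval (irr_table j) i
    & X 0 = 1].
Proof.
have [x1 i1 v1] := table_irr tableE; have [x2 i2 v2] := table_irr tableT1.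
have [x3 i3 v3] := table_irr tableT2; have [x4 i4 v4] := table_irr table61.
have [x5 i5 v5] := table_irr table63; have [x6 i6 v6] := table_irr table64.
have [x7 i7 v7] := table_irr table81; have [x8 i8 v8] := table_irr table82.
have [x9 i9 v9] := table_irr table12.
have v0 i : (i < 14)%N -> (1 : 'CF(H)) (r i) = tval (irr_table 0) i.
  move=> lti; rewrite cfun1E r_in /tval (_ : nth _ _ i = (1, 0)) /= ?mul0r ?addr0 //.
  by do 14?[case: i lti => [|i] lti //].
exists (nth 0 [:: 1; x1; x2; x3; x4; x5; x6; x7; x8; x9]).
split=> // [|j i]; first by do 10![case=> [_|]; first by rewrite ?cfun1_irr] => //.
case: j => [_|]; first exact: v0.
case=> [_|]; first exact: v1.
case=> [_|]; first exact: v2.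
case=> [_|]; first exact: v3.
case=> [_|]; first exact: v4.
case=> [_|]; first exact: v5.
case=> [_|]; first exact: v6.
case=> [_|]; first exact: v7.
case=> [_|]; first exact: v8.
by case=> [_|//]; exact: v9.
Qed.

(** * The six virtual characters induced to G *)

Section StronglyClosed.
Variable G : {group gT}.
Hypothesis sHG : H \subset G.
Hypothesis cJ : forall j, j \in J0^#%g -> 'C_G[j]%g \subset H.
Hypothesis scJ : strongly_closed J0 H G.

Let e1J : r 5 \in J0^#%g. Proof. by rewrite in_setD1 r_neq1 // r_J0. Qed.
Let j2J : r 6 \in J0^#%g. Proof. by rewrite in_setD1 r_neq1 // r_J0. Qed.
Let e1H : #|r 5 ^: H|%g = 6%N. Proof. by rewrite card_class_r. Qed.
Let j2H : #|r 6 ^: H|%g = 12%N. Proof. by rewrite card_class_r. Qed.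

Let t := r 1.
Let s := r 2.
Let Ht : t \in H. Proof. exact: r_in. Qed.
Let Hs : s \in H. Proof. exact: r_in. Qed.
Let t1 : t != 1%g. Proof. exact: r_neq1. Qed.
Let s1 : s != 1%g. Proof. exact: r_neq1. Qed.
Let t2 : (t ^+ 2 = 1)%g. Proof. by apply/eqP; rewrite r_order2. Qed.
Let s2 : (s ^+ 2 = 1)%g. Proof. by apply/eqP; rewrite r_order2. Qed.
Let t_e1 : commute t (r 5). Proof. by apply: r_commute; case/andP: reps_commute. Qed.
Let sj2 : commute s (r 6). Proof. by apply: r_commute; case/andP: reps_commute. Qed.
Let cs6 : ~~ (9 %| #|'C_H[s]%g :&: 'C[r 6]%g|)%N. Proof. by rewrite card_cent_r26. Qed.
Let invH u : u \in H -> (u ^+ 2 = 1)%g -> u != 1%g -> u \in (t ^: H :|: s ^: H)%g.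
Proof. by move=> Hu u2 u1; have [ut|us] := involution_class Hu u2 u1; rewrite in_setU ?ut ?us ?orbT. Qed.

Let A := J_roots H J0_group.

Let sAH : A \subset H.
Proof. by apply/subsetP=> h; rewrite in_set => /andP[]. Qed.

Let TI_A h g : h \in A -> g \in G -> (h ^ g)%g \in A -> g \in H.
Proof.
exact: (J_roots_TI sHG J0_normal J0_abelian card_J0 J0_cube cJ scJ e1J j2J e1H j2H).
Qed.

Let local x y u v : x \in [:: t; s] -> y \in [:: t; s] -> u \in (x ^: G)%g -> v \in (y ^: G)%g ->
  (u * v)%g \in A -> u \in (x ^: H)%g /\ v \in (y ^: H)%g.
Proof.
exact: (class_local sHG J0_normal J0_abelian card_J0 J0_cube cJ scJ e1J j2J e1H j2H
  Ht Hs t2 s2 t1 s1 t_e1 sj2 cs6 invH).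
Qed.

Lemma eq_of_degree3_char (chi : 'CF(G)) : chi \is a character -> chi 1%g = 3 -> chi t != 3 -> G :=: H.
Proof.
move=> chi_char chi3 chit.
have sJG : J0_group \subset G := subset_trans J0_sub sHG.
have rJ j : j \in J0_group -> (j ^+ 3 = 1)%g /\ chi j^-1%g = chi j.
  move=> Jj; split; first exact: J0_cube.
  by have /imsetP[y Hy ->] := J0_inverted Jj; rewrite cfunJ // (subsetP sHG).
have [|j Jj kj] := char3_ker chi_char chi3 sJG _ rJ; first by rewrite card_J0.
have [j1 Jj0] := setD1P Jj.
have nsKG : cfker chi <| G := cfker_normal chi.
have nsKH : (cfker chi :&: H <| H)%g.
  by rewrite /normal subsetIr normsI ?normG // (subset_trans sHG) ?normal_norm.
have Hj := subsetP J0_sub j Jj0.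
have sJK : J0 \subset (cfker chi :&: H)%g.
  by apply: (@J0_minnormal (cfker_group chi :&: H)%G nsKH j); rewrite // inE kj.
have ntK : t \notin (cfker chi :&: H)%g.
  by rewrite cfkerEchar // !inE chi3 (negPf chit) andbF.
apply: (normal_subgroup_J sHG J0_normal J0_abelian card_J0 J0_cube cJ scJ e1J j2J e1H j2H nsKG).
  by apply: subset_trans sJK (subsetIl _ _).
exact: (@J0_maximal (cfker_group chi :&: H)%G nsKH sJK ntK).
Qed.

(* Coordinates in [irr_table]: c4 is 8_1 - 6_3 - E, c3 is 6_3 - T1 - T2, c2 is
   8_1 + 1 - 6_1 - T2, c1 is 12 - 8_1 - 1 - T2, a1 is 6_3 - 6_4 and a2 is 8_1 - 8_2. *)
Let c4 : seq int := [:: 0; -1; 0; 0; 0; -1; 0; 1].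
Let c3 : seq int := [:: 0; 0; -1; -1; 0; 1].
Let c2 : seq int := [:: 1; 0; 0; -1; -1; 0; 0; 1].
Let c1 : seq int := [:: -1; 0; 0; -1; 0; 0; 0; -1; 0; 1].
Let a1 : seq int := [:: 0; 0; 0; 0; 0; 1; -1].
Let a2 : seq int := [:: 0; 0; 0; 0; 0; 0; 0; 1; -1].
Let cs := [:: c1; c2; c3; c4; a1; a2].

Let cs_vals : all (fun c => all (fun i => vvals c i == (0, 0)) (iota 0 5)) cs.
Proof. by vm_compute. Qed.

Theorem tabulated_strongly_closed : G :=: H.
Proof.
have [X [Xirr Xval X0]] := irr_table_exists.
(* By [class_roots] it is enough that the values at the representatives 0 to 4 are zero, which
   [cs_vals] checks. *)
have linA c : c \in cs -> vchar X c \in 'CF(H, A).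
  move=> cc; have ok := allP cs_vals c cc; apply/cfun_onP=> x xA.
  have [Hx|] := boolP (x \in H); last exact: cfun0.
  have [|i lti /imsetP[y Hy ->]] := class_roots Hx.
    by apply/eqP; move: xA; rewrite in_set Hx /= negbK.
  rewrite (cfunJ _ _ Hy) (vchar_eq0 Xval (leq_trans lti _)) //.
  by apply: (allP ok); rewrite mem_iota.
pose I c := 'Ind[G] (vchar X c).
have lin1 : vchar X [:: 1] = 1.
  rewrite /vchar big_ord_recl /= scale1r X0 big1 ?addr0 // => j _.
  by rewrite /= nth_nil scale0r.
have dot c d n : c \in cs -> d \in cs -> vdot c d = n -> '[I c, I d] = n%:~R.
  move=> cc dd <-; rewrite /I (cfdot_Ind_TI sHG sAH TI_A) ?linA //.
  exact: vchar_dot Xirr Xval c d.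
have dot1 c n : vdot c [:: 1] = n -> '[I c, 1] = n%:~R.
  by move=> <-; rewrite -Frobenius_reciprocity cfRes_cfun1 -lin1 (vchar_dot Xirr Xval).
(* The identity and the involutions have no conjugate in [A]; this gives weight and first moments
   zero. *)
have val0 c x : c \in cs -> (x ^+ 2 = 1)%g -> I c x = 0.
  move=> cc x2; apply: (cfInd_eq0 sHG (linA c cc)) => g _.
  exact: (involution_notin_J_roots H J0_cube g x2).
have coef c a b : c \in cs -> a \in [:: 1; 2]%N -> b \in [:: 1; 2]%N ->
  scaled_coef (class_scale G H (r a) * class_scale G H (r b)) (r a) (r b) (I c) = (vcoef c a b)%:~R / 24.
  move=> cc ha hb; rewrite (scaled_coef_Ind sHG (r_in a) (r_in b)).
    exact: vchar_class_coef.
  have ts x : x \in [:: 1; 2]%N -> r x \in [:: t; s].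
    by rewrite !inE => /orP[]/eqP->; rewrite eqxx ?orbT.
  move=> u v au bv nz; apply: local (ts a ha) (ts b hb) au bv _.
  by apply: contraNT nz => nA; have /cfun_onP/(_ _ nA) -> := linA c cc.
pose V x : {additive 'CF(G) -> algC} := scaled_val (class_scale G H x) x.
pose L x y : {additive 'CF(G) -> algC} := scaled_coef (class_scale G H x * class_scale G H y) x y.
pose V0 : {additive 'CF(G) -> algC} := scaled_val 1 1%g.
have V0_neq0 : {in dirr G, forall Y, V0 Y != 0}.
  by move=> Y dY; rewrite /V0 /= /scaled_val mul1r dirr1_neq0.
have LE x y : {in dirr G, forall Y, L x y Y * V0 Y = V x Y * V y Y}.
  by move=> Y dY; apply: scaled_coef_dirr.
have V0_1 : V0 1 = 1 by rewrite /V0 /= /scaled_val mul1r cfun11.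
have ZR : {subset [:: I c1; I c2; I c3; I c4; I a1; I a2] <= 'Z[irr G]}.
  move=> R RR; have /mapP[c _ ->] : R \in map I cs by [].
  by rewrite cfInd_vchar ?vchar_Z.
have VR : {in [:: I c1; I c2; I c3; I c4; I a1; I a2], forall R, [/\ V0 R = 0, V t R = 0 & V s R = 0]}.
  move=> R RR; have /mapP[c cc ->] : R \in map I cs by [].
  by rewrite /V0 /V /= /scaled_val !val0 ?mulr0 ?expg1n.
have R_1 : [/\ '[I c1, 1] = - 1, '[I c2, 1] = 1, '[I c3, 1] = 0 &
    [/\ '[I c4, 1] = 0, '[I a1, 1] = 0 & '[I a2, 1] = 0]].
  by split; last split; [exact: (dot1 c1 (-1) erefl)
     | exact: (dot1 c2 1 erefl)
     | exact: (dot1 c3 0 erefl)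
     | exact: (dot1 c4 0 erefl)
     | exact: (dot1 a1 0 erefl)
     | exact: (dot1 a2 0 erefl)].
have R_R4 : [/\ '[I c1, I c4] = - 1, '[I c2, I c4] = 1, '[I c3, I c4] = - 1 &
    [/\ '[I c4, I c4] = 3, '[I a1, I c4] = - 1 & '[I a2, I c4] = 1]].
  by split; last split; [exact: (dot c1 c4 (-1) isT isT erefl)
     | exact: (dot c2 c4 1 isT isT erefl)
     | exact: (dot c3 c4 (-1) isT isT erefl)
     | exact: (dot c4 c4 3 isT isT erefl)
     | exact: (dot a1 c4 (-1) isT isT erefl)
     | exact: (dot a2 c4 1 isT isT erefl)].
have R_R3 : [/\ '[I c1, I c3] = 1, '[I c2, I c3] = 1, '[I c3, I c3] = 3 &
    '[I a1, I c3] = 1 /\ '[I a2, I c3] = 0].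
  by split; last split; [exact: (dot c1 c3 1 isT isT erefl)
     | exact: (dot c2 c3 1 isT isT erefl)
     | exact: (dot c3 c3 3 isT isT erefl)
     | exact: (dot a1 c3 1 isT isT erefl)
     | exact: (dot a2 c3 0 isT isT erefl)].
have R_R2 : [/\ '[I c1, I c2] = - 1, '[I c2, I c2] = 4, '[I a1, I c2] = 0 & '[I a2, I c2] = 1].
  by split; [exact: (dot c1 c2 (-1) isT isT erefl)
     | exact: (dot c2 c2 4 isT isT erefl)
     | exact: (dot a1 c2 0 isT isT erefl)
     | exact: (dot a2 c2 1 isT isT erefl)].
have R_R1 : [/\ '[I c1, I c1] = 4, '[I a1, I c1] = 0 & '[I a2, I c1] = - 1].
  by split; [exact: (dot c1 c1 4 isT isT erefl)
     | exact: (dot a1 c1 0 isT isT erefl)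
     | exact: (dot a2 c1 (-1) isT isT erefl)].
have R_A : '[I a1, I a1] = 2 /\ '[I a2, I a2] = 2.
  by split; [exact: (dot a1 a1 2 isT isT erefl)
     | exact: (dot a2 a2 2 isT isT erefl)].
have ten c a b n q : c \in cs -> a \in [:: 1; 2]%N -> b \in [:: 1; 2]%N ->
    vcoef c a b = n -> n%:~R / 24 = q -> L (r a) (r b) (I c) = q.
  by move=> cc ha hb <- <-; apply: coef.
have T4 : [/\ L t t (I c4) = - (8 / 3), L t s (I c4) = 0 & L s s (I c4) = 0].
  by split; [by apply: (ten c4 1 1 (-64) _ isT isT isT erefl); field
     | by apply: (ten c4 1 2 0 _ isT isT isT erefl); field
     | by apply: (ten c4 2 2 0 _ isT isT isT erefl); field].
have T3 : [/\ L t t (I c3) = 0, L t s (I c3) = 0 & L s s (I c3) = - (2 / 3)].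
  by split; [by apply: (ten c3 1 1 0 _ isT isT isT erefl); field
     | by apply: (ten c3 1 2 0 _ isT isT isT erefl); field
     | by apply: (ten c3 2 2 (-16) _ isT isT isT erefl); field].
have T2 : [/\ L t t (I c2) = 0, L t s (I c2) = 4 / 3 & L s s (I c2) = 2 / 3].
  by split; [by apply: (ten c2 1 1 0 _ isT isT isT erefl); field
     | by apply: (ten c2 1 2 32 _ isT isT isT erefl); field
     | by apply: (ten c2 2 2 16 _ isT isT isT erefl); field].
have T1 : [/\ L t t (I c1) = - (4 / 3), L t s (I c1) = - (2 / 3) & L s s (I c1) = - 1].
  by split; [by apply: (ten c1 1 1 (-32) _ isT isT isT erefl); field
     | by apply: (ten c1 1 2 (-16) _ isT isT isT erefl); field
     | by apply: (ten c1 2 2 (-24) _ isT isT isT erefl); field].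
have [Y dY [Y3 Yt]] := degree3_constituent V0_neq0 (LE t t) (LE t s) (LE s s) V0_1 ZR VR
  R_1 R_R4 R_R3 R_R2 R_R1 R_A T4 T3 T2 T1.
rewrite /V0 /= /scaled_val mul1r in Y3.
(* The degree 3 is positive, so the sign is 1 and the constituent is an irreducible character. *)
case/dirrP: dY Y3 Yt => -[] [i ->] Y3 Yt.
  have : 0 < 3 :> algC by rewrite ltr0n.
  by rewrite -Y3 expr1 scaleN1r cfunE oppr_gt0 => /(lt_trans (irr1_gt0 i)); rewrite ltxx.
rewrite expr0 scale1r in Y3 Yt.
apply: (eq_of_degree3_char (irr_char i) Y3); apply: contra Yt => /eqP E.
by rewrite /V /= /scaled_val E cfun1E (subsetP sHG _ Ht) mulr1 mulrC.
Qed.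

End StronglyClosed.

End Tabulated.

Local Close Scope ring_scope.

Theorem theorem1p2 (gT : finGroupType) (G H J : {group gT}) :
  H \subset G ->
  H \isog K648 ->
  J :=: 'O_3(H) ->
  (forall j, j \in J^# -> 'C_G[j] \subset H) ->
  strongly_closed J H G ->
  G :=: H.
Proof.
move=> sHG /isogP[f injf fH] JE cJ scJ.
pose tb x := tab (f x).
have tbM : {in H &, forall x y, tb (x * y) = tcomp (tb x) (tb y)}.
  by move=> x y Hx Hy; rewrite /tb morphM // tabM.
have tb_inj : {in H &, injective tb} by move=> x y Hx Hy /tab_inj; apply: (injmP injf).
have tbH x : x \in H -> tb x \in Htabs.
  by move=> Hx; apply: tab_K648; rewrite -fH mem_morphim.
have tbS l : l \in Htabs -> exists2 x, x \in H & tb x = l.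
  by case/K648_tab=> p; rewrite -fH => /morphimP[x Hx _ ->] <-; exists x.
have [z z_prim] := C_prim_root_exists (isT : 0 < 12).
have z6 : (z ^+ 6 = -1)%R.
  have /eqP : (z ^+ 6 ^+ 2 = 1)%R by rewrite -exprM (prim_expr_order z_prim).
  rewrite sqrf_eq1 => /orP[|/eqP//]; by rewrite -(prim_order_dvd z_prim).
(* The 12th cyclotomic polynomial is the cofactor of [z ^+ 2 + 1] in [z ^+ 6 + 1], and [z ^+ 2 = -1]
   would give order 4. *)
have z4 : (z ^+ 4 = z ^+ 2 - 1)%R.
  have : ((z ^+ 2 + 1) * (z ^+ 4 - (z ^+ 2 - 1)) = 0)%R.
    have -> : ((z ^+ 2 + 1) * (z ^+ 4 - (z ^+ 2 - 1)) = z ^+ 6 + 1)%R by ring.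
    by rewrite z6 addNr.
  move/eqP; rewrite mulf_eq0 [X in _ || X]subr_eq0 => /orP[|/eqP//].
  rewrite addr_eq0 => /eqP z2; have : (z ^+ 4 == 1)%R by rewrite (exprM z 2 2) z2 sqrrN expr1n.
  by rewrite -(prim_order_dvd z_prim).
have zC : (z^* = z^-1)%R.
  have nz : (`|z| = 1)%R.
    apply/eqP; rewrite -(@pexpr_eq1 _ _ 12) // -normrX (prim_expr_order z_prim).
    by rewrite normr1.
  by rewrite invC_norm nz expr1n invr1 mul1r.
have JJ0 : J :=: J0 H tb by rewrite JE (J0E tbM tb_inj tbH tbS).
rewrite JJ0 in cJ scJ.
exact: (tabulated_strongly_closed tbM tb_inj tbH tbS z6 z4 zC sHG cJ scJ).
Qed.
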